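(* There are natural isomorphisms of $\mathcal A$-algebras $\mathbf S^{\jmath}\cong{}^{\mathbf C}\mathbf S^{\jmath}$ and $\mathbf S^{\imath}\cong{}^{\mathbf C}\mathbf S^{\imath}$ between the type $B$ and type $C$ convolution algebras. Here ''natural'' means: the first isomorphism is induced by the right $\mathbf H_{B_d}$-module isomorphism $\mathbf T_d\to{}^{\mathbf C}\mathbf T'_d$, $e_{r_1\cdots r_d}\mapsto e_{r_1\cdots r_d}$, through $\mathbf S^{\jmath}\cong\mathrm{End}_{\mathbf H_{B_d}}(\mathbf T_d)\cong\mathrm{End}_{\mathbf H_{B_d}}({}^{\mathbf C}\mathbf T'_d)\cong{}^{\mathbf C}\mathbf S^{\jmath}$, and the second is obtained in the same way from $\mathbf T_d^\imath$ and ${}^{\mathbf C}\mathbf T_d$.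
   Context: Let $\mathcal A=\mathbb Z[v,v^{-1}]$, $n,d\ge1$, $q$ an odd prime power. For a finite group $G$ acting on finite sets $P,P'$ (families over all odd $q$ with orbit parametrization independent of $q$), $\mathcal A_G(P\times P')$ denotes the free $\mathcal A$-module on the characteristic functions of $G$-orbits on $P\times P'$; convolution products $\mathcal A_G(P\times P')\times\mathcal A_G(P'\times P'')\to\mathcal A_G(P\times P'')$, $(f*g)(x,z)=\sum_yf(x,y)g(y,z)$, are defined with structure constants the polynomials in $v^2$ whose values at $v=\sqrt q$ are the counts over $\mathbb F_q$. Type $B$: $\mathbb F_q^{2d+1}$ with a nondegenerate symmetric form, isometry group $O(2d+1)$. $X$: flags $0=V_0\subseteq\cdots\subseteq V_{2n+1}=\mathbb F_q^{2d+1}$ with $V_i=V_{2n+1-i}^\perp$; ${}^\imath X\subset X$: those with $V_n$ maximal isotropic; $Y$: complete flags $F$ with $F_i=F_{2d+1-i}^\perp$. $\mathbf S^{\jmath}=\mathcal A_{O(2d+1)}(X\times X)$, $\mathbf S^{\imath}=\mathcal A_{O(2d+1)}({}^\imath X\times{}^\imath X)$, $\mathbf T_d=\mathcal A_{O(2d+1)}(X\times Y)$, $\mathbf T_d^\imath=\mathcal A_{O(2d+1)}({}^\imath X\times Y)$, and $\mathcal A_{O(2d+1)}(Y\times Y)=\mathbf H_{B_d}$, the Iwahori–Hecke algebra of type $B_d$. Type $C$: $\mathbb F_q^{2d}$ with a nondegenerate skew-symmetric form, isometry group $Sp(2d)$. $X_{\mathbf C_d}$: flags $0=V_0\subseteq\cdots\subseteq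 V_{2n}=\mathbb F_q^{2d}$ with $V_i=V_{2n-i}^\perp$; ${}'X_{\mathbf C_d}$: flags $0=V_0\subseteq\cdots\subseteq V_{2n+1}=\mathbb F_q^{2d}$ with $V_i=V_{2n+1-i}^\perp$; $Y_{\mathbf C_d}$: complete flags with $F_i=F_{2d-i}^\perp$. ${}^{\mathbf C}\mathbf S^{\imath}=\mathcal A_{Sp(2d)}(X_{\mathbf C_d}\times X_{\mathbf C_d})$, ${}^{\mathbf C}\mathbf S^{\jmath}=\mathcal A_{Sp(2d)}({}'X_{\mathbf C_d}\times{}'X_{\mathbf C_d})$, ${}^{\mathbf C}\mathbf T_d=\mathcal A_{Sp(2d)}(X_{\mathbf C_d}\times Y_{\mathbf C_d})$, ${}^{\mathbf C}\mathbf T'_d=\mathcal A_{Sp(2d)}({}'X_{\mathbf C_d}\times Y_{\mathbf C_d})$; $\mathcal A_{Sp(2d)}(Y_{\mathbf C_d}\times Y_{\mathbf C_d})$ is identified with $\mathbf H_{B_d}$ by matching, for $1\le j\le d$, the generators $T_j$ = characteristic function of $\{(F,F'):F_i=F'_i\ \forall i\in[1,d]\setminus\{j\},\,F_j\ne F'_j\}$. In each case, orbits on (partial flags)$\times$(complete flags) are indexed by sequences $r_1\cdots r_d$, $r_c$ being the unique $i$ with $\dim\,(V_{i-1}+V_i\cap F_c)/(V_{i-1}+V_i\cap F_{c-1})=1$; $e_{r_1\cdots r_d}$ is the characteristic function. The $r_c$ range over $[1,2n+1]$ for $\mathbf T_d$ and ${}^{\mathbf C}\mathbf T'_d$, over $[1,2n+1]\setminus\{n+1\}$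 for $\mathbf T^\imath_d$ and over $[1,2n]$ for ${}^{\mathbf C}\mathbf T_d$ (the last two sets being identified by the order-preserving bijection). *)

(* Defs.v *)
From HB Require Import structures.
From mathcomp Require Import all_boot all_order all_algebra.
From mathcomp Require Import boolp.
From Stdlib Require Import ClassicalEpsilon.

Set Implicit Arguments.
Unset Strict Implicit.
Unset Printing Implicit Defensive.

Import GRing.Theory.
Local Open Scope ring_scope.

Local Notation "p %:F" := (tofrac p).

(* Z[v, v^-1], as the subring of the fraction field of Z[X] consisting of the
   p / X^k. *)
Definition is_laurent : {pred {fraction {poly int}}} :=
  fun x => `[< exists (p : {poly int}) (k : nat), x = p%:F / ('X^k)%:F >].

Lemma Xn_frac_neq0 k : ('X^k : {poly int})%:F != 0.
Proof. by rewrite tofrac_eq0 monic_neq0 ?monicXn. Qed.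

Lemma is_laurent_subring : subring_closed is_laurent.
Proof.
split.
- by apply/asboolP; exists 1, 0%N; rewrite expr0 divff ?tofrac1 ?oner_neq0.
- move=> x y /asboolP[p [k ->]] /asboolP[q [l ->]]; apply/asboolP.
  exists (p * 'X^l - q * 'X^k), (k + l)%N.
  by rewrite -mulNr addf_div ?Xn_frac_neq0 // exprD !(tofracD, tofracN, tofracM) mulNr.
- move=> x y /asboolP[p [k ->]] /asboolP[q [l ->]]; apply/asboolP.
  by exists (p * q), (k + l)%N; rewrite mulf_div exprD !tofracM.
Qed.
HB.instance Definition _ :=
  GRing.isSubringClosed.Build {fraction {poly int}} is_laurent is_laurent_subring.

Definition laurent := {x : {fraction {poly int}} | x \in is_laurent}.
HB.instance Definition _ := SubChoice.on laurent.
HB.instance Definition _ := [SubChoice_isSubComNzRing of laurent by <:].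

Lemma is_laurentX : ('X : {poly int})%:F \in is_laurent.
Proof.
by apply/asboolP; exists 'X, 0%N; rewrite expr0 tofrac1 divr1.
Qed.

Definition v : laurent :=
  exist (fun x => x \in is_laurent) _ is_laurentX.

(* p(v^2), for p with integer coefficients. *)
Definition eval_v2 (p : {poly int}) : laurent :=
  (map_poly (fun c : int => c%:~R) p).[v ^+ 2].

Section Flags.
Variables (F : finFieldType) (m : nat) (b : 'M[F]_m).

(* Subspaces of F^m are row spaces of m x m matrices U normalised by
   <<U>>%MS = U, so that equality of matrices is equality of subspaces. *)
Definition flag N := {ffun 'I_N.+1 -> 'M[F]_m}.

Definition is_flag N (V : flag N) : bool :=
  [&& [forall i, <<V i>>%MS == V i], V ord0 == 0, V ord_max == 1%:M
    & [forall i : 'I_N.+1, forall j : 'I_N.+1, (i <= j)%N ==> (V i <= V j)%MS]].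

Definition selfdual N (V : flag N) : bool :=
  [forall i, (V i == orthomx idfun b (V (rev_ord i)))%MS].

Definition isotropic (U : 'M[F]_m) : bool := (U <= orthomx idfun b U)%MS.

Definition maximal_isotropic (U : 'M[F]_m) : bool :=
  isotropic U &&
  [forall W : 'M[F]_m, isotropic W && (U <= W)%MS ==> (W <= U)%MS].

Definition isometry (g : 'M[F]_m) : bool :=
  (g \in unitmx) && (g *m b *m g^T == b).

Definition act N (g : 'M[F]_m) (V : flag N) : flag N :=
  [ffun i => <<V i *m g>>%MS].

Definition same_orbit N N' (xy xy' : flag N * flag N') : bool :=
  [exists g : 'M[F]_m,
    isometry g && (xy' == (act g xy.1, act g xy.2))].

(* dim (V_i + V_{i+1} :&: W_{j+1}) / (V_i + V_{i+1} :&: W_j): the steps of a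
   flag are numbered from 0. *)
Definition step_dim N N' (V : flag N) (W : flag N') (i j : nat) : nat :=
  (\rank (V (inord i) + V (inord i.+1) :&: W (inord j.+1))%MS -
   \rank (V (inord i) + V (inord i.+1) :&: W (inord j))%MS)%N.

(* Relative position of two flags. It is invariant under isometries, and for
   the forms and kinds of flags below it separates the orbits of pairs, so it
   parametrizes them independently of F. *)
Definition position N N' (V : flag N) (W : flag N') : 'M['I_m.+1]_(N, N') :=
  \matrix_(i, j) inord (step_dim V W i j).

End Flags.

(* A kind of flags, defined uniformly over all finite fields and forms. *)
Record flag_kind := FlagKind {
  steps : nat;
  kind_cond : forall (F : finFieldType) (m : nat),
    'M[F]_m -> flag F m steps -> bool }.

Definition selfdual_flags (N : nat) : flag_kind :=
  @FlagKind N (fun F m b V => selfdual b V).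

Definition selfdual_flags_maxiso (n : nat) : flag_kind :=
  @FlagKind n.*2.+1
    (fun F m b V => selfdual b V && maximal_isotropic b (V (inord n))).

Definition complete_flags (m : nat) : flag_kind :=
  @FlagKind m (fun F _ b V =>
    selfdual b V && [forall i, \rank (V i) == i :> nat]).

(* eps = false: nondegenerate symmetric forms, with isometry group O(m);
   eps = true: nondegenerate skew-symmetric forms, with isometry group Sp(m).
   All finite fields of odd cardinality and all such forms are considered
   simultaneously. *)
Section Convolution.
Variables (eps : bool) (m : nat).

Definition admissible (F : finFieldType) (b : 'M[F]_m) : Prop :=
  [/\ odd #|F|, b \is (eps, (idfun : {rmorphism F -> F})).-sesqui & b \in unitmx].

Definition flags_of (P : flag_kind) (F : finFieldType) (b : 'M[F]_m) :
  {set flag F m (steps P)} := [set V | is_flag V && kind_cond b V].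

Definition has_position (P P' : flag_kind) (M : 'M['I_m.+1]_(steps P, steps P'))
    (F : finFieldType) (b : 'M[F]_m)
    (x : flag F m (steps P)) (y : flag F m (steps P')) : Prop :=
  [/\ x \in flags_of P b, y \in flags_of P' b & position x y = M].

(* Labels, independent of q, of the orbits on P x P'. *)
Definition orbits (P P' : flag_kind) : finType :=
  {M : 'M['I_m.+1]_(steps P, steps P') |
    `[< exists (F : finFieldType) (b : 'M[F]_m)
         (x : flag F m (steps P)) (y : flag F m (steps P')),
         admissible b /\ has_position M b x y >]}.

(* The free module over Z[v, v^-1] on the characteristic functions of orbits. *)
Definition orbit_module (P P' : flag_kind) : lmodType laurent :=
  {ffun orbits P P' -> laurent^o}.

Definition coef (P P' : flag_kind) (f : orbit_module P P') (M : orbits P P') :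
  laurent := (f : {ffun orbits P P' -> laurent^o}) M.

(* p(q) is, for every odd q, the number of y with (x, y) in the orbit labelled
   by M and (y, z) in the orbit labelled by M', when (x, z) is in the orbit
   labelled by M''; the first two orbits are given by representatives. *)
Definition is_structure_constant (P P' P'' : flag_kind)
    (M : orbits P P') (M' : orbits P' P'') (M'' : orbits P P'')
    (p : {poly int}) : Prop :=
  forall (F : finFieldType) (b : 'M[F]_m) x1 y1 y2 z2 x z,
    admissible b ->
    has_position (val M) b x1 y1 -> has_position (val M') b y2 z2 ->
    has_position (val M'') b x z ->
    p.[#|F|%:R] =
      #|[set y in flags_of P' b |
          same_orbit b (x1, y1) (x, y) && same_orbit b (y2, z2) (y, z)]|%:R.

Definition structure_constant (P P' P'' : flag_kind)
    (M : orbits P P') (M' : orbits P' P'') (M'' : orbits P P'') : {poly int} :=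
  epsilon (inhabits 0) (is_structure_constant M M' M'').

Definition conv (P P' P'' : flag_kind)
    (f : orbit_module P P') (g : orbit_module P' P'') : orbit_module P P'' :=
  [ffun M'' => \sum_M \sum_M'
     coef f M * coef g M' * eval_v2 (structure_constant M M' M'')].

(* The characteristic function of a set Q of pairs of flags which is a union of
   orbits, the same ones for all q. *)
Definition char_fun (P P' : flag_kind)
    (Q : forall F : finFieldType,
      flag F m (steps P) -> flag F m (steps P') -> bool) : orbit_module P P' :=
  [ffun M => (`[< forall (F : finFieldType) (b : 'M[F]_m) x y,
     admissible b -> has_position (val M) b x y -> Q F x y >] : bool)%:R].

Definition conv1 (P : flag_kind) : orbit_module P P :=
  char_fun (fun F x y => x == y).

(* T_{j+1}. *)
Definition hecke_gen (d : nat) (j : 'I_d) :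
    orbit_module (complete_flags m) (complete_flags m) :=
  char_fun (fun F x y =>
    [forall i : 'I_d, (x (inord i.+1) == y (inord i.+1)) == (i != j)]).

(* e_{r_1 ... r_d}, with the values r_c shifted to start from 0. *)
Definition seq_elt (P : flag_kind) (d : nat)
    (r : {ffun 'I_d -> 'I_(steps P)}) : orbit_module P (complete_flags m) :=
  char_fun (fun F x y => [forall c : 'I_d, step_dim x y (r c) c == 1%N]).

End Convolution.

Arguments orbit_module : clear implicits.
Arguments conv1 : clear implicits.
Arguments seq_elt : clear implicits.
Arguments hecke_gen : clear implicits.

Notation "f \conv g" := (conv f g) (at level 40, left associativity).

Definition algebra_iso (eps eps' : bool) (m m' : nat) (P P' : flag_kind)
    (h : {linear orbit_module eps m P P -> orbit_module eps' m' P' P'}) : Prop :=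
  [/\ bijective h, h (conv1 eps m P) = conv1 eps' m' P'
    & forall s t, h (s \conv t) = h s \conv h t].

(* H acts on the right of T. *)
Definition right_module (eps : bool) (m : nat) (P Y : flag_kind) : Prop :=
  (forall (t : orbit_module eps m P Y) (h h' : orbit_module eps m Y Y),
     (t \conv h) \conv h' = t \conv (h \conv h')) /\
  (forall t : orbit_module eps m P Y, t \conv conv1 eps m Y = t).

(* Left convolution is an isomorphism of algebras S -> End_H(T). *)
Definition endomorphism_iso (eps : bool) (m : nat) (P Y : flag_kind) : Prop :=
  let S := orbit_module eps m P P in
  let T := orbit_module eps m P Y in
  let H := orbit_module eps m Y Y in
  [/\ forall (s : S) (t : T) (h : H), s \conv (t \conv h) = (s \conv t) \conv h,
      forall (s s' : S) (t : T), (s \conv s') \conv t = s \conv (s' \conv t),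
      forall t : T, conv1 eps m P \conv t = t
    & forall f : {linear T -> T},
        (forall (t : T) (h : H), f (t \conv h) = f t \conv h) ->
        exists! s : S, forall t : T, f t = s \conv t].

(* Given the identification psi of the Hecke algebras H and H': the module
   isomorphism phi : T -> T' matching the families e and e' exists, and the
   isomorphism theta : S -> S' it induces through
   S = End_H(T) = End_H(T') = S' exists (phi o s o phi^-1 is left convolution
   by theta s). *)
Definition natural_iso (eps eps' : bool) (m m' : nat) (P Y P' Y' : flag_kind)
    (psi : {linear orbit_module eps m Y Y -> orbit_module eps' m' Y' Y'})
    (I : Type) (e : I -> orbit_module eps m P Y)
    (e' : I -> orbit_module eps' m' P' Y') : Prop :=
  exists (phi : {linear orbit_module eps m P Y -> orbit_module eps' m' P' Y'})
         (theta : {linear orbit_module eps m P P -> orbit_module eps' m' P' P'}),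
  [/\ [/\ right_module eps m P Y, right_module eps' m' P' Y',
          endomorphism_iso eps m P Y & endomorphism_iso eps' m' P' Y'],
      [/\ bijective phi, forall r, phi (e r) = e' r
        & forall t h, phi (t \conv h) = phi t \conv psi h],
      algebra_iso theta
    & forall s t, phi (s \conv t) = theta s \conv phi t].

(* The order-preserving bijection from [1, 2n] to [1, 2n + 1] \ {n + 1},
   applied termwise. *)
Definition skip_middle (n d : nat) (r : {ffun 'I_d -> 'I_(n.*2)}) :
    {ffun 'I_d -> 'I_(n.*2.+1)} :=
  [ffun c => lift (inord n : 'I_(n.*2.+1)) (r c)].

(* Main.v *)
From HB Require Import structures.
From mathcomp Require Import all_boot all_order all_fingroup all_algebra.
From mathcomp Require Import zify ring.
From mathcomp Require Import boolp.
From Stdlib Require Import ClassicalEpsilon.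
Require Import Defs.

Set Implicit Arguments.
Unset Strict Implicit.
Unset Printing Implicit Defensive.
Import GRing.Theory.
Local Open Scope ring_scope.

(* Everything is expressed through the label r of a pair (V, C), C complete: r_c is
   the step of V in which the line C_c / C_(c-1) appears. The flags C' which agree
   with C except in C_j and its orthogonal number q + 1; on them the label of
   (V, C') takes the values r and s_j r, where s_j exchanges r_j and r_(j+1), or
   replaces r_d by its opposite step when j = d. If the two differ, one flag has
   the smaller label and q have the larger. Hence the formula for e_r T_j, and so
   all structure constants for products with T_w, only involve the order of the
   steps and the duality exchanging opposite steps. Both survive the removal of the
   middle step, which makes e_r |-> e_r an isomorphism of modules over H.

   That labels separate orbits is seen by sorting them within the blocks of the
   second flag, which reduces to pairs (V, C) with C complete; two such pairs with
   the same label have adapted bases whose Gram matrices differ, after a diagonal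
   change, by a unipotent matrix, and Newton's iteration extracts its square root.

   For S = End_H(T), the elements e_R0 with R0 sorted generate T over H, and R0
   satisfies e_R0 T_j = q e_R0 for every s_j fixing it. If f is H-linear the
   coefficients of f(e_R0) are therefore invariant under these s_j; the orbits of
   these reflections are the orbits on P x P lying over R0, so f is the left
   convolution by a unique element of S. *)

(** * Subspaces and forms *)

(** The two groups act in different dimensions, and the comparison is possible because the last
    reflection has the same parameter q in both types: its panel is a conic in a nondegenerate
    quadratic 3-space in type B and a projective line in type C, and both have q + 1 points. The
    sign [eps] keeps the two types in one argument, with [m = d.*2 + ~~ eps].

    A structure constant is chosen by [epsilon], so nothing is known of a product before a counting
    polynomial, uniform in the field and in the form, is shown to exist; for partial flags no closed
    formula is used, only a reduction to complete flags. Moreover a label is only known to occur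
    over some field. Therefore labels are compared across two fields, every label is realised over
    every field, and identities in q are proved by evaluation at odd primes, where they become
    counts of flags. The algebra S itself is never computed: its isomorphism with the type C algebra
    comes from the uniqueness in its description by endomorphisms. *)

Section Subspaces.
Variables (F : fieldType) (m : nat).
Implicit Types U V W : 'M[F]_m.

Lemma eqmx_rank_sub p q (U : 'M[F]_(p, m)) (V : 'M[F]_(q, m)) :
  (U <= V)%MS -> (\rank V <= \rank U)%N -> (U :=: V)%MS.
Proof.
move=> UV rUV; apply/eqmxP.
by rewrite -(geq_leqif (mxrank_leqif_eq UV)).
Qed.

(** [U :&: W + V] lies between [V] and [W], whose ranks differ by at most one, so modularity leaves
    only two values. *)
Lemma rank_cap_leq1 U V W : (V <= W)%MS -> (\rank W <= (\rank V).+1)%N ->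
  \rank (U :&: W)%MS = (\rank (U :&: V)%MS + ~~ (U :&: W <= V)%MS)%N.
Proof.
move=> VW rW; have s1 : (U :&: V <= U :&: W)%MS by apply: capmxS.
case: (boolP (U :&: W <= V)%MS) => [UWV|nUWV] /=; rewrite ?addn0 ?addn1.
  apply/eqP; rewrite eqn_leq (mxrankS s1) andbT mxrankS //.
  by rewrite sub_capmx capmxSl.
have := mxrank_sum_cap (U :&: W)%MS V.
have -> : \rank (U :&: W :&: V)%MS = \rank (U :&: V)%MS.
  by rewrite -capmxA; apply/eqmx_rank/andP; split;
     rewrite capmxS // ?capmxSr // sub_capmx VW /=.
have le1 : (\rank (U :&: W + V)%MS <= (\rank V).+1)%N.
  by apply: leq_trans rW; apply: mxrankS; rewrite addsmx_sub capmxSr.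
have gt1 : (\rank V < \rank (U :&: W + V)%MS)%N.
  apply: rank_ltmx; rewrite ltmxE addsmxSr /=.
  by apply: contra nUWV => /(submx_trans _); apply; apply: addsmxSl.
lia.
Qed.

Lemma exists_row_notin p q (U : 'M[F]_(p, m)) (V : 'M[F]_(q, m)) :
  ~~ (U <= V)%MS -> exists2 u : 'rV[F]_m, (u <= U)%MS & ~~ (u <= V)%MS.
Proof. by case/row_subPn=> i nV; exists (row i U); rewrite ?row_sub. Qed.

Lemma rank_adds_row U (u : 'rV[F]_m) : ~~ (u <= U)%MS ->
  \rank (U + u)%MS = (\rank U).+1.
Proof.
move=> nU; have := mxrank_sum_cap U u.
have -> : \rank (U :&: u)%MS = 0.
  apply/eqP; rewrite mxrank_eq0; apply: contraNT nU => nz.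
  have : (u <= (U :&: u))%MS.
    have /eqmx_rank_sub -> // : (U :&: u <= u)%MS by apply: capmxSr.
    by rewrite rank_rV (leq_trans (leq_b1 _)) // lt0n mxrank_eq0.
  by move/submx_trans; apply; apply: capmxSl.
rewrite rank_rV addn0 => ->.
by case: eqP nU => [->|_ _]; rewrite ?sub0mx ?addn1.
Qed.

End Subspaces.

Section Quadratic.
Variable F : finFieldType.
Hypothesis oddF : odd #|F|.

(** Lagrange in the additive group gives [#|F|%:R = 0]; if 2 were 0, the odd cardinality would turn
    this into 1 = 0. *)
Lemma two_neq0 : 2%:R != 0 :> F.
Proof.
apply/negP => /eqP e.
have : (#|F|%:R : F) = 0.
  have /dvdnP[k ->] : (#[(1%R : F)]%g %| #|F|)%N.
    by rewrite -cardsT; apply: cardSg (subsetT _).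
  rewrite mulnC natrM; suff -> : (#[(1%R : F)]%g)%:R = 0 :> F by rewrite mul0r.
  exact: (expg_order (1%R : F)).
rewrite -(odd_double_half #|F|) oddF -muln2 natrD natrM e mulr0 addr0.
by apply/eqP; rewrite oner_neq0.
Qed.

(** The fibres of squaring have at most two elements, and the resulting bound is strict because
    [#|F|] is odd. *)
Lemma card_squares : (#|F| < #|[set x ^+ 2 | x in [set: F]]|.*2)%N.
Proof.
have le2 : (#|F| <= \sum_(s in [set x ^+ 2 | x in [set: F]]) 2)%N.
  rewrite -cardsT -sum1_card (partition_big_imset (fun x : F => x ^+ 2)) /=.
  apply: leq_sum => s /imsetP[r _ ->]; rewrite sum1dep_card.
  apply: leq_trans (_ : #|[set r; - r]| <= _)%N.
    by apply/subset_leq_card/subsetP => x; rewrite !inE eqf_sqr.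
  by rewrite cards2; case: (_ != _).
move: le2; rewrite sum_nat_const muln2 leq_eqVlt => /orP[/eqP e|//].
by move: oddF; rewrite e odd_double.
Qed.

(** The values of [a * x ^+ 2] and those of [c - b * y ^+ 2] each fill more than half of the field,
    so they meet. *)
Lemma binary_form_represents (a b c : F) : a != 0 -> b != 0 ->
  exists x y, a * x ^+ 2 + b * y ^+ 2 = c.
Proof.
move=> a0 b0; set S := [set x ^+ 2 | x in [set: F]].
have cA : #|[set a * s | s in S]| = #|S| by apply/card_imset/mulfI.
have cB : #|[set c - b * s | s in S]| = #|S|.
  by apply: card_imset => x y /addrI /oppr_inj /(mulfI b0).
have : [set a * s | s in S] :&: [set c - b * s | s in S] != set0.
  have := cardsUI [set a * s | s in S] [set c - b * s | s in S].
  rewrite -card_gt0 cA cB; move: card_squares; rewrite -/S.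
  move: (_ :&: _) (_ :|: _) => I U; have : (#|U| <= #|F|)%N := max_card _; lia.
case/set0Pn=> z /setIP[/imsetP[_ /imsetP[x _ ->] ->] /imsetP[_ /imsetP[y _ ->] e]].
by exists x, y; rewrite e subrK.
Qed.

End Quadratic.

Section Form.
Variables (F : finFieldType) (eps : bool) (m : nat) (b : 'M[F]_m).
Hypothesis adm : admissible eps b.

Definition orth (U : 'M[F]_m) : 'M[F]_m := orthomx idfun b U.
Arguments orth U%_MS.

Lemma form_tr : b^T = (-1) ^+ eps *: b.
Proof.
case: adm => _ /sesquiP e _.
have -> : b^T = (-1) ^+ eps *: ((-1) ^+ eps *: b^T).
  by rewrite scalerA -expr2 sqrr_sign scale1r.
by congr (_ *: _); rewrite [RHS]e map_mx_id.
Qed.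

Lemma form_unit : b \in unitmx. Proof. by case: adm. Qed.
Lemma odd_field : odd #|F|. Proof. by case: adm. Qed.

Lemma sub_orth p (A : 'M[F]_(p, m)) (U : 'M[F]_m) :
  (A <= orth U)%MS = (A *m b *m U^T == 0).
Proof. by rewrite /orth /orthomx map_mx_id // sub_kermx mulmxA. Qed.

Lemma form0C p q (A : 'M[F]_(p, m)) (B : 'M[F]_(q, m)) :
  (A *m b *m B^T == 0) = (B *m b *m A^T == 0).
Proof.
rewrite -(inj_eq (can_inj (@trmxK _ _ _))) !trmx_mul trmxK form_tr trmx0.
by rewrite -scalemxAl -scalemxAr mulmxA scaler_eq0 signr_eq0.
Qed.

Lemma sub_orthC (U V : 'M[F]_m) : (U <= orth V)%MS = (V <= orth U)%MS.
Proof. by rewrite !sub_orth form0C. Qed.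

Lemma rank_orth (U : 'M[F]_m) : \rank (orth U) = (m - \rank U)%N.
Proof.
rewrite /orth /orthomx map_mx_id // mxrank_ker.
by rewrite -mxrank_tr trmx_mul trmxK mxrankMfree // row_free_unit unitmx_tr form_unit.
Qed.

Lemma orthS (U V : 'M[F]_m) : (U <= V)%MS -> (orth V <= orth U)%MS.
Proof. by move=> UV; rewrite sub_orthC (submx_trans UV) // sub_orthC. Qed.

Lemma orthK (U : 'M[F]_m) : (orth (orth U) :=: U)%MS.
Proof.
apply/eqmx_sym/eqmx_rank_sub; first by rewrite sub_orthC.
by rewrite !rank_orth subKn // rank_leq_row.
Qed.

Lemma eqmx_orth (U V : 'M[F]_m) : (U :=: V)%MS -> (orth U :=: orth V)%MS.
Proof. by move=> e; apply/eqmxP/andP; split; apply: orthS; rewrite e. Qed.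

Lemma sub_orth_adds p (A : 'M[F]_(p, m)) (U V : 'M[F]_m) :
  (A <= orth (U + V)%MS)%MS = (A <= orth U)%MS && (A <= orth V)%MS.
Proof.
apply/idP/andP => [s|[s1 s2]].
  by split; apply: (submx_trans s); apply: orthS; rewrite ?addsmxSl ?addsmxSr.
have : ((U + V)%MS <= orth <<A>>)%MS.
  by rewrite addsmx_sub !(sub_orthC _ <<A>>%MS) !genmxE s1.
by rewrite sub_orthC genmxE.
Qed.

Lemma rank_cap_orth (U V : 'M[F]_m) :
  (\rank (orth U :&: orth V)%MS = m - (\rank U + \rank V - \rank (U :&: V)%MS))%N.
Proof.
have -> : (\rank U + \rank V - \rank (U :&: V)%MS = \rank (U + V)%MS)%N.
  by rewrite -mxrank_sum_cap addnK.
rewrite -rank_orth; apply/eqmx_rank/andP; split.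
  by rewrite sub_orth_adds capmxSl capmxSr.
by rewrite sub_capmx !orthS ?addsmxSl ?addsmxSr.
Qed.

Lemma rank_isotropic (U : 'M[F]_m) : isotropic b U -> ((\rank U).*2 <= m)%N.
Proof.
move=> /mxrankS; rewrite -[orthomx _ _ _]/(orth U) rank_orth.
by have := rank_leq_row U; lia.
Qed.

Lemma skew_row_isotropic (u : 'rV[F]_m) : eps -> u *m b *m u^T = 0.
Proof.
move=> e; have : (u *m b *m u^T)^T = - (u *m b *m u^T).
  by rewrite !trmx_mul trmxK form_tr e expr1 scaleN1r mulNmx mulmxN mulmxA.
rewrite [X in X^T]mx11_scalar tr_scalar_mx -mx11_scalar => /eqP.
rewrite -addr_eq0 -mulr2n -scaler_nat scaler_eq0 (negPf (two_neq0 odd_field)).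
by move/eqP.
Qed.

(** For a skew form any vector orthogonal to [U] and outside [U] will do. For a symmetric form the
    quotient of [orth U] by [U] has dimension at least 3, and a quadratic form in three variables
    over a finite field has a nontrivial zero. *)
Lemma exists_isotropic_row (d : nat) (U : 'M[F]_m) : m = (d.*2 + ~~ eps)%N ->
  isotropic b U -> (\rank U < d)%N ->
  exists u : 'rV[F]_m,
    [/\ (u <= orth U)%MS, ~~ (u <= U)%MS & u *m b *m u^T = 0].
Proof.
move=> md isoU rU.
have pick p (W : 'M[F]_(p, m)) : (\rank U < \rank W)%N ->
    exists2 u : 'rV[F]_m, (u <= W)%MS & ~~ (u <= U)%MS.
  by move=> r; apply: exists_row_notin; apply: contraL r => /mxrankS; lia.
case: (boolP eps) md => [e md|e /= md].
  have [|u s n] := pick _ (orth U); first by rewrite rank_orth; lia.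
  by exists u; rewrite skew_row_isotropic.
have symb (u w : 'rV[F]_m) : w *m b *m u^T = u *m b *m w^T.
  have : (w *m b *m u^T)^T = u *m b *m w^T.
    by rewrite !trmx_mul trmxK form_tr (negPf e) expr0 scale1r mulmxA.
  by rewrite [X in X^T]mx11_scalar tr_scalar_mx -mx11_scalar.
have rcap (W : 'M[F]_m) (u : 'rV[F]_m) :
    ((\rank W).-1 <= \rank (W :&: orth <<u>>))%N.
  have := mxrank_sum_cap W (orth <<u>>); rewrite rank_orth mxrank_gen rank_rV.
  have := rank_leq_row (W + orth <<u>>)%MS; case: (u != 0) => /=; lia.
have [|e1 s1 n1] := pick _ (orth U); first by rewrite rank_orth; lia.
case: (eqVneq (e1 *m b *m e1^T) 0) => [z|nz1]; first by exists e1.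
have r1 := rcap (orth U) e1; rewrite rank_orth in r1.
have [|e2 s2 n2] := pick _ (orth U :&: orth <<e1>>)%MS; first by lia.
case: (eqVneq (e2 *m b *m e2^T) 0) => [z|nz2].
  by exists e2; split=> //; apply: submx_trans s2 (capmxSl _ _).
have r2 := rcap (orth U :&: orth <<e1>>)%MS e2.
have [|e3 s3 n3] := pick _ (orth U :&: orth <<e1>> :&: orth <<e2>>)%MS; first by lia.
move: s2 s3; rewrite !sub_capmx => /andP[s2 o21] /andP[/andP[s3 o31] o32].
have orthE (u w : 'rV[F]_m) : (u <= orth <<w>>)%MS -> u *m b *m w^T = 0.
  move=> o; apply/eqP; rewrite form0C; rewrite sub_orth form0C in o.
  have /submxP[D ->] : (w <= <<w>>)%MS by rewrite genmxE.
  by rewrite -!mulmxA (mulmxA _ b) (eqP o) mulmx0.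
have {}o21 := orthE _ _ o21; have {}o31 := orthE _ _ o31.
have {}o32 := orthE _ _ o32.
pose Q (u : 'rV[F]_m) : F := (u *m b *m u^T) 0 0.
have nQ u : u *m b *m u^T != 0 -> Q u != 0.
  by apply: contra => /eqP q0; rewrite [_ *m _]mx11_scalar -/(Q u) q0 raddf0.
(* The binary form on the orthogonal vectors [e1], [e2] takes the value [- Q e3], which makes
   [x *: e1 + y *: e2 + e3] isotropic. *)
have [x [y xy]] := binary_form_represents odd_field (- Q e3) (nQ _ nz1) (nQ _ nz2).
case: (eqVneq (e3 *m b *m e3^T) 0) => [z|nz3]; first by exists e3.
have trE : (x *: e1 + y *: e2 + e3)^T = x *: e1^T + y *: e2^T + e3^T.
  by rewrite !raddfD /= !linearZ.
exists (x *: e1 + y *: e2 + e3); split.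
- by rewrite !addmx_sub ?scalemx_sub.
(* [e3] is orthogonal to [U], while its pairing with the new vector is [Q e3]. *)
- apply: contra nz3 => inU.
  have : (e3 *m b *m (x *: e1 + y *: e2 + e3)^T) == 0.
    rewrite form0C; have /submxP[D ->] := inU.
    by move: s3; rewrite sub_orth form0C -!mulmxA => /eqP ->; rewrite mulmx0.
  by rewrite trE !mulmxDr -!scalemxAr o31 o32 !scaler0 !add0r.
- rewrite trE !mulmxDl !mulmxDr -?scalemxAl -?scalemxAr -?scalemxAl.
  rewrite ?mulmxDl -?scalemxAl.
  rewrite (symb e2 e1) (symb e3 e1) (symb e3 e2) o21 o31 o32.
  rewrite !scaler0 !addr0 !add0r !scalerA.
  rewrite [_ *m e1^T]mx11_scalar [_ *m e2^T]mx11_scalar [_ *m e3^T]mx11_scalar.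
  rewrite !scale_scalar_mx -!raddfD /= -/(Q e1) -/(Q e2) -/(Q e3).
  apply/matrixP=> i j; rewrite !mxE; rewrite (_ : _ + _ = 0) ?mul0rn //.
  by rewrite -!expr2 (mulrC _ (Q e1)) (mulrC _ (Q e2)) xy addNr.
Qed.

End Form.

Arguments orth {F m} b U%_MS.

(** The sum is the last index at which [p] holds. In this threshold form, counting definitions such
    as that of [jump] become statements about a single subspace. *)
Lemma ltn_count_antitone (N : nat) (p : nat -> bool) :
  p 0 -> (forall i j, (i <= j)%N -> (j <= N)%N -> p j -> p i) ->
  forall i, (i <= N)%N -> (\sum_(k < N) p k.+1 < i)%N = ~~ p i.
Proof.
move=> p0 anti i iN; rewrite -(big_mkord xpredT (fun k => p k.+1 : nat)).
case: (boolP (p i)) => pi /=; apply/negbTE || idtac.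
  rewrite -leqNgt (big_cat_nat (n := i)) //= (eq_big_nat _ _ (F2 := fun=> 1)).
    by rewrite sum_nat_const_nat subn0 muln1 leq_addr.
  by move=> k /andP[_ ki]; rewrite (anti k.+1 i).
have i0 : (0 < i)%N by case: i pi {iN} => //; rewrite p0.
rewrite (big_cat_nat (n := i.-1)) //=; last by lia.
rewrite [X in (_ + X)%N]big_nat_cond [X in (_ + X)%N]big1 ?addn0; last first.
  move=> k /andP[/andP[ik kN] _]; case: (boolP (p k.+1)) => // pk.
  by case/negP: pi; apply: anti pk => //; lia.
apply: leq_ltn_trans (_ : i.-1 < i)%N; last by lia.
rewrite -[X in (_ <= X)%N]subn0 -[X in (_ <= X)%N]muln1 -sum_nat_const_nat.
by apply: leq_sum => k _; apply: leq_b1.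
Qed.

(** * Flags and labels *)

Section Flags.
Variables (F : finFieldType) (m : nat).

(** Natural-number indices keep arithmetic such as [N - i] free of casts. An index beyond [N] falls
    back to step 0, so the lemmas bound theirs. *)
Definition subsp N (V : flag F m N) (i : nat) : 'M[F]_m := V (inord i).

Definition rcap N N' (V : flag F m N) (W : flag F m N') (i j : nat) : nat :=
  \rank (subsp V i :&: subsp W j).

(* The paper's r_(c+1) - 1: the inclusion fails from step r_(c+1) on, so it holds
   for the first r_(c+1) - 1 steps of [V]. *)
Definition jump N N' (V : flag F m N) (W : flag F m N') (c : nat) : nat :=
  \sum_(i < N) (subsp V i.+1 :&: subsp W c.+1 <= subsp W c)%MS.

Section IsFlag.
Variables (N : nat) (V : flag F m N).
Hypothesis flagV : is_flag V.

Lemma genmx_subsp i : <<subsp V i>>%MS = subsp V i.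
Proof. by case/and4P: flagV => /forallP /(_ (inord i)) /eqP. Qed.

Lemma subsp0 : subsp V 0 = 0.
Proof.
case/and4P: flagV => _ /eqP <- _ _; rewrite /subsp; congr (V _).
by apply/val_inj; rewrite /= inordK.
Qed.

Lemma subsp_last : subsp V N = 1%:M.
Proof.
case/and4P: flagV => _ _ /eqP <- _; rewrite /subsp; congr (V _).
by apply/val_inj; rewrite /= inordK.
Qed.

Lemma subspS i j : (i <= j)%N -> (j <= N)%N -> (subsp V i <= subsp V j)%MS.
Proof.
move=> ij jN; case/and4P: flagV => _ _ _ /forallP /(_ (inord i)).
by move=> /forallP /(_ (inord j)); rewrite !inordK ?ij //= ltnS (leq_trans ij).
Qed.

End IsFlag.

Lemma subsp_inj N (V W : flag F m N) : is_flag V -> is_flag W ->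
  (forall i, (i <= N)%N -> (subsp V i :=: subsp W i)%MS) -> V = W.
Proof.
move=> fV fW e; apply/ffunP=> i; have /eqmxP/genmxP := e i (ltn_ord i).
by rewrite !genmx_subsp // /subsp inord_val.
Qed.

Lemma rcapC N N' (V : flag F m N) (W : flag F m N') i j :
  rcap V W i j = rcap W V j i.
Proof. by rewrite /rcap capmxC. Qed.

Section Step.
Variables (N N' : nat) (V : flag F m N) (W : flag F m N').
Hypotheses (fV : is_flag V) (fW : is_flag W).

Lemma rank_step i j : (i < N)%N ->
  (\rank (subsp V i + subsp V i.+1 :&: subsp W j)%MS + rcap V W i j =
   \rank (subsp V i) + rcap V W i.+1 j)%N.
Proof.
move=> iN; have := mxrank_sum_cap (subsp V i) (subsp V i.+1 :&: subsp W j)%MS.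
suff -> : \rank (subsp V i :&: (subsp V i.+1 :&: subsp W j))%MS = rcap V W i j by [].
apply/eqmx_rank/andP; split; first by rewrite capmxS // capmxSr.
by rewrite !sub_capmx capmxSl capmxSr andbT (submx_trans (capmxSl _ _)) ?subspS.

Qed.

Lemma step_dim_le i j : (step_dim V W i j <= m)%N.
Proof. by rewrite (leq_trans (leq_subr _ _)) ?rank_leq_row. Qed.

(** [step_dim] is the mixed second difference of [rcap], written without subtraction. *)
Lemma step_dimE i j : (i < N)%N -> (j < N')%N ->
  (step_dim V W i j + rcap V W i.+1 j + rcap V W i j.+1 =
   rcap V W i.+1 j.+1 + rcap V W i j)%N.
Proof.
move=> iN jN; have e1 := rank_step j iN; have e2 := rank_step j.+1 iN.
have : (\rank (subsp V i + subsp V i.+1 :&: subsp W j)%MS <=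
        \rank (subsp V i + subsp V i.+1 :&: subsp W j.+1)%MS)%N.
  by apply/mxrankS/addsmxS => //; apply: capmxS => //; apply: subspS.
by rewrite /step_dim -!/(subsp _ _); lia.
Qed.

Lemma sum_step_dim i j : (i <= N)%N -> (j <= N')%N ->
  (\sum_(i' < i) \sum_(j' < j) step_dim V W i' j')%N = rcap V W i j.
Proof.
move=> + jN; elim: i => [|i IH] iN; first by rewrite big_ord0 /rcap subsp0 // cap0mx mxrank0.
rewrite big_ord_recr /= IH 1?ltnW //.
have : (\sum_(j' < j) step_dim V W i j' + rcap V W i j = rcap V W i.+1 j)%N.
  elim: j jN {IH} => [|j IHj] jN; first by rewrite big_ord0 /rcap subsp0 // !capmx0 !mxrank0.
  have := IHj (ltnW jN); have := step_dimE iN jN; rewrite big_ord_recr /=; lia.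
by rewrite addnC.
Qed.

(** The inverse of taking second differences: partial sums of a position matrix recover the ranks of
    intersections, without mention of a field. *)
Definition pos_rcap (M : 'M['I_m.+1]_(N, N')) (i j : nat) : nat :=
  \sum_(i' < N | (i' < i)%N) \sum_(j' < N' | (j' < j)%N) M i' j'.

Lemma position_rcap i j : (i <= N)%N -> (j <= N')%N ->
  pos_rcap (position V W) i j = rcap V W i j.
Proof.
move=> iN jN; rewrite -sum_step_dim //.
rewrite (big_ord_widen N (fun i' => \sum_(j' < j) step_dim V W i' j')%N) //.
apply: eq_bigr => i' _; rewrite (big_ord_widen N' (step_dim V W i')) //.
by apply: eq_bigr => j' _; rewrite mxE inordK // ltnS step_dim_le.
Qed.

End Step.
End Flags.

(** The two fields may differ: this is what carries a position found over one field to another. *)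
Lemma eq_position (F F' : finFieldType) m N N' (V : flag F m N) (W : flag F m N')
    (V' : flag F' m N) (W' : flag F' m N') :
  is_flag V -> is_flag W -> is_flag V' -> is_flag W' ->
  (position V W = position V' W' <->
   forall i j, (i <= N)%N -> (j <= N')%N -> rcap V W i j = rcap V' W' i j).
Proof.
move=> fV fW fV' fW'; split => [e i j iN jN|e].
  by rewrite -!position_rcap // e.
apply/matrixP=> i j; rewrite !mxE; congr inord.
have := step_dimE fV fW (ltn_ord i) (ltn_ord j).
have := step_dimE fV' fW' (ltn_ord i) (ltn_ord j).
by rewrite !e //; try exact: ltnW; lia.
Qed.

Section Chambers.
Variables (F : finFieldType) (eps : bool) (m : nat) (b : 'M[F]_m).

Definition sdflag N (V : flag F m N) := is_flag V && selfdual b V.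
Definition chamber (C : flag F m m) := C \in flags_of (complete_flags m) b.

Lemma sdflag_flag N (V : flag F m N) : sdflag V -> is_flag V.
Proof. by case/andP. Qed.

Lemma subsp_orth N (V : flag F m N) i : sdflag V -> (i <= N)%N ->
  (subsp V i :=: orth b (subsp V (N - i)))%MS.
Proof.
case/andP=> _ /forallP /(_ (inord i)) /eqmxP e iN.
rewrite /subsp; suff -> : inord (N - i) = rev_ord (inord i) :> 'I_N.+1 by exact: e.
by apply/val_inj; rewrite /= !inordK // ltnS leq_subr.
Qed.

Lemma subsp_isotropic N (V : flag F m N) i : sdflag V -> (i.*2 <= N)%N ->
  isotropic b (subsp V i).
Proof.
move=> sV iN; rewrite /isotropic -[orthomx _ _ _]/(orth b (subsp V i)).
have := subsp_orth sV (leq_subr i N); rewrite subKn => [<-|]; last by lia.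
by apply: subspS; [exact: sdflag_flag|lia|lia].
Qed.

Lemma chamberP C : reflect (sdflag C /\ forall i, (i <= m)%N -> \rank (subsp C i) = i)
  (chamber C).
Proof.
rewrite /chamber inE /=; apply: (iffP and3P) => [[fC sC /forallP rC]|[/andP[fC sC] rC]].
  split=> [|i im]; first exact/andP.
  by have /eqP := rC (inord i); rewrite inordK.
split=> //; apply/forallP=> i; apply/eqP.
by have := rC i (leq_ord i); rewrite /subsp inord_val.
Qed.

Lemma chamber_sdflag C : chamber C -> sdflag C. Proof. by case/chamberP. Qed.
Lemma chamber_flag C : chamber C -> is_flag C.
Proof. by move/chamber_sdflag/sdflag_flag. Qed.
Lemma chamber_rank C i : chamber C -> (i <= m)%N -> \rank (subsp C i) = i.
Proof. by case/chamberP=> _; apply. Qed.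

Section Jump.
Variables (N : nat) (V : flag F m N) (C : flag F m m).
Hypotheses (sV : is_flag V) (chC : chamber C).

Lemma ltn_jump c i : (i <= N)%N ->
  (jump V C c < i)%N = ~~ (subsp V i :&: subsp C c.+1 <= subsp C c)%MS.
Proof.
move=> iN; rewrite /jump.
apply: (ltn_count_antitone (p := fun i => subsp V i :&: subsp C c.+1 <= subsp C c)%MS) => //.
  by rewrite subsp0 // cap0mx sub0mx.
by move=> k l kl lN; apply: submx_trans; apply: capmxS => //; apply: subspS.
Qed.

Lemma jump_lt c : (c < m)%N -> (jump V C c < N)%N.
Proof.
move=> cm; rewrite ltn_jump // subsp_last //.
apply/negP => /mxrankS; rewrite cap1mx chamber_rank //.
by rewrite chamber_rank ?ltnn // ltnW.
Qed.

Lemma rcap_jump i c : (i <= N)%N -> (c <= m)%N ->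
  rcap V C i c = (\sum_(c' < c) (jump V C c' < i))%N.
Proof.
move=> iN; elim: c => [|c IH] cm.
  by rewrite big_ord0 /rcap subsp0 ?chamber_flag // capmx0 mxrank0.
rewrite big_ord_recr /= -(IH (ltnW cm)) (ltn_jump c iN) /rcap.
apply: rank_cap_leq1; first exact: subspS (chamber_flag chC) _ _ _ _.
by rewrite !chamber_rank // ltnW.
Qed.

Lemma sum_jump i : (i <= N)%N -> \rank (subsp V i) = (\sum_(c < m) (jump V C c < i))%N.
Proof.
move=> iN; rewrite -rcap_jump // /rcap subsp_last ?chamber_flag //.
by rewrite (capmx_idPl (submx1 _)).
Qed.

Lemma step_dim_jump i c : (i < N)%N -> (c < m)%N ->
  step_dim V C i c = (jump V C c == i) :> nat.
Proof.
move=> iN cm; have := step_dimE sV (chamber_flag chC) iN cm.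
rewrite !(@rcap_jump _ c) ?(@rcap_jump _ c.+1) // 1?ltnW //.
by rewrite !big_ord_recr /=; have := ltngtP (jump V C c) i; case => /=; lia.
Qed.

End Jump.

Hypothesis adm : admissible eps b.

Lemma rank_subsp_dual N (V : flag F m N) i : sdflag V -> (i <= N)%N ->
  \rank (subsp V (N - i)) = (m - \rank (subsp V i))%N.
Proof.
move=> sV iN; rewrite (subsp_orth sV iN) (rank_orth adm) subKn //.
by rewrite rank_leq_row.
Qed.

(** Passing to orthogonals expresses the rank of [V_(N - i) :&: C_(m - k)] through that of
    [V_i :&: C_k]. Comparing [k = c] with [k = c + 1] shows that opposite lines of [C] fall in
    opposite steps of [V]; the first [d] jumps therefore determine the others. *)
Lemma jump_dual N (V : flag F m N) C c : sdflag V -> chamber C -> (c < m)%N ->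
  jump V C (m.-1 - c) = (N.-1 - jump V C c)%N.
Proof.
move=> sV chC cm; have fV := sdflag_flag sV; have sC := chamber_sdflag chC.
have dual i : (i <= N)%N -> (jump V C (m.-1 - c) < N - i)%N = ~~ (jump V C c < i)%N.
  move=> iN; have ci : (m - c = (m.-1 - c).+1)%N by lia.
  have key k : (k <= m)%N -> rcap V C (N - i) (m - k) =
      (m - (\rank (subsp V i) + k - rcap V C i k))%N.
    move=> km; rewrite {1}/rcap.
    have e1 := subsp_orth sV (leq_subr i N); have e2 := subsp_orth sC (leq_subr k m).
    rewrite (cap_eqmx e1 e2) !subKn // (rank_cap_orth adm).
    by rewrite chamber_rank.
  have := key c (ltnW cm); have := key c.+1 cm.
  have -> : (m - c.+1 = m.-1 - c)%N by lia.
  rewrite ci !(@rcap_jump _ _ _ _ _ _ _.+1) //; try lia.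
  rewrite !big_ord_recr /= -!rcap_jump //; try lia.
  have : (\rank (subsp V i) + c.+1 - rcap V C i c.+1 <= m)%N.
    rewrite -{1}(chamber_rank chC cm) /rcap -mxrank_sum_cap addnK.
    exact: rank_leq_row.
  rewrite (@rcap_jump _ _ _ _ _ _ _.+1) //= big_ord_recr /= -rcap_jump //; try lia.
  have : (rcap V C i c <= c)%N.
    by rewrite -{2}(chamber_rank chC (ltnW cm)) mxrankS ?capmxSr.
  have : (rcap V C i c <= \rank (subsp V i))%N by rewrite mxrankS ?capmxSl.
  by case: (_ < N - i)%N; case: (_ < i)%N => /=; lia.
have j1 := jump_lt fV chC cm.
have j2 : (jump V C (m.-1 - c) < N)%N by apply: jump_lt => //; lia.
have := dual (jump V C c) (ltnW j1); have := dual (jump V C c).+1 j1.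
by rewrite ltnn ltnSn /=; lia.
Qed.

Definition lab d N (V : flag F m N) (C : flag F m m) : seq nat := mkseq (jump V C) d.

Lemma nth_lab d N (V : flag F m N) C c : (c < d)%N -> nth 0%N (lab d V C) c = jump V C c.
Proof. by move=> cd; rewrite nth_mkseq. Qed.

Lemma size_lab d N (V : flag F m N) C : size (lab d V C) = d.
Proof. exact: size_mkseq. Qed.

End Chambers.

(* The extension of a label to [0, m), where m = 2d or 2d + 1, by the symmetry
   of the relative position of two self-dual flags. *)
Definition lext (m d N : nat) (r : seq nat) (c : nat) : nat :=
  if (c < d)%N then nth 0%N r c
  else if (c < m - d)%N then N./2 else (N.-1 - nth 0%N r (m.-1 - c))%N.

Section LabelExtension.
Variables (F : finFieldType) (eps : bool) (m d : nat) (b : 'M[F]_m).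
Hypothesis adm : admissible eps b.
Hypothesis md : m = (d.*2 + ~~ eps)%N.
Variables (N : nat) (V : flag F m N) (C : flag F m m).
Hypotheses (sV : sdflag b V) (chC : chamber b C).

Lemma jump_lext c : (c < m)%N -> jump V C c = lext m d N (lab d V C) c.
Proof.
move=> cm; rewrite /lext; case: ifP => cd; first by rewrite nth_lab.
have jN := jump_lt (sdflag_flag sV) chC cm; have du := jump_dual adm sV chC cm.
case: ifP => cmd; last by rewrite nth_lab; lia.
have e : (m.-1 - c = c)%N by lia.
by rewrite e in du; lia.
Qed.

End LabelExtension.

(** * Complete flags refining a self-dual flag *)

Section Build.
Variables (F : finFieldType) (eps : bool) (m d : nat) (b : 'M[F]_m).
Hypothesis adm : admissible eps b.
Hypothesis md : m = (d.*2 + ~~ eps)%N.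
Local Notation orth := (orth b).
Local Notation chamber := (chamber b).
Local Notation sdflag := (sdflag b).

Lemma isotropicS (U W : 'M[F]_m) : (U <= W)%MS -> isotropic b W -> isotropic b U.
Proof. by move=> UW iW; apply: submx_trans UW (submx_trans iW (orthS adm UW)). Qed.

Lemma isotropic_adds (U : 'M[F]_m) (u : 'rV[F]_m) : isotropic b U ->
  (u <= orth U)%MS -> u *m b *m u^T = 0 -> isotropic b (U + u)%MS.
Proof.
move=> iU uU uu; rewrite /isotropic -[orthomx _ _ _]/(orth (U + u)%MS).
rewrite -(eqmx_orth adm (adds_eqmx (eqmx_refl U) (genmxE u))).
have iU' : (U <= orth U)%MS := iU.
rewrite (sub_orth_adds adm) !addsmx_sub iU' uU /=.
have su : (U <= orth <<u>>)%MS by rewrite (sub_orthC adm) genmxE.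
rewrite su /= sub_orth; have /submxP[D ->] : (<<u>> <= u)%MS by rewrite genmxE.
by rewrite trmx_mul mulmxA uu mul0mx.
Qed.

(** A self-dual complete flag is determined by its isotropic half [h 0], ..., [h d]; the values of
    [h] beyond [d] are not consulted. *)
Definition mkflag (h : nat -> 'M[F]_m) : flag F m m :=
  [ffun i : 'I_m.+1 => if (i <= d)%N then <<h i>>%MS else <<orth (h (m - i)%N)>>%MS].

Section MkFlag.
Variable h : nat -> 'M[F]_m.

Lemma mkflag_half c : (c <= d)%N -> (subsp (mkflag h) c :=: h c)%MS.
Proof. by move=> cd; rewrite /subsp ffunE inordK ?cd; [exact: genmxE | lia]. Qed.

Lemma mkflag_dual c : (d < c)%N -> (c <= m)%N ->
  (subsp (mkflag h) c :=: orth (h (m - c)))%MS.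
Proof.
move=> dc cm; rewrite /subsp ffunE inordK // leqNgt dc /=; exact: genmxE.
Qed.

Hypotheses (rh : forall c, (c <= d)%N -> \rank (h c) = c)
  (hS : forall c, (c < d)%N -> (h c <= h c.+1)%MS) (ih : isotropic b (h d)).

Lemma mkflag_hS i j : (i <= j)%N -> (j <= d)%N -> (h i <= h j)%MS.
Proof.
elim: j => [|j IH]; first by rewrite leqn0 => /eqP ->.
rewrite leq_eqVlt => /orP[/eqP -> //|ij] jd.
by apply: submx_trans (hS jd); apply: IH => //; apply: ltnW.
Qed.

Lemma mkflag_chamber : chamber (mkflag h).
Proof.
have ih' : (h d <= orth (h d))%MS := ih.
have rk c : (c <= m)%N -> \rank (subsp (mkflag h) c) = c.
  move=> cm; case: (leqP c d) => cd; first by rewrite mkflag_half // rh.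
  by rewrite mkflag_dual // (rank_orth adm) rh; lia.
apply/chamberP; split=> //; apply/andP; split.
  apply/and4P; split.
  - by apply/forallP=> i; rewrite ffunE; case: ifP; rewrite genmx_id.
  - by rewrite -mxrank_eq0 -(inord_val ord0) -/(subsp _ _) rk.
  - have gen : <<mkflag h ord_max>>%MS = mkflag h ord_max.
      by rewrite ffunE; case: ifP; rewrite genmx_id.
    rewrite -gen -genmx1; apply/eqP/genmxP.
    rewrite submx1 sub1mx /row_full -[mkflag h ord_max](_ : subsp (mkflag h) m = _).
      by rewrite rk ?leqnn //= eqxx.
    by rewrite /subsp; congr (mkflag h _); apply/val_inj; rewrite /= inordK.
  - apply/forallP=> i; apply/forallP=> j; apply/implyP=> ij.
    have jm := leq_ord j; rewrite -(inord_val i) -(inord_val j) -!/(subsp _ _).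
    move: (nat_of_ord i) (nat_of_ord j) ij jm => {i j} i j ij jm.
    case: (leqP j d) => jd.
      by rewrite !mkflag_half ?mkflag_hS //; apply: leq_trans jd.
    have jmd : (m - j <= d)%N by lia.
    rewrite (mkflag_dual jd jm); case: (leqP i d) => id.
      rewrite mkflag_half //; apply: submx_trans (mkflag_hS id (leqnn d)) _.
      by apply: (submx_trans ih'); apply: (orthS adm); apply: mkflag_hS.
    by rewrite mkflag_dual ?(leq_trans ij) //; apply: (orthS adm); apply: mkflag_hS; lia.
apply/forallP=> i; apply/eqmxP.
have -> : mkflag h (rev_ord i) = subsp (mkflag h) (m - i).
  by rewrite /subsp; congr (mkflag h _); apply/val_inj; rewrite /= inordK // ltnS leq_subr.
rewrite -{1}(inord_val i) -[mkflag h (inord i)]/(subsp (mkflag h) i).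
rewrite -[orthomx _ _ _]/(orth _); have := leq_ord i.
move: (nat_of_ord i) => {i} i im.
case: (ltnP d i) => di.
  apply: (eqmx_trans (mkflag_dual di im)); apply/eqmx_sym/(eqmx_orth adm)/mkflag_half.
  by lia.
apply: (eqmx_trans (mkflag_half di)).
(* The remaining case is [m = 2d], [i = d], where [h d] is Lagrangian and equals its own
   orthogonal. *)
case: (ltnP d (m - i)) => dmi; last first.
  have -> : i = d by lia.
  have -> : (m - d = d)%N by lia.
 apply: (@eqmx_trans _ _ _ _ _ _ (orth (h d))); last first.
    exact/(eqmx_orth adm)/eqmx_sym/mkflag_half.
  by apply: eqmx_rank_sub => //; rewrite (rank_orth adm) rh //; lia.
have e := mkflag_dual dmi (leq_subr i m); rewrite subKn // in e.
apply: (eqmx_trans _ (eqmx_sym (eqmx_orth adm e))).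
exact/eqmx_sym/(orthK adm).
Qed.

End MkFlag.

Lemma subsp_chamber_dual C c : chamber C -> (c <= m)%N ->
  (subsp C c :=: orth (subsp C (m - c)))%MS.
Proof. by move=> chC cm; apply: subsp_orth (chamber_sdflag chC) cm. Qed.

Lemma chamber_eq C C' : chamber C -> chamber C' ->
  (forall c, (c <= d)%N -> (subsp C c :=: subsp C' c)%MS) -> C = C'.
Proof.
move=> chC chC' e; apply: (subsp_inj (chamber_flag chC) (chamber_flag chC')).
move=> c cm; case: (leqP c d) => cd; first exact: e.
apply: (eqmx_trans (subsp_chamber_dual chC cm)).
apply: (eqmx_trans _ (eqmx_sym (subsp_chamber_dual chC' cm))).
by apply: (eqmx_orth adm); apply: e; lia.
Qed.

Definition refines N (C : flag F m m) (V : flag F m N) : bool :=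
  [forall i, V i == C (inord (\rank (V i)))].

Lemma refinesP N C (V : flag F m N) : is_flag C -> is_flag V ->
  reflect (forall i, (i <= N)%N -> (subsp V i :=: subsp C (\rank (subsp V i)))%MS)
    (refines C V).
Proof.
move=> fC fV; apply: (iffP forallP) => [e i iN|e i].
  by rewrite {1}/subsp (eqP (e (inord i))).
have /eqmxP/genmxP := e i (leq_ord i).
by rewrite !genmx_subsp // /subsp inord_val => e'; apply/eqP.
Qed.

(** The isotropic half grows by one vector at a time, staying comparable with every isotropic member
    of [V]. Comparable spaces of equal rank coincide, which gives the refinement below the middle;
    duality gives the rest. *)
Lemma exists_chamber_refining N (V : flag F m N) : sdflag V ->
  exists2 C, chamber C & refines C V.
Proof.
move=> sV; have fV := sdflag_flag sV.
have main k : (k <= d)%N -> exists h : nat -> 'M[F]_m,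
  [/\ forall c, (c <= k)%N -> \rank (h c) = c,
      forall c, (c < k)%N -> (h c <= h c.+1)%MS, isotropic b (h k)
    & forall i c, (i.*2 <= N)%N -> (c <= k)%N ->
        (subsp V i <= h c)%MS || (h c <= subsp V i)%MS].
  elim: k => [|k IH] kd.
    exists (fun=> 0); split=> //; first by move=> c; rewrite leqn0 mxrank0 => /eqP.
      exact: sub0mx.
    by move=> i c _ _; rewrite sub0mx orbT.
  have [h [rh hS ih cmp]] := IH (ltnW kd).
  have [u [nu uh iu cu]] : exists u : 'rV[F]_m, [/\ ~~ (u <= h k)%MS,
     (h k + u <= h k + u)%MS, isotropic b (h k + u)%MS & forall i, (i.*2 <= N)%N ->
        (subsp V i <= h k + u)%MS || (h k + u <= subsp V i)%MS].
    (* The new vector is drawn from the smallest isotropic member of [V] not yet contained in [h k],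
       or from [exists_isotropic_row] once there is none. *)
    pose P i := (i.*2 <= N)%N && ~~ (subsp V i <= h k)%MS.
    case: (pselect (exists i, P i)) => [exP|nP].
      case: (ex_minnP exP) => i /andP[iN nVi] imin.
      have [u uV nu] := exists_row_notin nVi.
      have hV : (h k <= subsp V i)%MS.
        by have := cmp i k iN (leqnn k); rewrite (negPf nVi).
      have huV : (h k + u <= subsp V i)%MS by rewrite addsmx_sub hV.
      exists u; split=> //; first exact: isotropicS huV (subsp_isotropic sV iN).
      move=> i' iN'; case: (leqP i i') => ii'.
        apply/orP; right; apply: submx_trans huV (subspS fV ii' _).
        by apply: leq_trans iN'; rewrite -addnn leq_addr.
      apply/orP; left; apply: submx_trans (addsmxSl _ _).
      by apply: contraTT ii' => nV; rewrite -leqNgt imin // /P iN'.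
    have rk : (\rank (h k) < d)%N by rewrite rh.
    have [u [uo nu uu]] := exists_isotropic_row adm md ih rk.
    exists u; split=> //; first exact: isotropic_adds.
    move=> i iN; apply/orP; left; apply: submx_trans (addsmxSl _ _).
    by apply: contraT => nV; case: nP; exists i; rewrite /P iN.
  exists (fun c => if (c <= k)%N then h c else (h k + u)%MS); split.
  - move=> c; rewrite leq_eqVlt => /orP[/eqP ->|]; last first.
      by rewrite ltnS => ck; rewrite ck rh.
    by rewrite ltnn rank_adds_row // rh.
  - move=> c ck1; case: (eqVneq c k) => [->|nk]; first by rewrite leqnn ltnn addsmxSl.
    have ck : (c < k)%N by lia.
    by rewrite (ltnW ck) ck hS.
  - by rewrite ltnn.
  - move=> i c iN; rewrite leq_eqVlt => /orP[/eqP ->|]; last first.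
      by rewrite ltnS => ck; rewrite ck cmp.
    by rewrite ltnn cu.
have [h [rh hS ih cmp]] := main d (leqnn d).
have chC := mkflag_chamber rh hS ih; exists (mkflag h) => //.
have half i : (i.*2 <= N)%N -> (subsp V i :=: subsp (mkflag h) (\rank (subsp V i)))%MS.
  move=> iN; have rd : (\rank (subsp V i) <= d)%N.
    by have := rank_isotropic adm (subsp_isotropic sV iN); lia.
  have e1 := mkflag_half h rd.
  apply: eqmx_trans (eqmx_sym e1).
  have /orP[s|s] := cmp i _ iN rd; first by apply: eqmx_rank_sub; rewrite // rh.
  by apply/eqmx_sym/eqmx_rank_sub; rewrite // rh.
apply/refinesP; rewrite ?(chamber_flag chC) // => i iN.
case: (leqP i.*2 N) => iN2; first exact: half.
have i'N : ((N - i).*2 <= N)%N by lia.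
apply: (eqmx_trans (subsp_orth sV iN)).
apply: (eqmx_trans _ (eqmx_sym (subsp_chamber_dual chC (rank_leq_row _)))).
rewrite -(rank_subsp_dual adm sV iN); apply: (eqmx_orth adm); exact: half.
Qed.

End Build.

(** * Panels *)

(* The value which the j-th simple reflection exchanges with entry j. *)
Definition lpartner (d N j : nat) (r : seq nat) : nat :=
  if (j.+1 < d)%N then nth 0%N r j.+1 else (N.-1 - nth 0%N r j)%N.

(** The j-th simple reflection of the Weyl group of type B acting on labels. For [j.+1 = d] the
    second test never succeeds, so only the last entry changes, to its opposite. *)
Definition lrefl (d N j : nat) (r : seq nat) : seq nat :=
  mkseq (fun c => if c == j then lpartner d N j r
                  else if c == j.+1 then nth 0%N r j else nth 0%N r c) d.

Section Panels.
Variables (F : finFieldType) (eps : bool) (m d : nat) (b : 'M[F]_m).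
Hypothesis adm : admissible eps b.
Hypothesis md : m = (d.*2 + ~~ eps)%N.
Local Notation orth := (orth b).
Local Notation chamber := (chamber b).
Local Notation sdflag := (sdflag b).

Definition adjacent (j : nat) (C C' : flag F m m) : bool :=
  [forall i : 'I_d, (i != j :> nat) ==> (C (inord i.+1) == C' (inord i.+1))].

Definition panel (j : nat) (C : flag F m m) : {set flag F m m} :=
  [set C' | chamber C' && adjacent j C C'].

Lemma mem_panel j C : chamber C -> C \in panel j C.
Proof. by move=> chC; rewrite inE chC /=; apply/forallP=> i; rewrite eqxx implybT. Qed.

Lemma panel_chamber j C C' : C' \in panel j C -> chamber C'.
Proof. by rewrite inE => /andP[]. Qed.

Lemma subsp_panel j C C' c : (j < d)%N -> chamber C -> C' \in panel j C -> (c <= m)%N ->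
  c != j.+1 -> c != (m - j.+1)%N -> subsp C' c = subsp C c.
Proof.
move=> jd chC pC' cm cj cmj; have chC' := panel_chamber pC'.
have half k : (k <= d)%N -> k != j.+1 -> subsp C' k = subsp C k.
  case: k => [|k] kd kj; first by rewrite !subsp0 ?(chamber_flag chC) ?(chamber_flag chC').
  move: pC'; rewrite inE => /andP[_ /forallP /(_ (Ordinal kd)) /= /implyP e].
  by rewrite /subsp (eqP (e _)).
case: (leqP c d) => cd; first exact: half.
rewrite -(genmx_subsp (chamber_flag chC')) -(genmx_subsp (chamber_flag chC)).
apply/genmxP/eqmxP/(eqmx_trans (subsp_chamber_dual chC' cm)).
apply: eqmx_trans (eqmx_sym (subsp_chamber_dual chC cm)).
by rewrite half //; lia.
Qed.

(** The first index beyond [j.+1] at which all flags of the panel agree. The quotient by step [j] is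
    a plane, except for symmetric forms with [j.+1 = d], where it is a nondegenerate quadratic
    3-space. *)
Definition panel_top (j : nat) : nat := if (j.+1 < d)%N then j.+2 else (m - j)%N.

Lemma subsp_panel_bot j C C' : (j < d)%N -> chamber C -> C' \in panel j C ->
  subsp C' j = subsp C j.
Proof. by move=> jd chC pC'; rewrite (subsp_panel jd chC pC') //; lia. Qed.

Lemma subsp_panel_top j C C' : (j < d)%N -> chamber C -> C' \in panel j C ->
  subsp C' (panel_top j) = subsp C (panel_top j).
Proof.
by move=> jd chC pC'; rewrite /panel_top; case: ifP => jd';
  rewrite (subsp_panel jd chC pC') //; lia.
Qed.

Section Labels.
Variables (N : nat) (V : flag F m N).
Hypothesis sV : sdflag V.

(* The middle term is the contribution of the middle step when m is odd. *)
Lemma rcap_panel j C i : (j < d)%N -> chamber C -> (i <= N)%N ->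
  (rcap V C i (panel_top j) = rcap V C i j + (nth 0%N (lab d V C) j < i) +
     (lpartner d N j (lab d V C) < i) + (~~ eps && (j.+1 == d) && (N./2 < i)))%N.
Proof.
move=> jd chC iN; have fV := sdflag_flag sV.
have jl c : (c < m)%N -> jump V C c = lext m d N (lab d V C) c.
  exact: (jump_lext adm md sV chC).
rewrite /panel_top /lpartner; case: ifP => jd'.
  rewrite !(rcap_jump fV chC iN) ?big_ord_recr /=; try lia.
  by rewrite !nth_lab //; lia.
have ej : j.+1 = d by lia.
have rl : jump V C (m.-1 - j) = (N.-1 - nth 0%N (lab d V C) j)%N.
  by rewrite nth_lab // (jump_dual adm) //; lia.
have [mj|mj] : (m - j = j.+2)%N /\ eps \/ (m - j = j.+3)%N /\ ~~ eps by case: eps md => /=; lia.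
  case: mj => mj ->; rewrite mj !(rcap_jump fV chC iN) ?big_ord_recr /=; try lia.
  have -> : jump V C j.+1 = (N.-1 - nth 0%N (lab d V C) j)%N.
    by rewrite -rl; congr (jump V C _); lia.
  by rewrite nth_lab //=; lia.
case: mj => mj ->; rewrite mj !(rcap_jump fV chC iN) ?big_ord_recr /=; try lia.
have e2 : jump V C j.+2 = (N.-1 - nth 0%N (lab d V C) j)%N.
  by rewrite -rl; congr (jump V C _); lia.
have e1 : jump V C j.+1 = N./2.
  by rewrite jl ?/lext; [case: ifP => ?; [lia | case: ifP => // ?; lia] | lia].
by rewrite e1 e2 ej eqxx nth_lab //=; lia.
Qed.

Lemma lab_lt j C : (j < d)%N -> chamber C -> (nth 0%N (lab d V C) j < N)%N.
Proof. by move=> jd chC; rewrite nth_lab //; apply: (jump_lt (sdflag_flag sV) chC); lia. Qed.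

Lemma lpartner_lt j C : (j < d)%N -> chamber C -> (lpartner d N j (lab d V C) < N)%N.
Proof.
move=> jd chC; rewrite /lpartner; case: ifP => jd'; first exact: lab_lt.
by have := lab_lt jd chC; lia.
Qed.

(** The panel has a fixed bottom and a fixed top, so by [rcap_panel] the threshold counts of the
    unordered pair formed by entry [j] and its partner are constant. They determine its minimum and
    its maximum. *)
Lemma panel_values j C C' : (j < d)%N -> chamber C -> C' \in panel j C ->
  let r := lab d V C in let r' := lab d V C' in
  (nth 0%N r' j = nth 0%N r j /\ lpartner d N j r' = lpartner d N j r) \/
  (nth 0%N r' j = lpartner d N j r /\ lpartner d N j r' = nth 0%N r j).
Proof.
move=> jd chC pC' r r'; have chC' := panel_chamber pC'.
have key i : (i <= N)%N -> ((nth 0%N r' j < i) + (lpartner d N j r' < i) =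
    (nth 0%N r j < i) + (lpartner d N j r < i))%N.
  move=> iN; have := rcap_panel jd chC' iN; have := rcap_panel jd chC iN.
  rewrite /rcap (subsp_panel_bot jd chC pC') (subsp_panel_top jd chC pC') -/r -/r'.
  by move=> ->; lia.
have := lab_lt jd chC; have := lab_lt jd chC'; have := lpartner_lt jd chC.
have := lpartner_lt jd chC'; rewrite -/r -/r'.
move: (nth 0%N r j) (nth 0%N r' j) (lpartner d N j r) (lpartner d N j r') key => x x' y y' key.
move=> y'N yN x'N xN.
have min_le u v u' v' : ((u' < (minn u' v').+1) + (v' < (minn u' v').+1) =
    (u < (minn u' v').+1) + (v < (minn u' v').+1))%N -> (minn u v <= minn u' v')%N.
  by clear; lia.
have max_le u v u' v' : ((u' < (maxn u v).+1) + (v' < (maxn u v).+1) =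
    (u < (maxn u v).+1) + (v < (maxn u v).+1))%N -> (maxn u' v' <= maxn u v)%N.
  by clear; lia.
have e1 : minn x y = minn x' y'.
  apply/eqP; rewrite eqn_leq min_le ?key ?min_le //; first by apply/esym/key; rewrite gtn_min xN.
  by rewrite gtn_min x'N.
have e2 : maxn x y = maxn x' y'.
  apply/eqP; rewrite eqn_leq max_le; first rewrite max_le //.
    by apply: key; rewrite gtn_max xN.
  by apply/esym/key; rewrite gtn_max x'N.
by clear -e1 e2; lia.
Qed.

Lemma lab_panel_fix j C C' c : (j < d)%N -> chamber C -> C' \in panel j C ->
  (c < d)%N -> c != j -> c != j.+1 -> nth 0%N (lab d V C') c = nth 0%N (lab d V C) c.
Proof.
move=> jd chC pC' cd cj cj1; rewrite !nth_lab // /jump.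
by apply: eq_bigr => i _; rewrite !(subsp_panel jd chC pC') //; lia.
Qed.

Lemma lab_panel_eq j C C' C'' : (j < d)%N -> chamber C -> C' \in panel j C ->
  C'' \in panel j C -> nth 0%N (lab d V C') j = nth 0%N (lab d V C'') j ->
  lab d V C' = lab d V C''.
Proof.
move=> jd chC p' p'' e; apply: (@eq_from_nth _ 0%N); rewrite !size_lab // => c cd.
case: (eqVneq c j) => [-> //|cj]; case: (eqVneq c j.+1) => [cj1|cj1]; last first.
  by rewrite !(lab_panel_fix jd chC) // .
have := panel_values jd chC p'; have := panel_values jd chC p''.
by rewrite /lpartner -cj1 cd /= e; lia.
Qed.

Lemma lab_panel j C C' : (j < d)%N -> chamber C -> C' \in panel j C ->
  lab d V C' = lab d V C \/ lab d V C' = lrefl d N j (lab d V C).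
Proof.
move=> jd chC pC'; have := panel_values jd chC pC' => /= -[] [e1 e2]; [left|right].
  exact: lab_panel_eq jd chC pC' (mem_panel j chC) e1.
apply: (@eq_from_nth _ 0%N); rewrite ?size_lab ?size_mkseq // => c cd.
rewrite [RHS]nth_mkseq //; case: (eqVneq c j) => [->//|cj].
case: (eqVneq c j.+1) => [cj1|cj1]; last exact: (lab_panel_fix jd chC).
by move: e2; rewrite {1}/lpartner -cj1 cd.
Qed.

Lemma lrefl_id j C : (j < d)%N -> nth 0%N (lab d V C) j = lpartner d N j (lab d V C) ->
  lrefl d N j (lab d V C) = lab d V C.
Proof.
move=> jd e; apply: (@eq_from_nth _ 0%N); rewrite ?size_lab ?size_mkseq // => c cd.
rewrite [LHS]nth_mkseq //; case: (eqVneq c j) => [->//|cj]; case: (eqVneq c j.+1) => // cj1.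
by rewrite e /lpartner -cj1 cd.
Qed.

End Labels.
End Panels.

(** * Counting the flags of a panel *)

Section PanelCount.
Variables (F : finFieldType) (eps : bool) (m d : nat) (b : 'M[F]_m).
Hypothesis adm : admissible eps b.
Hypothesis md : m = (d.*2 + ~~ eps)%N.
Local Notation orth := (orth b).
Local Notation chamber := (chamber b).
Local Notation sdflag := (sdflag b).
Local Notation panel := (panel d b).
Local Notation panel_top := (panel_top m d).

Section Replace.
Variables (j : nat) (C : flag F m m).
Hypotheses (jd : (j < d)%N) (chC : chamber C).

Lemma panel_top_gt : (j.+2 <= panel_top j <= m)%N.
Proof. by rewrite /panel_top; case: ifP => ?; lia. Qed.

Lemma panel_bounds : [/\ (j <= m)%N, (j.+1 <= m)%N, (j.+1.*2 <= m)%N & (j <= panel_top j)%N].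
Proof. by have := panel_top_gt; split; lia. Qed.

Lemma panel_eq C1 C2 : C1 \in panel j C -> C2 \in panel j C ->
  (subsp C1 j.+1 :=: subsp C2 j.+1)%MS -> C1 = C2.
Proof.
move=> p1 p2 e; apply: (chamber_eq adm md (panel_chamber p1) (panel_chamber p2)) => c cd.
case: (eqVneq c j.+1) => [->//|cj].
by rewrite !(subsp_panel adm md jd chC) // ; lia.
Qed.

Lemma panel_sub_top C' : C' \in panel j C -> (subsp C' j.+1 <= subsp C (panel_top j))%MS.
Proof.
move=> p'; rewrite -(subsp_panel_top adm md jd chC p').
by have := panel_top_gt => tj; apply: (subspS (chamber_flag (panel_chamber p'))); lia.
Qed.

Lemma panel_sup_bot C' : C' \in panel j C -> (subsp C j <= subsp C' j.+1)%MS.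
Proof.
move=> p'; rewrite -(subsp_panel_bot adm md jd chC p').
by apply: (subspS (chamber_flag (panel_chamber p'))); lia.
Qed.

Lemma panel_of_subspace (L : 'M[F]_m) : (subsp C j <= L)%MS ->
  (L <= subsp C (panel_top j))%MS -> \rank L = j.+1 -> isotropic b L ->
  exists2 C', C' \in panel j C & (subsp C' j.+1 :=: L)%MS.
Proof.
move=> UL LU' rL iL; have fC := chamber_flag chC.
pose h c := if c == j.+1 then L else subsp C c.
have rh c : (c <= d)%N -> \rank (h c) = c.
  by move=> cd; rewrite /h; case: eqVneq => [->|_] //; rewrite (chamber_rank chC) //; lia.
have hS c : (c < d)%N -> (h c <= h c.+1)%MS.
  move=> cd; rewrite /h eqSS; case: (eqVneq c j.+1) => [cj|cj].
    rewrite cj ifN; last by lia.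
    by move: LU'; rewrite /panel_top ifT //; lia.
  case: (eqVneq c j) => [->//|cj']; apply: subspS => //; lia.
have ih : isotropic b (h d).
  rewrite /h; case: eqVneq => // _.
  by apply: subsp_isotropic (chamber_sdflag chC) _; lia.
have ch' := mkflag_chamber adm md rh hS ih.
have half c : (c <= d)%N -> (subsp (mkflag d b h) c :=: h c)%MS.
  exact: (mkflag_half adm md).
exists (mkflag d b h); last by apply: (eqmx_trans (half _ _)); rewrite // /h eqxx.
rewrite inE ch' /=; apply/forallP=> i; apply/implyP=> ij; apply/eqP.
rewrite -!/(subsp _ _) -(genmx_subsp fC) -(genmx_subsp (chamber_flag ch')).
apply/genmxP/eqmxP/eqmx_sym/(eqmx_trans (half _ _)); first exact: ltn_ord.
by rewrite /h eqSS (negPf ij).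
Qed.

Section Low.
Variables (N : nat) (V : flag F m N).
Hypothesis sV : sdflag V.
Local Notation r C := (lab d V C).

Lemma rank_adds_cap i : (i <= N)%N ->
  (\rank (subsp C j + subsp V i :&: subsp C (panel_top j))%MS + rcap V C i j =
   j + rcap V C i (panel_top j))%N.
Proof.
move=> iN; have := mxrank_sum_cap (subsp C j) (subsp V i :&: subsp C (panel_top j))%MS.
rewrite (chamber_rank chC) ?(leq_trans (ltnW jd)) ?md; try lia.
suff -> : \rank (subsp C j :&: (subsp V i :&: subsp C (panel_top j)))%MS = rcap V C i j by [].
have := panel_top_gt => tj.
apply/eqmx_rank/andP; split.
  by rewrite sub_capmx capmxSl andbT (submx_trans (capmxSr _ _)) ?capmxSl.
rewrite sub_capmx capmxSr capmxS //=.
by apply: (subspS (chamber_flag chC)); lia.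
Qed.

Hypothesis neq : nth 0%N (r C) j != lpartner d N j (r C).

Let a := minn (nth 0%N (r C) j) (lpartner d N j (r C)).
(** The only candidate for the [j.+1]-st member of a flag carrying the smaller value [a]: within the
    top of the panel, [V_(a+1)] adds exactly one dimension to [C_j]. *)
Let L := (subsp C j + subsp V a.+1 :&: subsp C (panel_top j))%MS.

Lemma a_ltN : (a < N)%N.
Proof. by have := lab_lt adm md sV jd chC; rewrite /a; lia. Qed.

(** A value distinct from its opposite has one of the two strictly below the middle; this makes
    [subsp V a.+1] isotropic. *)
Lemma middle_gt_a : j.+1 = d -> (a < N.-1 - a)%N /\ (a.+1 <= N./2)%N.
Proof.
move=> ej; have := lab_lt adm md sV jd chC; move: neq; rewrite /a /lpartner ifN; last by lia.
move: (nth 0%N _ _) => x; split; lia.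
Qed.

Lemma rank_low : \rank L = j.+1.
Proof.
have aN := a_ltN; have := rank_adds_cap aN; rewrite -/L.
rewrite (rcap_panel adm md sV jd chC aN).
have : (~~ eps && (j.+1 == d) && (N./2 < a.+1))%N = false.
  by case: eqVneq => [/middle_gt_a [_ ?]|]; rewrite ?andbF //=; lia.
by move=> ->; move: neq; rewrite /a; move: (nth 0%N _ _) (lpartner _ _ _ _); lia.
Qed.

(** For [j.+1 < d] the space [L] lies in the isotropic [C_(j+2)]. For [j.+1 = d] it is the sum of
    two isotropic spaces, the second of which is taken inside the orthogonal of the first. *)
Lemma isotropic_low : isotropic b L.
Proof.
case: (ltnP j.+1 d) => jd'.
  apply: (isotropicS adm) (subsp_isotropic (i := j.+2) (chamber_sdflag chC) _); last by lia.
  rewrite addsmx_sub /panel_top jd' capmxSr andbT.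
  by apply: (subspS (chamber_flag chC)); lia.
have ej : j.+1 = d by lia.
have [a1 a2] := middle_gt_a ej; have aN := a_ltN.
have eU : (subsp C (panel_top j) :=: orth (subsp C j))%MS.
  rewrite /panel_top ifN; last by lia.
  apply: (eqmx_trans (subsp_chamber_dual chC (leq_subr _ _))); rewrite subKn //; lia.
have iU : (subsp C j <= orth (subsp C j))%MS.
  by apply: (subsp_isotropic (chamber_sdflag chC)); lia.
have iV : (subsp V a.+1 <= orth (subsp V a.+1))%MS.
  by apply: (subsp_isotropic sV); lia.
rewrite /isotropic -[orthomx _ _ _]/(orth L) (sub_orth_adds adm).
apply/andP; split.
  by rewrite addsmx_sub iU (submx_trans (capmxSr _ _)) ?eU.
rewrite (sub_orthC adm) (sub_orth_adds adm); apply/andP; split.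
  by rewrite (submx_trans (capmxSr _ _)) ?eU.
apply: (submx_trans (capmxSl _ _)); apply: (submx_trans iV); apply: (orthS adm).
exact: capmxSl.
Qed.

(** Carrying the value [a] means that [C'_(j+1)] meets [V_(a+1)] outside [C_j]; one more dimension
    is all there is room for. *)
Lemma low_subsp C' : C' \in panel j C -> nth 0%N (r C') j = a -> (subsp C' j.+1 :=: L)%MS.
Proof.
move=> p' ra; have chC' := panel_chamber p'; have aN := a_ltN.
have : (nth 0%N (r C') j < a.+1)%N by rewrite ra.
rewrite nth_lab // (ltn_jump C' (sdflag_flag sV) j aN).
rewrite (subsp_panel_bot adm md jd chC p') => nU.
have jm : (j.+1 <= m)%N by lia.
have s : (subsp C j + subsp V a.+1 :&: subsp C' j.+1 <= subsp C' j.+1)%MS.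
  by rewrite addsmx_sub capmxSr panel_sup_bot.
have e : (subsp C j + subsp V a.+1 :&: subsp C' j.+1 :=: subsp C' j.+1)%MS.
  apply: eqmx_rank_sub => //; rewrite (chamber_rank chC' jm).
  rewrite -{1}[j](chamber_rank chC (ltnW jm)); apply: rank_ltmx.
  rewrite ltmxE addsmxSl /=; apply: contra nU; apply: submx_trans.
  exact: addsmxSr.
apply: eqmx_rank_sub; last by rewrite (chamber_rank chC' jm) rank_low.
rewrite -e addsmx_sub addsmxSl /=; apply: submx_trans (addsmxSr _ _).
by apply: capmxS; rewrite ?panel_sub_top.
Qed.

Lemma exists_low : exists2 C', C' \in panel j C &
  (nth 0%N (r C') j < lpartner d N j (r C'))%N.
Proof.
have aN := a_ltN.
have [|C' p' eL] := panel_of_subspace (addsmxSl _ _ : (_ <= L)%MS) _ rank_low isotropic_low.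
  rewrite addsmx_sub capmxSr andbT; have := panel_top_gt => tj.
  by apply: (subspS (chamber_flag chC)); lia.
exists C' => //; have chC' := panel_chamber p'.
have : (nth 0%N (r C') j < a.+1)%N.
  rewrite nth_lab // (ltn_jump C' (sdflag_flag sV) j aN).
  rewrite (subsp_panel_bot adm md jd chC p') (cap_eqmx (eqmx_refl _) eL).
  apply/negP => s; suff : (L <= subsp C j)%MS.
    by move/mxrankS; rewrite rank_low (chamber_rank chC) ?ltnn //; lia.
  rewrite addsmx_sub submx_refl /=; apply: submx_trans s.
  by rewrite sub_capmx capmxSl addsmxSr.
have := panel_values adm md sV jd chC p'; move: neq; rewrite /a /=.
by move=> ? [[-> ->]|[-> ->]]; lia.
Qed.

Lemma low_unique C1 C2 : C1 \in panel j C -> C2 \in panel j C ->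
  (nth 0%N (r C1) j < lpartner d N j (r C1))%N ->
  (nth 0%N (r C2) j < lpartner d N j (r C2))%N -> C1 = C2.
Proof.
move=> p1 p2 l1 l2.
have low C' : C' \in panel j C -> (nth 0%N (r C') j < lpartner d N j (r C'))%N ->
    nth 0%N (r C') j = a.
  move=> p'; have := panel_values adm md sV jd chC p'; rewrite /a /=.
  by move=> [[-> ->]|[-> ->]]; lia.
apply: panel_eq => //; apply: (eqmx_trans (low_subsp p1 (low _ p1 l1))).
exact: eqmx_sym (low_subsp p2 (low _ p2 l2)).
Qed.

End Low.

(* The members of the panel other than [C] are the spans of [subsp C j] and
   [f + t g + s(t) e], for t in the field. *)
Lemma card_panel_param (K : 'M[F]_m) (e f g : 'rV[F]_m) (s : F -> F) :
  (subsp C j <= K)%MS -> (e <= K)%MS -> (g <= K)%MS -> ~~ (f <= K)%MS ->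
  (subsp C j.+1 <= K)%MS -> ~~ (g <= subsp C j + e)%MS ->
  let w t := f + t *: g + s t *: e in
  (forall t, (w t <= subsp C (panel_top j))%MS) ->
  (forall t, isotropic b (subsp C j + w t)%MS) ->
  (forall u : 'rV[F]_m, (u <= subsp C (panel_top j))%MS -> u *m b *m u^T = 0 ->
     ~~ (u <= subsp C j.+1)%MS -> exists t, (u <= subsp C j + w t)%MS) ->
  #|panel j C :\ C| = #|F|.
Proof.
move=> UK eK gK nf CK ng w wT iw surj.
have wK t : (w t - f <= K)%MS.
  have -> : w t - f = t *: g + s t *: e by apply/rowP=> i; rewrite !mxE; ring.
  by rewrite addmx_sub ?scalemx_sub.
have nw t : ~~ (w t <= K)%MS.
  apply: contra nf => wt; rewrite -(subKr (w t) f).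
  by rewrite addmx_sub // eqmx_opp wK.
have [jm0 jm j2m jT] := panel_bounds; have /andP[_ Tm] := panel_top_gt.
have UT : (subsp C j <= subsp C (panel_top j))%MS.
  exact: (subspS (chamber_flag chC)).
have rw t : \rank (subsp C j + w t)%MS = j.+1.
  rewrite rank_adds_row ?(chamber_rank chC) //.
  by apply: contra (nw t) => /submx_trans; apply.
have ex t : exists C', (C' \in panel j C) && (subsp C' j.+1 == subsp C j + w t)%MS.
  have [|C' p' eC'] := panel_of_subspace (addsmxSl _ _) _ (rw t) (iw t).
    by rewrite addsmx_sub UT wT.
  by exists C'; rewrite p' /=; apply/eqmxP.
pose G t := xchoose (ex t).
have GP t : G t \in panel j C /\ (subsp (G t) j.+1 :=: subsp C j + w t)%MS.
  by have /andP[p' /eqmxP e'] := xchooseP (ex t).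
(* [f] outside [K] forces the coefficient of [w t'] to be 1; then [g] outside [subsp C j + e] forces
   [t = t']. *)
have Ginj : injective G.
  move=> t t' Gt; have [_ e1] := GP t; have [_ e2] := GP t'.
  have : (w t <= subsp C j + w t')%MS by rewrite -e2 -Gt e1 addsmxSr.
  case/sub_addsmxP=> -[u1 u2] /= eq.
  have [l [A AU eu]] : exists l : F, exists2 A : 'rV[F]_m, (A <= subsp C j)%MS &
      w t = A + l *: w t'.
    exists (u2 0 0); exists (u1 *m subsp C j); first exact: submxMl.
    by rewrite eq {1}[u2]mx11_scalar mul_scalar_mx.
  have l1 : l = 1.
    apply/eqP; rewrite -subr_eq0; apply: contraR nf => l1.
    have : ((l - 1) *: f <= K)%MS.
      have -> : (l - 1) *: f = (w t - f) - A - l *: (w t' - f).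
        by apply/rowP=> i; rewrite eu !mxE; ring.
      apply: addmx_sub; first by rewrite addmx_sub ?wK // eqmx_opp (submx_trans AU).
      by rewrite eqmx_opp scalemx_sub.
    by move/(scalemx_sub (l - 1)^-1); rewrite scalerA mulVf // scale1r.
  apply/eqP; rewrite -subr_eq0; apply: contraR ng => tt'.
  have : ((t - t') *: g <= subsp C j + e)%MS.
    have -> : (t - t') *: g = A + (s t' - s t) *: e.
      have -> : A = w t - w t' by rewrite eu l1 scale1r addrK.
      by apply/rowP=> i; rewrite !mxE; ring.
    by rewrite addmx_sub_adds ?scalemx_sub.
  by move/(scalemx_sub (t - t')^-1); rewrite scalerA mulVf // scale1r.
suff -> : panel j C :\ C = [set G t | t : F] by rewrite card_imset // cardsT.
apply/setP=> C'; apply/setD1P/imsetP => [[nC p']|[t _ ->]]; last first.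
  have [p' e'] := GP t; split=> //; apply: contra (nw t) => /eqP Gt.
  by apply: submx_trans CK; rewrite -Gt e' addsmxSr.
have chC' := panel_chamber p'.
(* A flag other than [C] contains an isotropic vector outside [C_(j+1)], and together with [C_j]
   this vector spans its member of rank [j.+1]. *)
have nCC : ~~ (subsp C' j.+1 <= subsp C j.+1)%MS.
  apply: contra nC => s'; apply/eqP; apply: (panel_eq p' (mem_panel d j chC)).
  by apply: eqmx_rank_sub => //; rewrite !(@chamber_rank _ _ b).
have [u uC' nu] := exists_row_notin nCC.
have uu : u *m b *m u^T = 0.
  have iC' : (subsp C' j.+1 <= orth (subsp C' j.+1))%MS.
    exact: (subsp_isotropic (chamber_sdflag chC')).
  have := submx_trans uC' iC'; rewrite sub_orth => /eqP e0.
  have /submxP[D eD] := uC'; rewrite {2}eD trmx_mul mulmxA e0 mul0mx //.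
have [t ut] := surj u (submx_trans uC' (panel_sub_top p')) uu nu.
exists t => //; have [pG eG] := GP t; apply: (panel_eq p' pG).
have e1 : (subsp C j + u :=: subsp C' j.+1)%MS.
  apply: eqmx_rank_sub; first by rewrite addsmx_sub uC' panel_sup_bot.
  rewrite rank_adds_row ?(chamber_rank chC) ?(chamber_rank chC') //.
  by apply: contra nu => /submx_trans; apply; apply: (subspS (chamber_flag chC)).
apply: eqmx_trans (eqmx_sym eG); apply: eqmx_rank_sub.
  by rewrite -e1 addsmx_sub addsmxSl.
by rewrite rw (chamber_rank chC').
Qed.

(** In the plane case all lines are admissible and those other than the line of [C] form an affine
    line. In the 3-space case a hyperbolic pair [e], [f] and an orthogonal [g] give the usual
    parametrisation of a conic with one point removed. *)
Lemma card_panel : #|panel j C :\ C| = #|F|.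
Proof.
have fC := chamber_flag chC; have /andP[t1 t2] := panel_top_gt.
have jm : (j.+1 <= m)%N by lia.
have rC c : (c <= m)%N -> \rank (subsp C c) = c by exact: (chamber_rank chC).
have iC c : (c <= d)%N -> (subsp C c <= orth (subsp C c))%MS.
  by move=> cd; apply: (subsp_isotropic (chamber_sdflag chC)); lia.
have CS c c' : (c <= c')%N -> (c' <= m)%N -> (subsp C c <= subsp C c')%MS by apply: subspS.
have [|e eC ne] := @exists_row_notin _ m _ _ (subsp C j.+1) (subsp C j).
  by apply: contraL (leqnn j.+1) => /mxrankS; rewrite !rC //; lia.
have eqC : (subsp C j + e :=: subsp C j.+1)%MS.
  apply: eqmx_rank_sub; first by rewrite addsmx_sub eC CS.
  by rewrite rank_adds_row ?rC //; lia.
case: (boolP (panel_top j == j.+2)) => [/eqP top|top].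
  have [|f fT nf] := @exists_row_notin _ m _ _ (subsp C j.+2) (subsp C j.+1).
    by apply: contraL (leqnn j.+2) => /mxrankS; rewrite !rC //; lia.
  have eqT : (subsp C j.+1 + f :=: subsp C j.+2)%MS.
    apply: eqmx_rank_sub; first by rewrite addsmx_sub fT CS //; lia.
    by rewrite rank_adds_row ?rC //; lia.
  (* Modulo [C_j] the lines of the plane other than that of [e] are spanned by the vectors
     [f + t *: e]. *)
  apply: (@card_panel_param (subsp C j.+1) 0 f e (fun=> 0)) => //.
  - exact: CS.
  - exact: sub0mx.
  - by rewrite addsmx0_id.
  - move=> t; rewrite top scale0r addr0 addmx_sub ?scalemx_sub //.
    by apply: submx_trans eC (CS _ _ _ _); lia.
  - move=> t; rewrite scale0r addr0.
    case: (ltnP j.+1 d) => jd'.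
      apply: (isotropicS adm) (subsp_isotropic (i := j.+2) (chamber_sdflag chC) _); last by lia.
      rewrite addsmx_sub CS ?addmx_sub ?scalemx_sub //; try lia.
      by apply: submx_trans eC (CS _ _ _ _); lia.
    have ee : eps by move: top; rewrite /panel_top ifN; [case: eps md => //=; lia | lia].
    apply: (isotropic_adds adm); first by apply: iC; lia.
      rewrite -[j](_ : (m - j.+2)%N = _); last by case: eps ee md => //=; lia.
      rewrite -(subsp_chamber_dual chC); last by lia.
      rewrite addmx_sub ?scalemx_sub //.
      by apply: submx_trans eC (CS _ _ _ _); lia.
    exact: (skew_row_isotropic adm).
  - move=> u; rewrite top => uT _ nu; move: uT; rewrite -eqT.
    case/sub_addsmxP=> -[u1 u2] /= eq.
    have [be eu] : exists be : F, u = u1 *m subsp C j.+1 + be *: f.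
      by exists (u2 0 0); rewrite eq {1}[u2]mx11_scalar mul_scalar_mx.
    have be0 : be != 0.
      by apply: contra nu => /eqP b0; rewrite eu b0 scale0r addr0 submxMl.
    have := submxMl u1 (subsp C j.+1); rewrite -eqC => /sub_addsmxP[[v1 v2] /= eq'].
    have [al ev] : exists al : F, u1 *m subsp C j.+1 = v1 *m subsp C j + al *: e.
      by exists (v2 0 0); rewrite eq' {1}[v2]mx11_scalar mul_scalar_mx.
    exists (al / be); rewrite scale0r addr0.
    have -> : u = v1 *m subsp C j + be *: (f + (al / be) *: e).
      by rewrite eu ev scalerDr scalerA mulrCA divff // mulr1 -addrA [al *: _ + _]addrC.
    by rewrite addmx_sub_adds ?submxMl ?scalemx_sub.
have ej : j.+1 = d by move: top; rewrite /panel_top; case: ifP; rewrite ?eqxx //; lia.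
have ee : eps = false by move: top; rewrite /panel_top ifN; [case: eps md => //=; lia | lia].
move: md; rewrite ee /= => md'.
have top3 : panel_top j = j.+3 by rewrite /panel_top ifN; lia.
have [jm2 jm3 mT1 mT2] : [/\ (j.+2 <= m)%N, (j.+3 <= m)%N, (m - j.+3 = j)%N & (m - j.+2 = j.+1)%N].
  by clear -md' ej; split; lia.
have [nm2 jd1] : ((j.+2).*2 <= m)%N = false /\ (j.+1 <= d)%N by clear -md' ej; split; lia.
have jm0 : (j <= m)%N by apply: ltnW.
pose bl (x y : 'rV[F]_m) : F := (x *m b *m y^T) 0 0.
have blE x y : x *m b *m y^T = (bl x y)%:M by rewrite /bl -mx11_scalar.
have bl0 x y : (x *m b *m y^T == 0) = (bl x y == 0).
  apply/eqP/eqP => [e0|e0]; first by rewrite /bl e0 mxE.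
  by rewrite blE e0 raddf0.
have blC x y : bl x y = bl y x.
  have : (x *m b *m y^T)^T = y *m b *m x^T.
    by rewrite !trmx_mul trmxK (form_tr adm) ee expr0 scale1r mulmxA.
  rewrite !blE tr_scalar_mx => /(congr1 (fun M : 'M_1 => M 0 0)).
  by rewrite !mxE eqxx !mulr1n.
have blDl x y z : bl (x + y) z = bl x z + bl y z by rewrite /bl !mulmxDl mxE.
have blZl a x z : bl (a *: x) z = a * bl x z by rewrite /bl -!scalemxAl mxE.
have blDr x y z : bl z (x + y) = bl z x + bl z y by rewrite !(blC z) blDl.
have blZr a x z : bl z (a *: x) = a * bl z x by rewrite !(blC z) blZl.
have two := two_neq0 (odd_field adm).
have T1 : (subsp C j.+3 :=: orth (subsp C j))%MS.
  by apply: (eqmx_trans (subsp_chamber_dual chC jm3)); rewrite mT1.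
have T2 : (subsp C j.+2 :=: orth (subsp C j.+1))%MS.
  by apply: (eqmx_trans (subsp_chamber_dual chC jm2)); rewrite mT2.
have T1a : (subsp C j.+3 <= orth (subsp C j))%MS by rewrite T1.
have T2a : (subsp C j.+2 <= orth (subsp C j.+1))%MS by rewrite T2.
have S12 : (subsp C j.+1 <= subsp C j.+2)%MS by exact: CS.
have S23 : (subsp C j.+2 <= subsp C j.+3)%MS by exact: CS.
have S01 : (subsp C j <= subsp C j.+1)%MS by exact: CS.
have perp k x y : (x <= orth (subsp C k))%MS -> (y <= subsp C k)%MS -> bl x y = 0.
  rewrite sub_orth => /eqP e0 /submxP[D eD]; apply/eqP; rewrite -bl0 {1}eD.
  by rewrite trmx_mul mulmxA e0 mul0mx.
have [|f0 f0T nf0] := @exists_row_notin _ m _ _ (subsp C j.+3) (subsp C j.+2).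
  by apply/negP => /mxrankS; rewrite !rC // ltnn.
have be0 : bl e f0 != 0.
  rewrite -bl0 (form0C adm); apply: contra nf0 => e0; rewrite T2.
  have : (f0 <= orth (subsp C j + <<e>>)%MS)%MS.
    rewrite (sub_orth_adds adm).
    apply/andP; split.
      exact: (submx_trans f0T T1a).
    rewrite sub_orth.
    have /submxP[D ->] : (<<e>> <= e)%MS by rewrite genmxE.
    by rewrite trmx_mul mulmxA (eqP e0) mul0mx.
  move/submx_trans; apply; apply: (orthS adm); rewrite -eqC.
  by rewrite (adds_eqmx (eqmx_refl _) (genmxE e)).
have ee0 : bl e e = 0 by exact: (perp j.+1 _ _ (submx_trans eC (submx_trans S12 T2a))).
have eK : (e <= subsp C j.+2)%MS by exact: submx_trans eC S12.
have eT : (e <= subsp C j.+3)%MS by exact: submx_trans eK S23.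
have [f1 [ef1 f1T nf1]] : exists f1, [/\ bl e f1 = 1, (f1 <= subsp C j.+3)%MS &
    ~~ (f1 <= subsp C j.+2)%MS].
  exists ((bl e f0)^-1 *: f0); split; first by rewrite blZr mulVf.
    by rewrite scalemx_sub.
  apply: contra nf0 => /(scalemx_sub (bl e f0)).
  by rewrite scalerA mulfV // scale1r.
have [f [ef ff fT nf]] : exists f, [/\ bl e f = 1, bl f f = 0, (f <= subsp C j.+3)%MS &
    ~~ (f <= subsp C j.+2)%MS].
  (* As [e] is isotropic with [bl e f1 = 1], this multiple of it cancels [bl f1 f1]. *)
  exists (f1 + (- (bl f1 f1 / 2%:R)) *: e); split.
  - by rewrite blDr blZr ef1 ee0 mulr0 addr0.
  - by rewrite blDl !blDr !blZl !blZr (blC f1 e) ef1 ee0; field.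
  - by rewrite addmx_sub ?scalemx_sub.
  apply: contra nf1 => fK.
  rewrite -[f1](addrK ((- (bl f1 f1 / 2%:R)) *: e)) addmx_sub //.
  by rewrite eqmx_opp scalemx_sub.
have [|g0 g0K ng0] := @exists_row_notin _ m _ _ (subsp C j.+2) (subsp C j.+1).
  by apply/negP => /mxrankS; rewrite !rC // ltnn.
have [g [gf gK ng]] : exists g, [/\ bl g f = 0, (g <= subsp C j.+2)%MS &
    ~~ (g <= subsp C j.+1)%MS].
  exists (g0 + (- bl g0 f) *: e); split.
  - by rewrite blDl blZl ef mulr1 addrN.
  - by rewrite addmx_sub ?scalemx_sub.
  apply: contra ng0 => gC; rewrite -[g0](addrK ((- bl g0 f) *: e)) addmx_sub //.
  by rewrite eqmx_opp scalemx_sub.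
have ge : bl g e = 0 by exact: (perp j.+1 _ _ (submx_trans gK T2a)).
(* Otherwise [subsp C j.+1 + g] would be isotropic of rank [d.+1]. *)
have gg : bl g g != 0.
  apply/eqP => g20.
  have : isotropic b (subsp C j.+1 + g)%MS.
    apply: (isotropic_adds adm); first exact: iC.
      exact: submx_trans gK T2a.
    by rewrite blE g20 raddf0.
  by move/(rank_isotropic adm); rewrite rank_adds_row // rC // nm2.
have gT : (g <= subsp C j.+3)%MS by rewrite (submx_trans gK).
(* The coefficient [s] of [e] solves [t ^+ 2 * bl g g + 2 s = 0], the equation of the conic at
   [f + t *: g + s *: e]. *)
apply: (@card_panel_param (subsp C j.+2) e f g (fun t => - (t ^+ 2 * bl g g / 2%:R))) => //.
- exact: submx_trans S01 S12.
- by rewrite eqC.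
- by move=> t; rewrite top3 !addmx_sub ?scalemx_sub.
- move=> t; apply: (isotropic_adds adm); first exact: (iC _ (ltnW jd)).
    by apply: submx_trans T1a; rewrite !addmx_sub ?scalemx_sub.
  apply/eqP; rewrite bl0; apply/eqP.
  rewrite !(blDl, blDr, blZl, blZr) ff gf ee0 ge (blC f g) gf (blC f e) ef (blC e g) ge.
  by field.
move=> u; rewrite top3 => uT /eqP; rewrite bl0 => /eqP uu nu.
have eq3 : (subsp C j.+2 + f :=: subsp C j.+3)%MS.
  apply: eqmx_rank_sub; first by rewrite addsmx_sub fT S23.
  by rewrite rank_adds_row ?rC.
have eq2 : (subsp C j.+1 + g :=: subsp C j.+2)%MS.
  apply: eqmx_rank_sub; first by rewrite addsmx_sub gK S12.
  by rewrite rank_adds_row ?rC.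
have dec k (x y : 'rV[F]_m) : (x <= subsp C k + y)%MS ->
    exists2 x' : 'rV[F]_m, (x' <= subsp C k)%MS & exists a, x = x' + a *: y.
  case/sub_addsmxP=> -[u1 u2] /= ->; exists (u1 *m subsp C k); first exact: submxMl.
  by exists (u2 0 0); rewrite {1}[u2]mx11_scalar mul_scalar_mx.
move: uT; rewrite -eq3 => /dec[x3]; rewrite -eq2 => /dec[x2 + [ga ->]].
rewrite -eqC => /dec[x1 x1U [al ->]] [be eu].
have x1P y : (y <= subsp C j.+3)%MS -> bl x1 y = 0.
  by move=> yT; rewrite blC; apply: perp (submx_trans yT T1a) x1U.
have x1x : (x1 <= subsp C j.+3)%MS by rewrite (submx_trans x1U) // (submx_trans S01) // (submx_trans S12).
have {}uu : 2%:R * al * be + ga ^+ 2 * bl g g = 0.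
  rewrite -[RHS]uu eu !(blDl, blDr, blZl, blZr) !x1P // !(blC _ x1) !x1P //.
  by rewrite ff gf ee0 ge (blC f g) gf (blC f e) ef (blC e g) ge; ring.
have be_neq0 : be != 0.
  apply: contra nu => /eqP b0; move: uu; rewrite b0 mulr0 add0r => /eqP.
  rewrite mulf_eq0 expf_eq0 /= (negPf gg) orbF => /eqP g00.
  rewrite eu b0 g00 !scale0r !addr0 addmx_sub ?scalemx_sub //.
  exact: submx_trans x1U S01.
exists (ga / be).
have -> : u = x1 + be *: (f + (ga / be) *: g + - ((ga / be) ^+ 2 * bl g g / 2%:R) *: e).
  have -> : - ((ga / be) ^+ 2 * bl g g / 2%:R) = al / be.
    have e1 : ga ^+ 2 * bl g g = - (2%:R * al * be) by apply/eqP; rewrite -addr_eq0 addrC uu.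
    have -> : (ga / be) ^+ 2 * bl g g / 2%:R = (ga ^+ 2 * bl g g) / (be ^+ 2 * 2%:R).
      by field; rewrite ?be_neq0 ?two.
    by rewrite e1; field; rewrite ?be_neq0 ?two.
  apply/rowP=> i; rewrite eu !mxE; field; exact: be_neq0.
by rewrite addmx_sub_adds ?scalemx_sub.
Qed.

End Replace.

Section PanelSum.
Variables (N : nat) (V : flag F m N) (R : pzRingType) (G : seq nat -> R).
Variables (j : nat) (C : flag F m m).
Hypotheses (sV : sdflag V) (jd : (j < d)%N) (chC : chamber C).

(** [C] itself is left out, so if it carries the larger label only q - 1 others do: this is the
    coefficient q - 1 of the quadratic Hecke relation. The weight [G] is arbitrary, so that one
    computation serves both single labels and whole word coefficients. *)
Lemma sum_panel :
  \sum_(C' in panel j C :\ C) G (lab d V C') =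
  let r := lab d V C in
  let x := nth 0%N r j in let y := lpartner d N j r in
  if x == y then #|F|%:R * G r
  else if (x < y)%N then #|F|%:R * G (lrefl d N j r)
  else G (lrefl d N j r) + (#|F|%:R - 1) * G r.
Proof.
have cst (A : {set flag F m m}) z : (forall C', C' \in A -> lab d V C' = z) ->
    \sum_(C' in A) G (lab d V C') = #|A|%:R * G z.
  by move=> e; rewrite (eq_bigr (fun=> G z)) => [|C' /e -> //]; rewrite sumr_const mulr_natl.
have lp := lab_panel adm md sV jd chC.
have card := card_panel jd chC.
cbv zeta; case: eqVneq => [e|ne].
  rewrite -card; apply: cst => C' /setD1P[_ /lp[] // ->]; exact: lrefl_id jd e.
have uni := low_unique jd chC sV ne; have mC := mem_panel d j chC.
case: ltnP => xy.
  rewrite -card; apply: cst => C' /setD1P[nC p']; have [e|//] := lp _ p'.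
  by case/eqP: nC; apply: uni => //; rewrite e.
have [C0 p0 l0] := exists_low jd chC sV ne.
have n0 : C0 != C by apply: contraTneq l0 => ->; rewrite -leqNgt.
have r0 : lab d V C0 = lrefl d N j (lab d V C).
  by have [e|//] := lp _ p0; move: l0; rewrite e ltnNge xy.
rewrite (big_setD1 C0) /=; last by rewrite in_setD1 n0.
rewrite r0; congr (_ + _).
rewrite (cst _ (lab d V C)) => [|C' /setD1P[nC0 /setD1P[nC p']]].
  congr (_ * _); have := cardsD1 C0 (panel j C :\ C); rewrite in_setD1 n0 p0 card /=.
  by move=> ->; rewrite natrD addrAC subrr add0r.
have [//|e] := lp _ p'; case/eqP: nC0; apply: uni => //.
by rewrite e -r0.
Qed.

End PanelSum.
End PanelCount.

(** * Sorting labels *)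

Lemma size_lrefl d N j r : size (lrefl d N j r) = d.
Proof. exact: size_mkseq. Qed.

(** The termination measure of sorting: the positive weights decrease along the label, so moving a
    smaller value to the left, or lowering the last entry, decreases the sum. *)
Definition lpotential (d : nat) (r : seq nat) : nat := \sum_(c < d) (d - c) * nth 0%N r c.

Lemma lrefl_partner d N j r : (j < d)%N -> (nth 0%N r j < N)%N ->
  nth 0%N (lrefl d N j r) j = lpartner d N j r /\
  lpartner d N j (lrefl d N j r) = nth 0%N r j.
Proof.
move=> jd xN; have e : nth 0%N (lrefl d N j r) j = lpartner d N j r.
  by rewrite nth_mkseq // eqxx.
split=> //; rewrite {1}/lpartner e; case: ifP => jd'.
  by rewrite nth_mkseq // eqxx ifN //; lia.
by rewrite /lpartner jd'; lia.
Qed.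

Lemma lrefl_invol d N j r : (j < d)%N -> (nth 0%N r j < N)%N -> size r = d ->
  lrefl d N j (lrefl d N j r) = r.
Proof.
move=> jd xN sr; have [e1 e2] := lrefl_partner jd xN.
apply: (@eq_from_nth _ 0%N); rewrite ?size_lrefl ?sr // => c cd.
rewrite [LHS]nth_mkseq // e1 e2; case: (eqVneq c j) => [->//|cj].
case: (eqVneq c j.+1) => [cj1|cj1]; first by rewrite /lpartner -cj1 cd.
by rewrite nth_mkseq // (negPf cj) (negPf cj1).
Qed.

Lemma lpotential_lrefl d N j r : (j < d)%N -> (lpartner d N j r < nth 0%N r j)%N ->
  (lpotential d (lrefl d N j r) < lpotential d r)%N.
Proof.
move=> jd xy; rewrite /lpotential (bigD1 (Ordinal jd)) //= [X in (_ < X)%N](bigD1 (Ordinal jd)) //=.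
have e c : (c < d)%N -> nth 0%N (lrefl d N j r) c =
   if c == j then lpartner d N j r else if c == j.+1 then nth 0%N r j else nth 0%N r c.
  by move=> cd; rewrite nth_mkseq.
rewrite e // eqxx; case: (ltnP j.+1 d) => jd'; last first.
  rewrite (eq_bigr (fun c : 'I_d => (d - c) * nth 0 r c)%N); last first.
    move=> c cj; rewrite e // (negPf (cj : (c : nat) != j)).
    by rewrite ifN //; have := ltn_ord c; lia.
  by rewrite ltn_add2r ltn_mul2l xy andbT; lia.
have nj : Ordinal jd' != Ordinal jd by apply/eqP => /(congr1 val) /=; lia.
rewrite (bigD1 (Ordinal jd')) //= [X in (_ < _ + X)%N](bigD1 (Ordinal jd')) //=.
rewrite (e j.+1) // eqxx ifN; last by lia.
rewrite (eq_bigr (fun c : 'I_d => (d - c) * nth 0 r c)%N); last first.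
  move=> c /andP[cj cj1]; rewrite e // (negPf (cj : (c : nat) != j)).
  by rewrite (negPf (cj1 : (c : nat) != j.+1)).
move: xy; rewrite !addnA ltn_add2r /lpartner jd'.
have -> : (d - j = (d - j.+1).+1)%N by lia.
move: (d - j.+1)%N (nth 0%N r j) (nth 0%N r j.+1) => k x y; nia.
Qed.

(** A sorted sequence is recovered from its threshold counts: [r c < i] exactly when [c - a] is less
    than the number of values below [i]. *)
Lemma eq_sorted_count (N a b : nat) (r r' : nat -> nat) :
  (forall c c', (a <= c <= c')%N -> (c' < b)%N -> (r c <= r c')%N) ->
  (forall c c', (a <= c <= c')%N -> (c' < b)%N -> (r' c <= r' c')%N) ->
  (forall c, (a <= c < b)%N -> (r c < N)%N && (r' c < N)%N) ->
  (forall i, (i <= N)%N ->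
     (\sum_(k < b - a) (r (a + k) < i) = \sum_(k < b - a) (r' (a + k) < i))%N) ->
  forall c, (a <= c < b)%N -> r c = r' c.
Proof.
move=> mr mr' rN e c cab.
have key (f : nat -> nat) : (forall c c', (a <= c <= c')%N -> (c' < b)%N -> (f c <= f c')%N) ->
    forall i, (f c < i)%N = (c - a < \sum_(k < b - a) (f (a + k) < i))%N.
  move=> mf i; pose p k := (k == 0) || (f (a + k.-1)%N < i)%N.
  have := @ltn_count_antitone (b - a) p isT _ (c - a).+1; rewrite /p /=.
  have -> : (a + (c - a) = c)%N by lia.
  move=> H; rewrite ltnS leqNgt in H; apply: negb_inj; rewrite -H //.
    by rewrite -leqNgt.
  - move=> [|k] [|l] //= kl lb; apply: leq_ltn_trans; apply: mf; lia.
  - by lia.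
have := rN c cab; have e1 := key r mr; have e2 := key r' mr'.
move=> /andP[c1 c2].
have e3 i : (i <= N)%N -> (r c < i)%N = (r' c < i)%N by move=> iN; rewrite e1 e2 e.
have := e3 _ c1; have := e3 _ c2; lia.
Qed.

(** [dm] lists the dimensions occurring in a second flag. Only the reflections that preserve this
    flag, those with [j.+1] outside [dm], are asked not to lower the label. *)
Definition lsorted (d N : nat) (dm r : seq nat) : bool :=
  all (fun j => (j.+1 \in dm) || (nth 0%N r j <= lpartner d N j r)%N) (iota 0 d).

Lemma lsortedP d N dm r : reflect
  (forall j, (j < d)%N -> j.+1 \notin dm -> (nth 0%N r j <= lpartner d N j r)%N)
  (lsorted d N dm r).
Proof.
apply: (iffP allP) => [a j jd jn|a j].
  by have := a j; rewrite mem_iota add0n jd (negPf jn) /=; apply.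
by rewrite mem_iota => /= jd; case: (boolP (j.+1 \in dm)) => //= jn; apply: a.
Qed.

Definition dims_sym (m : nat) (dm : seq nat) :=
  forall c, (c <= m)%N -> (c \in dm) = (m - c \in dm)%N.

(** The duality reverses both the positions and the values, so it copies the inequalities of the
    first half to the second; the comparisons at the middle come from [f (d - 1)] being at most its
    opposite. *)
Lemma symmetric_sorted (eps : bool) (m d N : nat) (dm : seq nat) (f : nat -> nat) :
  m = (d.*2 + ~~ eps)%N -> dims_sym m dm ->
  (forall c, (c < m)%N -> f (m.-1 - c) = N.-1 - f c)%N ->
  (forall c, (c < m)%N -> (f c < N)%N) ->
  (forall j, (j < d)%N -> j.+1 \notin dm ->
     (f j <= if j.+1 < d then f j.+1 else N.-1 - f j)%N) ->
  forall c, (c.+1 < m)%N -> c.+1 \notin dm -> (f c <= f c.+1)%N.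
Proof.
move=> md sym du jN srt c cm cn.
have low j : (j < d)%N -> j.+1 \notin dm -> (j.+1 < d)%N -> (f j <= f j.+1)%N.
  by move=> jd jn jd'; have := srt j jd jn; rewrite jd'.
case: (ltnP c.+1 d) => cd; first by apply: low => //; apply: ltnW.
have mid : (c < d)%N -> (f c <= N.-1 - f c)%N.
  by move=> cd'; have := srt c cd' cn; rewrite ifN //; lia.
have [c'|] : (c = d.-1 /\ 0 < d)%N \/ (d <= c)%N by lia.
  have c1 : (c < d)%N by lia.
  have := mid c1; have := jN c; have := du c; have := du c.+1; have := jN c.+1.
  have [e|e] : (m.-1 - c = c.+1)%N \/ (m.-1 - c.+1 = c.+1)%N by lia.
    rewrite e; lia.
  by rewrite e; lia.
move=> dc; have cn' : (m - c.+1)%N \notin dm by rewrite -sym // ltnW.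
have := du c; have := du c.+1; have := jN c; have := jN c.+1.
have [e1 e2] : (m.-1 - c = (m.-1 - c.+1).+1)%N /\ (m - c.+1 = (m.-1 - c.+1).+1)%N by lia.
have [j ej] : exists j, j = (m.-1 - c.+1)%N by exists (m.-1 - c.+1)%N.
have jn : j.+1 \notin dm by rewrite ej -e2.
rewrite e1 -ej; case: (ltnP j.+1 d) => jd'.
  by have := low j (ltnW jd') jn jd'; lia.
have [e e3] : (j.+1 = c)%N /\ (j.+1 = d)%N by clear -md ej jd' dc cm; lia.
have jd : (j < d)%N by rewrite -e3.
have := srt j jd jn; rewrite ifN; last by rewrite e3 ltnn.
rewrite e; clear -cm; lia.
Qed.

Section Sorting.
Variables (F : finFieldType) (eps : bool) (m d : nat) (b : 'M[F]_m).
Hypothesis adm : admissible eps b.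
Hypothesis md : m = (d.*2 + ~~ eps)%N.
Local Notation orth := (orth b).
Local Notation chamber := (chamber b).
Local Notation sdflag := (sdflag b).
Local Notation panel := (panel d b).

Lemma card_field_gt0 : (0 < #|F|)%N. Proof. by apply/card_gt0P; exists 0. Qed.

Lemma exists_lrefl N (V : flag F m N) j C : sdflag V -> chamber C -> (j < d)%N ->
  nth 0%N (lab d V C) j != lpartner d N j (lab d V C) ->
  exists2 C', C' \in panel j C & lab d V C' = lrefl d N j (lab d V C).
Proof.
move=> sV chC jd ne; have lp := lab_panel adm md sV jd chC.
have uni := low_unique adm md jd chC sV ne; have mC := mem_panel d j chC.
case: (ltnP (nth 0%N (lab d V C) j) (lpartner d N j (lab d V C))) => xy.
  have := card_field_gt0; rewrite -(card_panel adm md jd chC).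
  case/card_gt0P=> C' /setD1P[nC p']; exists C' => //; have [e|//] := lp _ p'.
  by case/eqP: nC; apply: uni => //; rewrite e.
have [C0 p0 l0] := exists_low adm md jd chC sV ne.
exists C0 => //; have [e|//] := lp _ p0; move: l0; rewrite e ltnNge xy //.
Qed.

Definition dims N (V : flag F m N) : seq nat := [seq \rank (subsp V k) | k <- iota 0 N.+1].

Lemma mem_dims N (V : flag F m N) k : (k <= N)%N -> \rank (subsp V k) \in dims V.
Proof. by move=> kN; apply/mapP; exists k; rewrite // mem_iota. Qed.

Lemma dims_symP N (V : flag F m N) : sdflag V -> dims_sym m (dims V).
Proof.
move=> sV.
suff im c : (c <= m)%N -> c \in dims V -> (m - c)%N \in dims V.
  move=> c cm; apply/idP/idP; first exact: im.
  by move/(im _ (leq_subr _ _)); rewrite subKn.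
move=> cm /mapP[k]; rewrite mem_iota => /andP[_ kN] ->.
by rewrite -(rank_subsp_dual adm sV) // mem_dims // leq_subr.
Qed.

Lemma jump_sorted N (V : flag F m N) C dm : sdflag V -> chamber C -> dims_sym m dm ->
  lsorted d N dm (lab d V C) ->
  forall c, (c.+1 < m)%N -> c.+1 \notin dm -> (jump V C c <= jump V C c.+1)%N.
Proof.
move=> sV chC sym /lsortedP srt; apply: (symmetric_sorted md (N := N)) => //.
- move=> c cm; exact: (jump_dual adm).
- move=> c cm; exact: (jump_lt (sdflag_flag sV) chC).
move=> j jd jn; have := srt j jd jn; rewrite /lpartner.
by case: ifP => jd'; rewrite !nth_lab.
Qed.

Lemma jump_sorted_trans N (V : flag F m N) C dm : sdflag V -> chamber C -> dims_sym m dm ->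
  lsorted d N dm (lab d V C) ->
  forall c c', (c <= c')%N -> (c' < m)%N ->
  (forall k, (c < k <= c')%N -> k \notin dm) -> (jump V C c <= jump V C c')%N.
Proof.
move=> sV chC sym srt c; elim=> [|c' IH] cc' cm nd.
  by move: cc'; rewrite leqn0 => /eqP ->.
move: cc'; rewrite leq_eqVlt => /orP[/eqP -> //|cc'].
apply: leq_trans (IH _ _ _) (jump_sorted sV chC sym srt cm _) => //.
- exact: ltnW.
- by move=> k /andP[ck kc]; apply: nd; rewrite ck leqW.
- by apply: nd; rewrite cc' leqnn.
Qed.

Lemma panel_refines N' (V' : flag F m N') j C C' : sdflag V' -> chamber C -> (j < d)%N ->
  refines C V' -> j.+1 \notin dims V' -> C' \in panel j C -> refines C' V'.
Proof.
move=> sV' chC jd /refinesP ref jn p'; have fV' := sdflag_flag sV'.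
have chC' := panel_chamber p'; apply/refinesP; rewrite ?(chamber_flag chC') // => i iN.
apply: (eqmx_trans (ref (chamber_flag chC) fV' i iN)).
rewrite (subsp_panel adm md jd chC p') ?rank_leq_row //.
  by apply: contraNneq jn => <-; apply: mem_dims.
apply: contraNneq jn => e; rewrite (dims_symP sV') -?e ?mem_dims //.
by clear -md jd; lia.
Qed.

(** Each descent outside [dims V'] is removed by passing to another flag of the panel, which still
    refines [V']. The predicate [Pr] carries along whatever is invariant under the reflections
    used. *)
Lemma sort_chamber N (V : flag F m N) N' (V' : flag F m N') (Pr : seq nat -> Prop) C :
  sdflag V -> sdflag V' -> chamber C -> refines C V' -> Pr (lab d V C) ->
  (forall C1 j, chamber C1 -> (j < d)%N -> j.+1 \notin dims V' -> Pr (lab d V C1) ->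
     Pr (lrefl d N j (lab d V C1))) ->
  exists C', [/\ chamber C', refines C' V', lsorted d N (dims V') (lab d V C')
               & Pr (lab d V C')].
Proof.
move=> sV sV' chC ref prC pcl.
have [k] := ubnP (lpotential d (lab d V C)); elim: k C chC ref prC => // k IH C chC ref prC.
rewrite ltnS => pk; case: (boolP (lsorted d N (dims V') (lab d V C))) => [srt|].
  by exists C.
case/allPn=> j; rewrite mem_iota add0n /= => jd; rewrite negb_or -ltnNge => /andP[jn xy].
have ne : nth 0%N (lab d V C) j != lpartner d N j (lab d V C) by rewrite eq_sym ltn_eqF.
have [C' p' e'] := exists_lrefl sV chC jd ne; have chC' := panel_chamber p'.
apply: (IH C') => //; first exact: panel_refines p'.
  by rewrite e'; apply: pcl.
by rewrite e'; apply: leq_trans pk; apply: lpotential_lrefl.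
Qed.

Lemma exists_sorted_chamber N (V : flag F m N) N' (V' : flag F m N') :
  sdflag V -> sdflag V' ->
  exists C, [/\ chamber C, refines C V' & lsorted d N (dims V') (lab d V C)].
Proof.
move=> sV sV'; have [C chC ref] := exists_chamber_refining adm md sV'.
have [C' [c1 c2 c3 _]] := sort_chamber (Pr := fun=> True) sV sV' chC ref I (fun _ _ _ _ _ _ => I).
by exists C'.
Qed.

Lemma rcap_refines N (V : flag F m N) N' (V' : flag F m N') C i k : is_flag V -> is_flag V' ->
  chamber C -> refines C V' -> (i <= N)%N -> (k <= N')%N ->
  rcap V V' i k = (\sum_(c < \rank (subsp V' k)) (jump V C c < i))%N.
Proof.
move=> fV fV' chC /refinesP ref iN kN.
rewrite -(rcap_jump fV chC iN) ?rank_leq_row // /rcap.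
by apply/eqmx_rank/eqmxP/cap_eqmx => //; apply: (ref (chamber_flag chC)).
Qed.

(** With no block boundaries the jumps increase along all of [C], so the lines falling below step
    [i] are the first ones, and they fill [V_i]. *)
Lemma sorted_refines N (V : flag F m N) C : sdflag V -> chamber C ->
  lsorted d N [::] (lab d V C) -> refines C V.
Proof.
move=> sV chC srt; have fV := sdflag_flag sV; have fC := chamber_flag chC.
apply/refinesP => // i iN; set k := \rank _.
have km : (k <= m)%N by exact: rank_leq_row.
have mono c c' : (c <= c')%N -> (c' < m)%N -> (jump V C c <= jump V C c')%N.
  by move=> ? ?; apply: (jump_sorted_trans sV chC _ srt).
have small c : (c < k)%N -> (jump V C c < i)%N.
  move=> ck; rewrite ltnNge; apply/negP => ij.
  have : (k <= c)%N; last by rewrite leqNgt ck.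
  rewrite /k (sum_jump fV chC iN) -(big_mkord xpredT (fun x => (jump V C x < i)%N : nat)).
  rewrite (big_cat_nat (n := c)) //=; last exact: ltnW (leq_trans ck km).
  rewrite [X in (_ + X)%N]big_nat_cond [X in (_ + X)%N]big1 ?addn0.
    rewrite -[X in (_ <= X)%N]subn0 -[X in (_ <= X)%N]muln1 -sum_nat_const_nat.
    by apply: leq_sum => ? _; apply: leq_b1.
  move=> l /andP[/andP[cl lm] _]; rewrite ltnNge (leq_trans ij) //; exact: mono.
have e : rcap V C i k = k.
  rewrite (rcap_jump fV chC iN km) (eq_bigr (fun=> 1)) => [|c _]; last by rewrite small.
  by rewrite sum_nat_const card_ord muln1.
have e1 : (subsp V i :&: subsp C k :=: subsp V i)%MS.
  by apply: eqmx_rank_sub; rewrite ?capmxSl // -[X in (X <= _)%N]/k -{1}e.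
have e2 : (subsp V i :&: subsp C k :=: subsp C k)%MS.
  by apply: eqmx_rank_sub; rewrite ?capmxSr // (chamber_rank chC km) -{1}e.
exact: eqmx_trans (eqmx_sym e1) e2.
Qed.

(** Two complete flags are in relative position given by a permutation: each step of [E] gains one
    dimension and receives one line of [C]. *)
Lemma jump_inj (E C : flag F m m) c c' : chamber E -> chamber C ->
  (c < m)%N -> (c' < m)%N -> jump E C c = jump E C c' -> c = c'.
Proof.
move=> chE chC cm cm' e; apply/eqP/contraT => ne; have fE := chamber_flag chE.
have jm := jump_lt fE chC cm; set i := jump E C c in e jm.
have : (\sum_(k < m) (jump E C k < i.+1) = \sum_(k < m) (jump E C k < i) + 1)%N.
  rewrite -!(sum_jump fE chC) ?(chamber_rank chE) // ?addn1 //; exact: ltnW.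
rewrite (eq_bigr (fun k : 'I_m => (jump E C k < i) + (jump E C k == i))%N); last first.
  by move=> k _; rewrite ltnS leq_eqVlt; case: ltngtP.
rewrite big_split /= => /addnI; rewrite (bigD1 (Ordinal cm)) //= -/i eqxx.
rewrite (bigD1 (Ordinal cm')) /= -?e ?eqxx //.
by apply/eqP => /(congr1 val) /= ee; rewrite ee eqxx in ne.
Qed.

Lemma block_of (f : nat -> nat) n c : f 0 = 0 -> (c < f n)%N ->
  exists2 k, (k < n)%N & (f k <= c < f k.+1)%N.
Proof.
move=> f0; elim: n => [|n IH]; first by rewrite f0.
case: (ltnP c (f n)) => [cn _|nc cn1]; last by exists n; rewrite // nc.
by have [k kn kc] := IH cn; exists k; rewrite // ltnW.
Qed.

Lemma block_notin N' (V' : flag F m N') k c : is_flag V' -> (k < N')%N ->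
  (\rank (subsp V' k) < c < \rank (subsp V' k.+1))%N -> c \notin dims V'.
Proof.
move=> fV' kN /andP[c1 c2]; apply/negP => /mapP[l]; rewrite mem_iota add0n ltnS => /= lN el.
case: (leqP l k) => lk.
  by have := mxrankS (subspS fV' lk (ltnW kN)); rewrite -el leqNgt c1.
by have := mxrankS (subspS fV' lk lN); rewrite -el leqNgt c2.
Qed.

(** [C] can be rebuilt from [E], [V'] and the jumps: the later lines of a block have larger jumps,
    hence [C_(c+1)] is [C_c] plus the part of the block's upper bound in [V'] that lies in the first
    [jump E C c + 1] steps of [E]. *)
Lemma sorted_unique N' (V' : flag F m N') (E C C2 : flag F m m) :
  sdflag V' -> chamber E -> chamber C -> chamber C2 -> refines C V' -> refines C2 V' ->
  lsorted d m (dims V') (lab d E C) -> (forall c, (c < m)%N -> jump E C c = jump E C2 c) ->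
  C = C2.
Proof.
move=> sV' chE chC chC2 ref ref2 srt ej; have fE := chamber_flag chE.
have fV' := sdflag_flag sV'.
apply: (subsp_inj (chamber_flag chC) (chamber_flag chC2)).
elim=> [|c IH] cm; first by rewrite !subsp0 ?chamber_flag ?(chamber_flag chC) ?(chamber_flag chC2).
have {}IH := IH (ltnW cm).
have [k kN /andP[kc ck]] : exists2 k, (k < N')%N &
    (\rank (subsp V' k) <= c < \rank (subsp V' k.+1))%N.
  by apply: (block_of (f := fun k => \rank (subsp V' k))); rewrite ?subsp0 ?subsp_last ?mxrank0 ?mxrank1.
have key C' : chamber C' -> refines C' V' -> (forall c, (c < m)%N -> jump E C c = jump E C' c) ->
    (subsp C' c.+1 :=: subsp C' c + subsp E (jump E C c).+1 :&: subsp V' k.+1)%MS.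
  move=> chC' ref' ej'; set i := (jump E C c).+1.
  have im : (i <= m)%N by apply: (jump_lt fE chC cm).
  have r1 : rcap E V' i k.+1 = rcap E C' i c.+1.
    rewrite (rcap_refines fE fV' chC' ref' im kN) (rcap_jump fE chC' im cm).
    rewrite -(subnKC ck) big_split_ord /= [X in (_ + X)%N]big1 ?addn0 // => l _.
    have lr := ltn_ord l; have lm : (c.+1 + l < m)%N.
      by apply: leq_trans (rank_leq_row (subsp V' k.+1)); move: lr; clear -ck; lia.
    rewrite -ej' // ltnS leqNgt; apply/eqP; rewrite eqb0 negbK ltn_neqAle.
    apply/andP; split.
      by apply/eqP => /(jump_inj chE chC cm lm); clear; lia.
    apply: (jump_sorted_trans (chamber_sdflag chE) chC (dims_symP sV') srt) => //.
      by rewrite addSn leqW // leq_addr.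
    move=> x /andP[cx xl]; apply: (block_notin fV' kN).
    by apply/andP; split; move: lr cx xl kc ck; clear; lia.
  have s : (subsp E i :&: subsp C' c.+1 <= subsp E i :&: subsp V' k.+1)%MS.
    have /refinesP r := ref'.
    rewrite capmxS // (r (chamber_flag chC') fV' k.+1 kN).
    by apply: (subspS (chamber_flag chC')) => //; apply: rank_leq_row.
  have e1 : (subsp E i :&: subsp C' c.+1 :=: subsp E i :&: subsp V' k.+1)%MS.
    by apply: eqmx_rank_sub => //; rewrite -/(rcap _ _ _ _) -/(rcap E V' _ _) r1.
  have nj : ~~ (subsp E i :&: subsp C' c.+1 <= subsp C' c)%MS.
    by rewrite -(ltn_jump C' fE c im) -ej'.
  apply: (eqmx_trans _ (adds_eqmx (eqmx_refl _) e1)); apply/eqmx_sym/eqmx_rank_sub.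
    rewrite addsmx_sub capmxSr andbT; exact: (subspS (chamber_flag chC')).
  rewrite (chamber_rank chC' cm) -{1}[c](chamber_rank chC' (ltnW cm)); apply: rank_ltmx.
  rewrite ltmxE addsmxSl /=; apply: contra nj; apply: submx_trans; exact: addsmxSr.
apply: (eqmx_trans (key C chC ref (fun _ _ => erefl))).
apply: (eqmx_trans _ (eqmx_sym (key C2 chC2 ref2 ej))).
exact: adds_eqmx.
Qed.

End Sorting.

Section SortedDetermined.
Variables (eps : bool) (m d N N' : nat).
Hypothesis md : m = (d.*2 + ~~ eps)%N.
Variables (F : finFieldType) (b : 'M[F]_m) (V : flag F m N) (V' : flag F m N').
Variables (F2 : finFieldType) (b2 : 'M[F2]_m) (V2 : flag F2 m N) (V2' : flag F2 m N').
Hypotheses (adm : admissible eps b) (adm2 : admissible eps b2).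
Hypotheses (sV : sdflag b V) (sV' : sdflag b V') (sV2 : sdflag b2 V2) (sV2' : sdflag b2 V2').

Lemma eq_dims : (forall k, (k <= N')%N -> rcap V V' N k = rcap V2 V2' N k) ->
  (forall k, (k <= N')%N -> \rank (subsp V' k) = \rank (subsp V2' k)) /\ dims V' = dims V2'.
Proof.
move=> e; have e1 k : (k <= N')%N -> \rank (subsp V' k) = \rank (subsp V2' k).
  move=> kN; have := e k kN; rewrite /rcap !subsp_last ?(sdflag_flag sV) ?(sdflag_flag sV2) //.
  by rewrite !cap1mx.
split=> //; apply/eq_in_map => k; rewrite mem_iota => /andP[_]; exact: e1.
Qed.

(** Within a block of [V'], the multiset of jumps is the difference of the ranks of intersections at
    the two ends of the block, and sorting fixes its order. *)
Lemma sorted_determined (C : flag F m m) (C2 : flag F2 m m) :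
  chamber b C -> chamber b2 C2 -> refines C V' -> refines C2 V2' ->
  lsorted d N (dims V') (lab d V C) -> lsorted d N (dims V2') (lab d V2 C2) ->
  (forall i k, (i <= N)%N -> (k <= N')%N -> rcap V V' i k = rcap V2 V2' i k) ->
  forall c, (c < m)%N -> jump V C c = jump V2 C2 c.
Proof.
move=> chC chC2 ref ref2 srt srt2 e c cm.
have [er ed] := eq_dims (fun k => e N k (leqnn N)).
have fV := sdflag_flag sV; have fV2 := sdflag_flag sV2.
have fV' := sdflag_flag sV'; have fV2' := sdflag_flag sV2'.
have [k kN kc] : exists2 k, (k < N')%N & (\rank (subsp V' k) <= c < \rank (subsp V' k.+1))%N.
  by apply: (block_of (f := fun k => \rank (subsp V' k))); rewrite ?subsp0 ?subsp_last ?mxrank0 ?mxrank1.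
have km : (\rank (subsp V' k.+1) <= m)%N by exact: rank_leq_row.
have kk : (\rank (subsp V' k) <= \rank (subsp V' k.+1))%N.
  by case/andP: kc => k1 /ltnW; apply: leq_trans.
apply: (eq_sorted_count (N := N) _ _ _ _ kc).
- move=> x y /andP[ax xy] yb; apply: (jump_sorted_trans adm md sV chC (dims_symP adm sV') srt) => //.
    exact: leq_trans yb km.
  move=> l /andP[xl ly]; apply: (block_notin fV' kN).
  by rewrite (leq_ltn_trans ax xl) (leq_ltn_trans ly yb).
- move=> x y /andP[ax xy] yb.
  apply: (jump_sorted_trans adm2 md sV2 chC2 (dims_symP adm2 sV2') srt2) => //.
    exact: leq_trans yb km.
  move=> l /andP[xl ly]; rewrite -ed; apply: (block_notin fV' kN).
  by rewrite (leq_ltn_trans ax xl) (leq_ltn_trans ly yb).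
- move=> x /andP[_ xb]; have xm := leq_trans xb km.
  by rewrite (jump_lt fV chC xm) (jump_lt fV2 chC2 xm).
move=> i iN; have e1 := e i k iN (ltnW kN); have e2 := e i k.+1 iN kN.
move: e1 e2; rewrite !(rcap_refines fV fV' chC ref) // 1?ltnW //.
rewrite !(rcap_refines fV2 fV2' chC2 ref2) // 1?ltnW // -!er // 1?ltnW //.
move: (\rank (subsp V' k)) (\rank (subsp V' k.+1)) kk => x y xy.
have [n en] : exists n, n = (y - x)%N by exists (y - x)%N.
by rewrite -en -(subnKC xy) -en !big_split_ord /= => -> /addnI.
Qed.

End SortedDetermined.

(** In odd dimension a self-dual complete flag has a middle line. It must fall in a step that is its
    own opposite, so symmetric forms require [N] odd. *)
Definition lvalid (eps : bool) (d N : nat) (r : seq nat) : Prop :=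
  [/\ size r = d, forall c, (c < d)%N -> (nth 0%N r c < N)%N & ~~ eps -> odd N].

Definition lrank (m d N : nat) (r : seq nat) (i : nat) : nat :=
  \sum_(c < m) (lext m d N r c < i)%N.

Section Realize.
Variables (F : finFieldType) (eps : bool) (m d : nat) (b : 'M[F]_m).
Hypothesis adm : admissible eps b.
Hypothesis md : m = (d.*2 + ~~ eps)%N.
Variable N : nat.

Lemma lext_lt r c : lvalid eps d N r -> (c < m)%N -> (lext m d N r c < N)%N.
Proof.
case=> sr rN oN cm; rewrite /lext; case: ifP => cd; first exact: rN.
case: ifP => cd'; first by have := oN; case: eps md => /=; lia.
by have := rN (m.-1 - c)%N; lia.
Qed.

Lemma lext_dual r c : lvalid eps d N r -> (c < m)%N ->
  lext m d N r (m.-1 - c) = (N.-1 - lext m d N r c)%N.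
Proof.
move=> val cm; have := lext_lt val cm; case: val => sr rN oN.
rewrite /lext; case: (ltnP c d) => cd.
  rewrite !ifN; [|lia|lia]; have -> : (m.-1 - (m.-1 - c) = c)%N by lia.
  by [].
case: (ltnP c (m - d)) => cd' xN.
  have e : (m.-1 - c = c)%N by lia.
  by rewrite e ifN ?cd' -?leqNgt //; have := oN; case: eps md => /=; lia.
by have := rN (m.-1 - c)%N; rewrite ifT; lia.
Qed.

Lemma lext_sorted r : lvalid eps d N r -> lsorted d N [::] r ->
  forall c c', (c <= c')%N -> (c' < m)%N -> (lext m d N r c <= lext m d N r c')%N.
Proof.
move=> val /lsortedP srt c; elim=> [|c' IH] cc' cm.
  by move: cc'; rewrite leqn0 => /eqP ->.
move: cc'; rewrite leq_eqVlt => /orP[/eqP -> //|cc'].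
apply: leq_trans (IH cc' (ltnW cm)) _.
apply: (symmetric_sorted md (N := N) (dm := [::])) => //.
- by move=> k km; apply: lext_dual.
- by move=> k km; apply: lext_lt.
move=> j jd jn; have := srt j jd jn; rewrite /lpartner /lext jd.
by case: ifP => jd'.
Qed.

Lemma rank_lab (V : flag F m N) C i : sdflag b V -> chamber b C -> (i <= N)%N ->
  \rank (subsp V i) = lrank m d N (lab d V C) i.
Proof.
move=> sV chC iN; rewrite (sum_jump (sdflag_flag sV) chC iN).
by apply: eq_bigr => c _; rewrite (jump_lext adm md sV chC).
Qed.

Lemma lrankN r i : lvalid eps d N r -> (i <= N)%N ->
  lrank m d N r (N - i) = (m - lrank m d N r i)%N.
Proof.
move=> val iN; rewrite {1}/lrank (reindex_inj rev_ord_inj) /=.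
have e : (\sum_(c < m) (lext m d N r (m - c.+1) < N - i) + lrank m d N r i = m)%N.
  rewrite -[RHS](card_ord m) -sum1_card.
  rewrite -big_split /=; apply: eq_bigr => c _.
  have -> : (m - c.+1 = m.-1 - c)%N by lia.
  rewrite lext_dual //; have := lext_lt val (ltn_ord c).
  by move: (lext _ _ _ _ _) => x; lia.
by rewrite -[X in _ = (X - _)%N]e addnK.
Qed.

Lemma exists_chamber : exists C, chamber b C.
Proof.
(* The trivial flag with a single step is self-dual, so some chamber refines it. *)
pose V : flag F m 1 := [ffun i : 'I_2 => if i == ord0 then 0 else 1%:M].
have sV : sdflag b V.
  apply/andP; split.
    apply/and4P; split.
    - by apply/forallP=> i; rewrite ffunE; case: ifP; rewrite ?genmx0 ?genmx1.
    - by rewrite ffunE eqxx.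
    - by rewrite ffunE.
    apply/forallP=> i; apply/forallP=> j; apply/implyP=> ij; rewrite !ffunE.
    case: (eqVneq i ord0) => [_|i0]; first exact: sub0mx.
    rewrite ifN ?submx_refl //; apply: contra i0 => /eqP j0; move: ij; rewrite j0 leqn0.
    by move=> /eqP i0; apply/eqP/val_inj.
  apply/forallP=> i; apply/eqmxP; rewrite !ffunE -[orthomx _ _ _]/(orth b _).
  case: (eqVneq i ord0) => [->|i0] /=.
    apply/eqmx_rank_sub; first exact: sub0mx.
    by rewrite (rank_orth adm) mxrank1 subnn.
  have -> : rev_ord i == ord0.
    by case: i i0 => [[|[|i]] ?] //= _; apply/eqP/val_inj.
  by apply/eqmx_sym/eqmx_rank_sub; rewrite ?submx1 // (rank_orth adm) mxrank0 mxrank1 subn0.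
by have [C chC _] := exists_chamber_refining adm md sV; exists C.
Qed.

(** A sorted label is realised by keeping, in any chamber, the members of the dimensions prescribed
    by [lrank]. An unsorted one is a reflection of a label of smaller potential, and [exists_lrefl]
    performs this reflection inside a panel. *)
Lemma exists_lab r : lvalid eps d N r ->
  exists (V : flag F m N) (C : flag F m m), [/\ sdflag b V, chamber b C & lab d V C = r].
Proof.
move=> val; have [k] := ubnP (lpotential d r); elim: k r val => // k IH r val; rewrite ltnS => pk.
have [sr rN oN] := val.
case: (boolP (lsorted d N [::] r)) => [srt|]; last first.
  case/allPn=> j; rewrite mem_iota add0n /= => jd; rewrite -ltnNge => xy.
  have pN : (lpartner d N j r < N)%N.
    by rewrite /lpartner; case: ifP => jd'; [apply: rN | have := rN j jd; lia].
  have [e1 e2] := lrefl_partner jd (rN j jd).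
  have val' : lvalid eps d N (lrefl d N j r).
    split=> [|c cd|//]; first exact: size_lrefl.
    by rewrite nth_mkseq //; case: ifP => // _; case: ifP => // _; apply: rN.
  have [|V [C [sV chC e]]] := IH _ val'; first exact: leq_trans (lpotential_lrefl jd xy) pk.
  have [|C' p' e'] := exists_lrefl adm md sV chC jd (j := j).
    by rewrite e e1 e2 ltn_eqF.
  exists V, C'; split=> //; first exact: panel_chamber p'.
  by rewrite e' e lrefl_invol //; apply: rN.
have [C chC] := exists_chamber; have fC := chamber_flag chC; have sC := chamber_sdflag chC.
pose h := lrank m d N r.
have hm i : (h i <= m)%N.
  rewrite /h /lrank -[X in (_ <= X)%N]card_ord -sum1_card.
  by apply: leq_sum => c _; apply: leq_b1.
have hS i j : (i <= j)%N -> (h i <= h j)%N.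
  move=> ij; apply: leq_sum => c _; case: (ltnP _ i) => //= ci.
  by rewrite (leq_trans ci ij).
have h0 : h 0 = 0 by rewrite /h /lrank big1.
have hd i : (i <= N)%N -> h (N - i)%N = (m - h i)%N by exact: lrankN.
have hN : h N = m by rewrite -[N in LHS]subn0 hd // h0 subn0.
pose V : flag F m N := [ffun i : 'I_N.+1 => subsp C (h i)].
have fV i : (i <= N)%N -> subsp V i = subsp C (h i) by move=> iN; rewrite /subsp ffunE inordK.
have sV : sdflag b V.
  apply/andP; split.
    apply/and4P; split.
    - by apply/forallP=> i; rewrite ffunE genmx_subsp.
    - by rewrite ffunE h0 subsp0.
    - by rewrite ffunE hN subsp_last.
    apply/forallP=> i; apply/forallP=> j; apply/implyP=> ij; rewrite !ffunE.
    by apply: (subspS fC) => //; apply: hS.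
  apply/forallP=> i; apply/eqmxP; rewrite !ffunE -[orthomx _ _ _]/(orth b _).
  apply: (eqmx_trans (subsp_orth sC (hm i))); rewrite /= subSS.
  by rewrite hd // leq_ord.
exists V, C; split=> //.
apply: (@eq_from_nth _ 0%N); rewrite ?size_lab ?sr // => c cd; rewrite nth_lab //.
have cm : (c < m)%N by clear -cd md; lia.
have key i : (i <= N)%N -> (jump V C c < i)%N = (nth 0%N r c < i)%N.
  move=> iN; rewrite (ltn_jump C (sdflag_flag sV) c iN) fV //.
  have := @ltn_count_antitone m (fun k => (k == 0) || (lext m d N r k.-1 < i)%N) isT _ c.+1.
  rewrite -/(h i) /= => e.
  have {e} -> : (nth 0%N r c < i)%N = (c < h i)%N.
    have {1}-> : nth 0%N r c = lext m d N r c by rewrite /lext cd.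
    apply: negb_inj; rewrite -e //; first by rewrite -leqNgt.
    move=> [|x] [|y] //= xy ym; apply: leq_ltn_trans; exact: (lext_sorted val srt).
  case: (ltnP c (h i)) => ch.
    apply/negP => /(submx_trans _) s.
    have /mxrankS : (subsp C c.+1 <= subsp C c)%MS.
      by apply: s; rewrite sub_capmx submx_refl andbT; apply: (subspS fC).
    by rewrite !(chamber_rank chC) ?ltnn // ltnW.
  apply/negbTE; rewrite negbK (submx_trans (capmxSl _ _)) // (subspS fC) //; exact: ltnW.
have j1 := jump_lt (sdflag_flag sV) chC cm.
have := key _ j1; have := key _ (rN c cd); clear -j1; lia.
Qed.

End Realize.

(** * Transitivity of the isometry group *)

Section Newton.
Variables (F : fieldType) (m : nat) (e : F).
Hypothesis two : 2%:R != 0 :> F.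

(* Newton's iteration [t := 1 - u / 2] for the inverse square root of [1 + u]. *)
Lemma unipotent_isometric (k : nat) (B B1 : 'M[F]_m) :
  B \in unitmx -> B^T = e *: B -> B1^T = e *: B1 -> e != 0 ->
  (B1 *m invmx B - 1%:M) ^+ (2 ^ k) = 0 ->
  exists t : 'M[F]_m, t *m B1 *m t^T = B /\
    forall S : 'M[F]_m, (S *m (B1 *m invmx B) <= S)%MS -> (S *m t <= S)%MS.
Proof.
move=> uB eB + e0; elim: k B1 => [|k IH] B1 eB1.
  rewrite expn0 expr1 => /eqP; rewrite subr_eq0 => /eqP A1; exists 1%:M.
  split=> [|S _]; last by rewrite mulmx1.
  by rewrite trmx1 mulmx1 mul1mx -[B1](mulmxKV uB) A1 mul1mx.
pose A := B1 *m invmx B; pose h : F := 2%:R^-1.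
have [u uE] : exists u, u = A - 1%:M by exists (A - 1%:M).
rewrite -/A -uE => uk.
have hh : h + h = 1 by rewrite -mulr2n -mulr_natl /h mulfV.
have AB : A *m B = B1 by rewrite /A mulmxKV.
pose t0 : 'M[F]_m := 1%:M - h *: u.
have t0E : t0 *m B = B - h *: (B1 - B).
  by rewrite /t0 uE mulmxBl mul1mx -scalemxAl mulmxBl mul1mx AB.
(* [t0] is self-adjoint for [B], so the new quotient is [t0 *m A *m t0]. *)
have t0B : B *m t0^T = t0 *m B.
  have : (t0 *m B)^T = e *: (t0 *m B).
    by rewrite t0E; apply/matrixP=> i j; rewrite !mxE;
       have := congr1 (fun M : 'M_m => M i j) eB; have := congr1 (fun M : 'M_m => M i j) eB1;
       rewrite !mxE => -> ->; ring.
  rewrite trmx_mul eB -scalemxAl => /(congr1 (fun M => e^-1 *: M)).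
  by rewrite !scalerA mulVf // !scale1r.
have eB1' : (t0 *m B1 *m t0^T)^T = e *: (t0 *m B1 *m t0^T).
  by rewrite !trmx_mul trmxK eB1 -!(scalemxAl, scalemxAr) mulmxA.
have A' : t0 *m B1 *m t0^T *m invmx B = t0 *m A *m t0.
  by rewrite -AB -!mulmxA (mulmxA B) t0B !mulmxA mulmxK.
have A1u : A = 1%:M + u by rewrite uE addrC subrK.
have step1 : A *m t0 = 1%:M + h *: u - h *: (u *m u).
  rewrite A1u /t0 mulmxBr mulmx1 mulmxDl mul1mx -scalemxAr.
  move: (u *m u) (1%:M : 'M[F]_m) (u) => X I w; apply/matrixP=> i j; rewrite !mxE.
  by rewrite -{1}[w i j]mul1r -hh; ring.
(* The new error is divisible by the square of [u], so the nilpotency exponent [2 ^ k.+1] drops to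
   [2 ^ k]. *)
have sq : t0 *m B1 *m t0^T *m invmx B - 1%:M =
    (u *m u) *m (h ^+ 2 *: u - (h + h ^+ 2) *: 1%:M).
  rewrite A' -mulmxA step1 /t0 mulmxBl mul1mx -!scalemxAl.
  rewrite !(mulmxBr, mulmxDr) mulmx1 -!scalemxAr !mulmxA mulmx1.
  move: (u *m u *m u) (u *m u) (1%:M : 'M[F]_m) (u) => Y X I w; apply/matrixP=> i j.
  by rewrite !mxE; ring.
have pow0 : (t0 *m B1 *m t0^T *m invmx B - 1%:M) ^+ (2 ^ k) = 0.
  rewrite sq -[X in X ^+ _]/(_ * _) exprMn_comm.
    by rewrite -[X in X ^+ _ * _]/(u ^+ 2) -exprM -expnS uk mul0r.
  rewrite /GRing.comm -![_ * _]/(_ *m _) mulmxBr mulmxBl -!scalemxAr -!scalemxAl.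
  by rewrite mulmx1 mul1mx !mulmxA.
have [t [tB tS]] := IH _ eB1' pow0.
exists (t *m t0); split.
  by rewrite trmx_mul -[RHS]tB !mulmxA.
(* The factors of [t] are built from [A] by ring operations, so they preserve every row space that
   [A] preserves. *)
move=> S SA.
have St0 : (S *m t0 <= S)%MS.
  rewrite /t0 mulmxBr mulmx1 -scalemxAr addmx_sub // eqmx_opp scalemx_sub //.
  by rewrite uE mulmxBr mulmx1 addmx_sub // eqmx_opp.
rewrite mulmxA; apply: (submx_trans _ St0); apply: submxMr; apply: tS.
have -> : S *m (t0 *m B1 *m t0^T *m invmx B) = S *m t0 *m A *m t0 by rewrite A' !mulmxA.
apply: (submx_trans _ St0); apply: submxMr.
by apply: (submx_trans _ SA); apply: submxMr.
Qed.

End Newton.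

(** * Adapted bases and their Gram matrices *)

Section AdaptedBasis.
Variables (F : finFieldType) (m : nat) (b : 'M[F]_m).
Local Notation chamber := (chamber b).

(** [dsel p *m P] spans the rows of [P] selected by [p]. Keeping coordinate subspaces as square
    matrices independent of [P] lets two bases be compared on the same selection. *)
Definition dsel (p : pred nat) : 'M[F]_m := diag_mx (\row_(c < m) (p c)%:R).

Lemma row_dsel_mul (p : pred nat) c (P : 'M[F]_m) : row c (dsel p *m P) = (p c)%:R *: row c P.
Proof. by apply/rowP=> j; rewrite mul_diag_mx !mxE. Qed.

Lemma dsel_sub q (p : pred nat) (P : 'M[F]_m) (W : 'M[F]_(q, m)) :
  (forall c : 'I_m, p c -> (row c P <= W)%MS) -> (dsel p *m P <= W)%MS.
Proof.
move=> sub; apply/row_subP=> c; rewrite row_dsel_mul; case: (boolP (p c)) => pc.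
  by rewrite scale1r sub.
by rewrite scale0r sub0mx.
Qed.

Lemma row_sub_dsel (p : pred nat) (c : 'I_m) (P : 'M[F]_m) : p c -> (row c P <= dsel p *m P)%MS.
Proof. by move=> pc; have := row_dsel_mul p c P; rewrite pc scale1r => <-; apply: row_sub. Qed.

Lemma dselS (p q : pred nat) (P : 'M[F]_m) : (forall c : 'I_m, p c -> q c) ->
  (dsel p *m P <= dsel q *m P)%MS.
Proof. by move=> pq; apply: dsel_sub => c /pq; apply: row_sub_dsel. Qed.

(** A Bruhat-type decomposition: by definition of the jump, [V_(jump + 1) :&: C_(c+1)] contains a
    vector outside [C_c]. Rank counting shows that these vectors span every [V_i :&: C_c]. *)
Lemma exists_adapted_basis N (V : flag F m N) C : is_flag V -> chamber C ->
  exists2 P : 'M[F]_m, P \in unitmx &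
    (forall i, (i <= N)%N -> (subsp V i :=: dsel (fun c => jump V C c < i)%N *m P)%MS) /\
    (forall c, (c <= m)%N -> (subsp C c :=: dsel (fun k => k < c)%N *m P)%MS).
Proof.
move=> fV chC; have fC := chamber_flag chC.
have ex (c : 'I_m) : exists u : 'rV[F]_m, (u <= subsp V (jump V C c).+1 :&: subsp C c.+1)%MS &&
    ~~ (u <= subsp C c)%MS.
  have jN := jump_lt fV chC (ltn_ord c).
  have := ltn_jump C fV c jN; rewrite ltnSn => /esym/exists_row_notin[u u1 u2].
  by exists u; rewrite u1.
pose P : 'M[F]_m := \matrix_c xchoose (ex c).
have rP c : (row c P <= subsp V (jump V C c).+1)%MS /\ (row c P <= subsp C c.+1)%MS.
  by rewrite rowK; have /andP[] := xchooseP (ex c); rewrite sub_capmx => /andP[].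
have nP c : ~~ (row c P <= subsp C c)%MS by rewrite rowK; have /andP[] := xchooseP (ex c).
have main i c : (i <= N)%N -> (c <= m)%N ->
    (subsp V i :&: subsp C c <= dsel (fun k => (jump V C k < i) && (k < c))%N *m P)%MS.
  move=> iN; elim: c => [|c IH] cm; first by rewrite (subsp0 fC) capmx0 sub0mx.
  have {}IH := IH (ltnW cm); have jE := ltn_jump C fV c iN.
  have mono : (dsel (fun k => (jump V C k < i) && (k < c))%N *m P <=
      dsel (fun k => (jump V C k < i) && (k < c.+1))%N *m P)%MS.
    by apply: dselS => k /andP[-> kc]; rewrite ltnW.
  case: (boolP (jump V C c < i)%N) jE => [ji nj|_ /esym/negbFE sj]; last first.
    apply: submx_trans mono; apply: submx_trans IH.
    by rewrite sub_capmx capmxSl sj.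
  pose oc := Ordinal cm; have [rV rC] := rP oc.
  have s1 : (subsp V i :&: subsp C c + row oc P <= subsp V i :&: subsp C c.+1)%MS.
    rewrite addsmx_sub capmxS ?(subspS fC) //= sub_capmx rC andbT.
    by apply: submx_trans rV (subspS fV _ iN).
  have /eqmx_rank_sub e := s1.
  rewrite -e; last first.
    rewrite rank_adds_row; last by apply: contra (nP oc) => /submx_trans; apply; apply: capmxSr.
    rewrite -!/(rcap _ _ _ _) -/(rcap V C i c) !(rcap_jump fV chC iN) ?(ltnW cm) //.
    by rewrite big_ord_recr /= ji addn1.
  rewrite addsmx_sub (submx_trans IH mono) /=.
  by apply: (row_sub_dsel (p := fun k => (jump V C k < i) && (k < c.+1))%N); rewrite /= ji ltnSn.
have full : row_full P.
  rewrite -sub1mx; apply: submx_trans (_ : dsel (fun k => (jump V C k < N) && (k < m))%N *m P <= P)%MS.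
    apply: submx_trans (main N m (leqnn _) (leqnn _)).
    by rewrite (subsp_last fV) (subsp_last fC) sub_capmx !submx1.
  exact: submxMl.
exists P; first by rewrite -row_full_unit.
split=> [i iN|c cm].
  apply/eqmxP/andP; split.
    apply: submx_trans (_ : subsp V i :&: subsp C m <= _)%MS.
      by rewrite (subsp_last fC) sub_capmx submx_refl submx1.
    by apply: submx_trans (main i m iN (leqnn m)) _; apply: dselS => k /andP[].
  by apply: dsel_sub => k ki; apply: submx_trans (proj1 (rP k)) (subspS fV ki iN).
apply/eqmxP/andP; split.
  apply: submx_trans (_ : subsp V N :&: subsp C c <= _)%MS.
    by rewrite (subsp_last fV) sub_capmx submx_refl submx1.
  by apply: submx_trans (main N c (leqnn N) cm) _; apply: dselS => k /andP[].
by apply: dsel_sub => k kc; apply: submx_trans (proj2 (rP k)) (subspS fC kc cm).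
Qed.

End AdaptedBasis.

(** Already the power [m] vanishes; the exponent is a larger power of 2 to fit the Newton
    iteration. *)
Lemma strictly_lower_nilpotent (F : fieldType) m (u : 'M[F]_m) :
  (forall c k : 'I_m, (c <= k)%N -> u c k = 0) -> u ^+ (2 ^ m) = 0.
Proof.
move=> u0; have key j (c k : 'I_m) : (c < k + j)%N -> (u ^+ j) c k = 0.
  elim: j c k => [|j IH] c k ckj.
    by rewrite expr0 mxE; case: eqVneq ckj => // ->; rewrite addn0 ltnn.
  rewrite exprS -[_ * _]/(_ *m _) mxE big1 // => l _.
  case: (leqP c l) => cl; first by rewrite u0 ?mul0r.
  by rewrite IH ?mulr0 //; lia.
have um : u ^+ m = 0.
  by apply/matrixP=> c k; rewrite key ?mxE //; have := ltn_ord c; lia.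
by rewrite -(subnKC (ltnW (ltn_expl m (ltnSn 1)))) exprD um mul0r.
Qed.

Section Gram.
Variables (F : finFieldType) (eps : bool) (m : nat) (b : 'M[F]_m).
Hypothesis adm : admissible eps b.
Local Notation orth := (orth b).
Local Notation chamber := (chamber b).
Local Notation sdflag := (sdflag b).
Local Notation dsel := (@dsel F m).
Local Notation gram P := (P *m b *m P^T).

Lemma gram_tr (P : 'M[F]_m) : (gram P)^T = (-1) ^+ eps *: gram P.
Proof. by rewrite !trmx_mul trmxK (form_tr adm) -scalemxAl -scalemxAr mulmxA. Qed.

Lemma gram_unit (P : 'M[F]_m) : P \in unitmx -> gram P \in unitmx.
Proof. by move=> uP; rewrite !unitmx_mul unitmx_tr uP (form_unit adm). Qed.

Lemma gramE (P : 'M[F]_m) c k : gram P c k = (row c P *m b *m (row k P)^T) 0 0.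
Proof.
rewrite -row_mul tr_row !mxE; apply: eq_bigr => l _; rewrite !mxE; congr (_ * _).
Qed.

Lemma sub_dsel0 (p : pred nat) (x : 'rV[F]_m) (k : 'I_m) : (x <= dsel p)%MS -> ~~ p k -> x 0 k = 0.
Proof.
case/submxP=> y -> nk; rewrite mul_mx_diag !mxE (negPf nk) mulr0 //.
Qed.

(* The Gram matrices of two bases adapted to self-dual flags of the same shape
   differ by a matrix which preserves the common coordinate flag. *)
Lemma gram_stable N (V V1 : flag F m N) (S : nat -> 'M[F]_m) (P P1 : 'M[F]_m) :
  sdflag V -> sdflag V1 -> P \in unitmx ->
  (forall i, (i <= N)%N -> (subsp V i :=: S i *m P)%MS) ->
  (forall i, (i <= N)%N -> (subsp V1 i :=: S i *m P1)%MS) ->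
  forall i, (i <= N)%N -> (S i *m (gram P1 *m invmx (gram P)) <= S i)%MS.
Proof.
move=> sV sV1 uP eV eV1 i iN.
have fP : row_free P by rewrite row_free_unit.
rewrite -(submxMfree _ _ fP).
rewrite -(eV i iN) (subsp_orth sV iN) sub_orth.
have /submxP[D ->] : (subsp V (N - i) <= S (N - i)%N *m P)%MS by rewrite eV // leq_subr.
have /submxP[D1 e1] : (S i *m P1 <= orth (subsp V1 (N - i)))%MS by rewrite -(subsp_orth sV1 iN) eV1.
have z : S i *m gram P1 *m (S (N - i)%N)^T = 0.
  have : (S i *m P1 <= orth (subsp V1 (N - i)))%MS by rewrite -(subsp_orth sV1 iN) eV1.
  rewrite sub_orth => /eqP z.
  have /submxP[D2 e2] : (S (N - i)%N *m P1 <= subsp V1 (N - i))%MS by rewrite eV1 // leq_subr.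
  have -> : S i *m gram P1 *m (S (N - i)%N)^T = S i *m P1 *m b *m (S (N - i)%N *m P1)^T.
    by rewrite trmx_mul !mulmxA.
  by rewrite e2 trmx_mul mulmxA z mul0mx.
have -> : S i *m (gram P1 *m invmx (gram P)) *m P *m b *m (D *m (S (N - i)%N *m P))^T =
    S i *m gram P1 *m (S (N - i)%N)^T *m D^T.
  rewrite !trmx_mul !mulmxA; congr (_ *m _ *m _).
  rewrite -!mulmxA; congr (S i *m _); rewrite !mulmxA.
  have -> : P1 *m b *m P1^T *m invmx (gram P) *m P *m b *m P^T =
     P1 *m b *m P1^T *m (invmx (gram P) *m gram P) by rewrite !mulmxA.
  by rewrite mulVmx ?mulmx1 ?gram_unit.
by rewrite z mul0mx.
Qed.

Section Chamber.
Variables (C : flag F m m) (P : 'M[F]_m).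
Hypotheses (chC : chamber C) (uP : P \in unitmx).
Hypothesis eC : forall c, (c <= m)%N -> (subsp C c :=: dsel (fun k => k < c)%N *m P)%MS.

Lemma row_adapted (c : 'I_m) k : (c < k)%N -> (k <= m)%N -> (row c P <= subsp C k)%MS.
Proof.
by move=> ck km; rewrite eC //; apply: (row_sub_dsel (p := fun k' => k' < k)%N).
Qed.

(** Row [k] lies in [C_(m - c - 1)], the orthogonal of [C_(c+1)], which contains row [c]: the Gram
    matrix is anti-triangular. *)
Lemma gram0 (c k : 'I_m) : (c + k < m.-1)%N -> gram P c k = 0.
Proof.
move=> ck; rewrite gramE; have := row_adapted (ltnSn c) (ltn_ord c).
rewrite (subsp_orth (chamber_sdflag chC) (ltn_ord c)) sub_orth => /eqP z.
have /submxP[D ->] : (row k P <= subsp C (m - c.+1))%MS.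
  by apply: row_adapted; [lia | exact: leq_subr].
by rewrite trmx_mul mulmxA z mul0mx mxE.
Qed.

(** If this entry vanished as well, row [c] would be orthogonal to [C_(m - c)] and hence belong to
    [C_c]. *)
Lemma gram_rev_neq0 (c : 'I_m) : gram P c (rev_ord c) != 0.
Proof.
apply/eqP => z; have cm := ltn_ord c.
have s : (row c P <= subsp C c)%MS.
  rewrite (subsp_orth (chamber_sdflag chC) (ltnW cm)) sub_orth.
  have /submxP[D ->] : (subsp C (m - c) <= dsel (fun k => k < m - c)%N *m P)%MS.
    by rewrite eC // leq_subr.
  rewrite trmx_mul mulmxA; suff -> : row c P *m b *m (dsel (fun k => k < m - c)%N *m P)^T = 0.
    by rewrite mul0mx.
  apply/rowP=> k; rewrite -[LHS](_ : (row c P *m b *m (row k (dsel (fun k => k < m - c)%N *m P))^T) 0 0 = _).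
    rewrite row_dsel_mul linearZ /= -scalemxAr mxE -gramE [RHS]mxE.
    case: (ltnP k (m - c)) => kc /=; last by rewrite mul0r.
    case: (eqVneq k (rev_ord c)) => [->|nk]; first by rewrite z mulr0.
    rewrite gram0 ?mulr0 //; have : (k : nat) != (m - c.+1)%N by [].
    by clear -kc cm; lia.
  by rewrite [LHS]mxE [RHS]mxE; apply: eq_bigr => l _; congr (_ * _); rewrite !mxE.
have : (subsp C c.+1 <= subsp C c)%MS.
  rewrite eC //; apply: dsel_sub => k; rewrite ltnS leq_eqVlt => /orP[/eqP ek|kc].
    by rewrite (_ : k = c) //; apply/val_inj.
  by apply: row_adapted => //; apply: ltnW.
by move/mxrankS; rewrite !(chamber_rank chC) ?ltnn // ltnW.
Qed.

Lemma lower_diag (B1 : 'M[F]_m) : (forall c k : 'I_m, (c < k)%N -> (B1 *m invmx (gram P)) c k = 0) ->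
  forall c, (B1 *m invmx (gram P)) c c * gram P c (rev_ord c) = B1 c (rev_ord c).
Proof.
move=> low c; have {2}-> : B1 = B1 *m invmx (gram P) *m gram P by rewrite mulmxKV ?gram_unit.
rewrite [RHS]mxE (bigD1 c) //= big1 ?addr0 // => k kc.
case: (ltnP c k) => ck; first by rewrite low ?mul0r.
rewrite gram0 ?mulr0 //=; have : (k : nat) != c by [].
by have := ltn_ord c; clear -ck; lia.
Qed.

End Chamber.

Lemma stable_lower (A : 'M[F]_m) :
  (forall c, (c <= m)%N -> (dsel (fun k => k < c)%N *m A <= dsel (fun k => k < c)%N)%MS) ->
  forall c k : 'I_m, (c < k)%N -> A c k = 0.
Proof.
move=> st c k ck.
have := submx_trans (row_sub c _) (st c.+1 (ltn_ord c)).
rewrite row_dsel_mul ltnSn scale1r => s.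
have := sub_dsel0 s (_ : ~~ (k < c.+1)%N); rewrite mxE; apply.
by rewrite -leqNgt.
Qed.

End Gram.

Section Transitivity.
Variables (F : finFieldType) (eps : bool) (m : nat) (b : 'M[F]_m).
Hypothesis adm : admissible eps b.
Local Notation orth := (orth b).
Local Notation chamber := (chamber b).
Local Notation sdflag := (sdflag b).
Local Notation dsel := (@dsel F m).
Local Notation gram P := (P *m b *m P^T).

(** A priori the middle entries of two Gram matrices could differ by a nonsquare. But both represent
    the same form, so [\det A] is a square, and the other diagonal entries of [A] are equal in
    opposite pairs. *)
Lemma middle_square (C C1 : flag F m m) (P P1 : 'M[F]_m) (od : 'I_m) :
  chamber C -> chamber C1 -> P \in unitmx -> P1 \in unitmx ->
  (forall c, (c <= m)%N -> (subsp C c :=: dsel (fun k => k < c)%N *m P)%MS) ->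
  (forall c, (c <= m)%N -> (subsp C1 c :=: dsel (fun k => k < c)%N *m P1)%MS) ->
  rev_ord od = od -> exists s, s ^+ 2 * gram P1 od od = gram P od od.
Proof.
move=> chC chC1 uP uP1 eC eC1 rod.
have st := gram_stable adm (chamber_sdflag chC) (chamber_sdflag chC1) uP eC eC1.
set A := gram P1 *m invmx (gram P); have low := stable_lower st.
have di c : A c c * gram P c (rev_ord c) = gram P1 c (rev_ord c) := lower_diag adm chC uP eC low c.
have sy c : A (rev_ord c) (rev_ord c) = A c c.
  have nz := gram_rev_neq0 chC uP eC c.
  have tr (Q : 'M[F]_m) : gram Q (rev_ord c) c = (-1) ^+ eps * gram Q c (rev_ord c).
    by have := congr1 (fun M : 'M_m => M c (rev_ord c)) (gram_tr adm Q); rewrite !mxE.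
  have := di (rev_ord c); rewrite rev_ordK !tr -di mulrCA => /(mulfI _) e.
  by apply: (mulIf nz); apply: e; rewrite signr_eq0.
have dA : \det A = \prod_c A c c.
  by apply: det_trig; apply/is_trig_mxP => i j ij; apply: low.
pose q := \prod_(c < m | (c < od)%N) A c c.
have dq : \det A = q ^+ 2 * A od od.
  rewrite dA (bigID (fun c : 'I_m => c < od)%N) /= -/q (bigD1 od) /= ?ltnn //.
  (* The factors beyond the middle repeat those before it, by [sy]. *)
  rewrite [X in _ * (_ * X)](_ : _ = q); first by ring.
  rewrite (reindex_inj rev_ord_inj) /=; apply: eq_big => [c|c _]; last exact: sy.
  have := congr1 val rod; have := ltn_ord c; have := ltn_ord od => /= h1 h2 h3.
  rewrite -(inj_eq val_inj) /=; move: (nat_of_ord c) (nat_of_ord od) h1 h2 h3; clear.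
  by move=> x y; lia.
have dP : \det A * \det P ^+ 2 = \det P1 ^+ 2.
  have nb : \det b != 0 by rewrite -unitfE -unitmxE (form_unit adm).
  have e0 : \det A * \det (gram P) = \det (gram P1) by rewrite -det_mulmx mulmxKV ?(gram_unit adm).
  have eg (Q : 'M[F]_m) : \det (gram Q) = \det Q * \det b * \det Q.
    by rewrite !det_mulmx det_tr.
  rewrite !eg in e0; apply: (mulIf nb).
  transitivity (\det A * (\det P * \det b * \det P)); first by ring.
  by rewrite e0; ring.
have nP : \det P != 0 by rewrite -unitfE -unitmxE.
have nP1 : \det P1 != 0 by rewrite -unitfE -unitmxE.
have nA : q ^+ 2 * A od od != 0.
  by rewrite -dq; apply: contraNneq nP1 => dA0; rewrite -sqrf_eq0 -dP dA0 mul0r.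
move: nA; rewrite mulf_eq0 negb_or expf_eq0 /= => /andP[nq nA].
(* Its square is [q ^+ 2 / \det A], the inverse of the middle entry of [A]. *)
exists (q * \det P / \det P1).
have := di od; rewrite rod => <-; rewrite expr_div_n -dP dq exprMn.
by field; rewrite nP nq nA.
Qed.

Lemma chamber_transitive N (V V1 : flag F m N) (C C1 : flag F m m) :
  sdflag V -> sdflag V1 -> chamber C -> chamber C1 ->
  (forall c, (c < m)%N -> jump V C c = jump V1 C1 c) ->
  exists g, [/\ isometry b g, act g V = V1 & act g C = C1].
Proof.
move=> sV sV1 chC chC1 ej; have fV := sdflag_flag sV; have fV1 := sdflag_flag sV1.
have [P uP [eV eC]] := exists_adapted_basis fV chC.
have [P1 uP1 [eV1 eC1]] := exists_adapted_basis fV1 chC1.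
have selE i : dsel (fun c => jump V1 C1 c < i)%N = dsel (fun c => jump V C c < i)%N.
  by congr diag_mx; apply/rowP=> c; rewrite !mxE ej.
have [lam [nlam elam]] : exists lam : 'rV[F]_m, (forall c, lam 0 c != 0) /\
    forall c, lam 0 c * lam 0 (rev_ord c) * gram P1 c (rev_ord c) = gram P c (rev_ord c).
  have nz := gram_rev_neq0 chC uP eC; have nz1 := gram_rev_neq0 chC1 uP1 eC1.
  have [s es] : exists s, forall c, rev_ord c = c -> s ^+ 2 * gram P1 c c = gram P c c.
    case: (pselect (exists c : 'I_m, rev_ord c = c)) => [[c rc]|nc]; last first.
      by exists 0 => c rc; case: nc; exists c.
    have [s es] := middle_square chC chC1 uP uP1 eC eC1 rc; exists s => c' rc'.
    suff -> : c' = c by [].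
    apply/val_inj; have := congr1 val rc; have := congr1 val rc'; have := ltn_ord c.
    by have := ltn_ord c'; rewrite /=; clear; lia.
  (* Only the products of opposite entries are prescribed: the first of a pair carries the ratio and
     the second is 1. A middle entry is squared, whence the root [s]. *)
  pose lam : 'rV[F]_m := (\row_c if (c < rev_ord c)%N then gram P c (rev_ord c) / gram P1 c (rev_ord c)
                 else if c == rev_ord c then s else 1).
  exists lam; have lamE c : lam 0 c = if (c < rev_ord c)%N
      then gram P c (rev_ord c) / gram P1 c (rev_ord c)
      else if c == rev_ord c then s else 1 by rewrite mxE.
  split=> c; rewrite !lamE.
    case: ifP => _; first by rewrite mulf_neq0 ?invr_eq0.
    case: (eqVneq c (rev_ord c)) => [rc|_]; last exact: oner_neq0.
    apply: contraNneq (nz c) => s0; rewrite -rc.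
    by rewrite -es // s0 expr0n /= mul0r.
  rewrite rev_ordK; case: (ltngtP c (rev_ord c)) => cr.
  - rewrite ifN; last by apply/eqP => e; move: cr; rewrite e ltnn.
    by rewrite mulr1 divfK.
  - rewrite ifN; last by apply/eqP => e; move: cr; rewrite -e ltnn.
    have tr (Q : 'M[F]_m) : gram Q (rev_ord c) c = (-1) ^+ eps * gram Q c (rev_ord c).
      by have := congr1 (fun M : 'M_m => M c (rev_ord c)) (gram_tr adm Q); rewrite !mxE.
    by rewrite mul1r !tr -mulf_div divff ?signr_eq0 // mul1r divfK.
  have rc : rev_ord c = c by apply/val_inj/esym; exact: cr.
  by rewrite rc eqxx -expr2 es.
pose L : 'M[F]_m := diag_mx lam.
have uL : L \in unitmx.
  rewrite unitmxE det_diag unitfE; apply/prodf_neq0 => c _; exact: nlam.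
have selL p : (dsel p *m (L *m P1) :=: dsel p *m P1)%MS.
  have -> : dsel p *m (L *m P1) = L *m (dsel p *m P1) by rewrite !mulmxA diag_mxC.
  by apply: eqmxMfull; rewrite row_full_unit.
pose Q := L *m P1; have uQ : Q \in unitmx by rewrite unitmx_mul uL.
have eV1' i : (i <= N)%N -> (subsp V1 i :=: dsel (fun c => jump V C c < i)%N *m Q)%MS.
  by move=> iN; apply: (eqmx_trans (eV1 i iN)); rewrite selE; apply/eqmx_sym/selL.
have eC1' c : (c <= m)%N -> (subsp C1 c :=: dsel (fun k => k < c)%N *m Q)%MS.
  by move=> cm; apply: (eqmx_trans (eC1 c cm)); apply/eqmx_sym/selL.
have stV := gram_stable adm sV sV1 uP eV eV1'.
have stC := gram_stable adm (chamber_sdflag chC) (chamber_sdflag chC1) uP eC eC1'.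
have low := stable_lower stC.
have di := lower_diag adm chC uP eC low.
have gQ c : gram Q c (rev_ord c) = gram P c (rev_ord c).
  rewrite -elam /Q trmx_mul tr_diag_mx !mulmxA mul_mx_diag mxE -!mulmxA mul_diag_mx mxE.
  by rewrite mulrAC.
have nil : (gram Q *m invmx (gram P) - 1%:M) ^+ (2 ^ m) = 0.
  apply: strictly_lower_nilpotent => c k; rewrite leq_eqVlt mxE [X in _ + X]mxE [X in _ - X]mxE.
  case/orP=> [/eqP/val_inj <-|ck]; last first.
    rewrite low // -(inj_eq val_inj) (ltn_eqF ck) subrr //.
  have := di c; rewrite gQ => e; rewrite eqxx; apply/eqP; rewrite subr_eq0; apply/eqP.
  by apply: (mulIf (gram_rev_neq0 chC uP eC c)); rewrite e mul1r.
have [t [tB tS]] := unipotent_isometric (two_neq0 (odd_field adm)) (gram_unit adm uP)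
  (gram_tr adm P) (gram_tr adm Q) (negbT (signr_eq0 _ _)) nil.
have ut : t \in unitmx.
  by have := gram_unit adm uP; rewrite -tB !unitmx_mul => /andP[/andP[]].
pose g := invmx P *m (t *m Q).
have ug : g \in unitmx by rewrite !unitmx_mul unitmx_inv uP ut uL uP1.
(* [t] preserves the coordinate subspaces stable under the Gram quotient, so on these [g] acts as
   the change of basis from [P] to [Q], although it also corrects the form. *)
have acts N' (W W1 : flag F m N') (p : nat -> pred nat) : is_flag W1 ->
    (forall i, (i <= N')%N -> (subsp W i :=: dsel (p i) *m P)%MS) ->
    (forall i, (i <= N')%N -> (subsp W1 i :=: dsel (p i) *m Q)%MS) ->
    (forall i, (i <= N')%N -> (dsel (p i) *m (gram Q *m invmx (gram P)) <= dsel (p i))%MS) ->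
    act g W = W1.
  move=> fW1 eW eW1 stW; apply/ffunP=> i; rewrite ffunE.
  have -> : W i = subsp W i by rewrite /subsp inord_val.
  have -> : W1 i = subsp W1 i by rewrite /subsp inord_val.
  have iN := leq_ord i; rewrite -(genmx_subsp fW1); apply/genmxP/eqmxP.
  apply: (eqmx_trans (eqmxMr _ (eW _ iN))); apply: (eqmx_trans _ (eqmx_sym (eW1 _ iN))).
  have -> : dsel (p i) *m P *m g = dsel (p i) *m t *m Q by rewrite /g !mulmxA mulmxK.
  apply: eqmxMr; apply: eqmx_rank_sub; first exact/tS/stW.
  by rewrite mxrankMfree // row_free_unit.
exists g; split.
- rewrite /isometry ug /=; apply/eqP.
  have -> : g *m b *m g^T = invmx P *m (t *m gram Q *m t^T) *m (invmx P)^T.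
    by rewrite /g !trmx_mul !mulmxA.
  by rewrite tB !mulmxA mulVmx // mul1mx -mulmxA -trmx_mul mulVmx // trmx1 mulmx1.
- by apply: (acts _ _ _ (fun i c => jump V C c < i)%N).
- by apply: (acts _ _ _ (fun i k => k < i)%N) => //; apply: chamber_flag chC1.
Qed.

End Transitivity.

(** * Orbits *)

(** Besides self-duality only the dimensions may be constrained, which makes membership visible in a
    relative position and independent of the field. Maximal isotropy qualifies because in dimension
    2d + 1 it amounts to rank d. *)
Definition good_kind (eps : bool) (m : nat) (P : flag_kind) : Prop :=
  exists K : {ffun 'I_(steps P).+1 -> nat} -> bool,
    forall (F : finFieldType) (b : 'M[F]_m) (V : flag F m (steps P)),
      admissible eps b -> is_flag V ->
      kind_cond b V = selfdual b V && K [ffun i => \rank (V i)].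

Lemma good_complete_flags eps m : good_kind eps m (complete_flags m).
Proof.
exists (fun f : {ffun 'I_m.+1 -> nat} => [forall i : 'I_m.+1, f i == i :> nat]) => F b V _ _ /=; congr (_ && _).
by apply: eq_forallb => i; rewrite ffunE.
Qed.

Lemma good_selfdual_flags eps m N : good_kind eps m (selfdual_flags N).
Proof. by exists (fun=> true) => F b V _ _ /=; rewrite andbT. Qed.

Section GoodKind.
Variables (eps : bool) (m : nat) (P : flag_kind).
Hypothesis good : good_kind eps m P.

Lemma flags_of_sdflag (F : finFieldType) (b : 'M[F]_m) x : admissible eps b ->
  x \in flags_of P b -> sdflag b x.
Proof.
case: good => K e adm; rewrite inE => /andP[fx]; rewrite e // => /andP[sx _].
exact/andP.
Qed.

Lemma flags_of_rank (F F' : finFieldType) (b : 'M[F]_m) (b' : 'M[F']_m) x x' :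
  admissible eps b -> admissible eps b' -> x \in flags_of P b -> sdflag b' x' ->
  (forall i, (i <= steps P)%N -> \rank (subsp x i) = \rank (subsp x' i)) ->
  x' \in flags_of P b'.
Proof.
case: good => K e adm adm' xP /andP[fx' sx'] r; have sx := flags_of_sdflag adm xP.
rewrite inE fx' /= e // sx' /=; move: xP; rewrite inE => /andP[fx].
rewrite e // => /andP[_]; congr (K _); apply/ffunP=> i; rewrite !ffunE.
by have := r i (leq_ord i); rewrite /subsp inord_val.
Qed.

End GoodKind.

Section Coarsen.
Variables (F : finFieldType) (eps : bool) (m : nat) (b : 'M[F]_m).
Hypothesis adm : admissible eps b.

Definition profile (N : nat) (l : nat -> nat) : Prop :=
  [/\ l 0 = 0, l N = m, forall i j, (i <= j)%N -> (j <= N)%N -> (l i <= l j)%N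
    & forall i, (i <= N)%N -> l (N - i)%N = (m - l i)%N].

Definition coarsen N (C : flag F m m) (l : nat -> nat) : flag F m N :=
  [ffun i : 'I_N.+1 => subsp C (l i)].

Lemma profile_rank N (V : flag F m N) : sdflag b V -> profile N (fun i => \rank (subsp V i)).
Proof.
move=> sV; have fV := sdflag_flag sV; split.
- by rewrite subsp0 // mxrank0.
- by rewrite subsp_last // mxrank1.
- by move=> i j ij jN; apply/mxrankS/subspS.
by move=> i iN; apply: (rank_subsp_dual adm).
Qed.

Lemma profile_le N l i : profile N l -> (i <= N)%N -> (l i <= m)%N.
Proof. by case=> _ <- mono _ iN; apply: mono. Qed.

Section Lemmas.
Variables (N : nat) (C : flag F m m) (l : nat -> nat).
Hypotheses (chC : chamber b C) (pl : profile N l).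

Lemma subsp_coarsen i : (i <= N)%N -> subsp (coarsen N C l) i = subsp C (l i).
Proof. by move=> iN; rewrite {1}/subsp ffunE inordK. Qed.

Lemma rank_coarsen i : (i <= N)%N -> \rank (subsp (coarsen N C l) i) = l i.
Proof. by move=> iN; rewrite subsp_coarsen // (chamber_rank chC) // (profile_le pl). Qed.

Lemma coarsen_sdflag : sdflag b (coarsen N C l).
Proof.
case: (pl) => l0 lN mono ld; have fC := chamber_flag chC.
apply/andP; split.
  apply/and4P; split.
  - by apply/forallP=> i; rewrite ffunE genmx_subsp.
  - by rewrite ffunE l0 subsp0.
  - by rewrite ffunE lN subsp_last.
  apply/forallP=> i; apply/forallP=> j; apply/implyP=> ij; rewrite !ffunE.
  by apply: (subspS fC); [apply: mono; rewrite ?leq_ord | rewrite (profile_le pl) ?leq_ord].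
apply/forallP=> i; apply/eqmxP; rewrite !ffunE -[orthomx _ _ _]/(orth b _).
apply: (eqmx_trans (subsp_orth (chamber_sdflag chC) (profile_le pl (leq_ord i)))).
by rewrite /= subSS ld // leq_ord.
Qed.

Lemma coarsen_refines : refines C (coarsen N C l).
Proof.
apply/refinesP; rewrite ?(chamber_flag chC) ?(sdflag_flag coarsen_sdflag) // => i iN.
by rewrite rank_coarsen // subsp_coarsen.
Qed.

Lemma rcap_coarsen N' (V : flag F m N') i k : (k <= N)%N ->
  rcap V (coarsen N C l) i k = rcap V C i (l k).
Proof. by move=> kN; rewrite /rcap subsp_coarsen. Qed.

End Lemmas.

Lemma refines_coarsen N (V : flag F m N) C l : is_flag V -> chamber b C -> refines C V ->
  (forall i, (i <= N)%N -> \rank (subsp V i) = l i) -> coarsen N C l = V.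
Proof.
move=> fV chC /refinesP ref e; apply/ffunP=> i; rewrite ffunE.
have iN := leq_ord i; have /eqmxP/genmxP := ref (chamber_flag chC) fV i iN.
by rewrite !genmx_subsp ?(chamber_flag chC) // e // /subsp inord_val.
Qed.

Lemma rcap_refine N N' (V : flag F m N') (V' : flag F m N) C i k : is_flag V' ->
  chamber b C -> refines C V' -> (k <= N)%N ->
  rcap V V' i k = rcap V C i (\rank (subsp V' k)).
Proof.
move=> fV' chC /refinesP ref kN.
by apply/eqmx_rank/eqmxP/cap_eqmx => //; apply: (ref (chamber_flag chC)).
Qed.

Lemma rcap_act N N' (V : flag F m N) (W : flag F m N') g i k : g \in unitmx ->
  rcap (act g V) (act g W) i k = rcap V W i k.
Proof.
move=> ug; have fg : row_free g by rewrite row_free_unit.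
have e M (U : flag F m M) j : (subsp (act g U) j :=: subsp U j *m g)%MS.
  by rewrite /subsp ffunE; exact: genmxE.
have := mxrank_sum_cap (subsp (act g V) i) (subsp (act g W) k).
have := mxrank_sum_cap (subsp V i) (subsp W k).
have -> : \rank (subsp (act g V) i + subsp (act g W) k)%MS = \rank (subsp V i + subsp W k)%MS.
  by rewrite (adds_eqmx (e _ V i) (e _ W k)) -addsmxMr mxrankMfree.
by rewrite !e !mxrankMfree // -/(rcap V W i k) -/(rcap (act g V) (act g W) i k); lia.
Qed.

End Coarsen.

Section Orbits.
Variables (eps : bool) (m d : nat).
Hypothesis md : m = (d.*2 + ~~ eps)%N.

Section Two.
Variables (F F' : finFieldType) (b : 'M[F]_m) (b' : 'M[F']_m).
Hypotheses (adm : admissible eps b) (adm' : admissible eps b').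

Lemma eq_lab N (V : flag F m N) C (V' : flag F' m N) C' :
  sdflag b V -> chamber b C -> sdflag b' V' -> chamber b' C' ->
  lab d V C = lab d V' C' -> forall c, (c < m)%N -> jump V C c = jump V' C' c.
Proof.
by move=> sV chC sV' chC' e c cm; rewrite (jump_lext adm md sV chC cm)
  (jump_lext adm' md sV' chC' cm) e.
Qed.

Lemma eq_jump_rcap N (V : flag F m N) C (V' : flag F' m N) C' i c :
  sdflag b V -> chamber b C -> sdflag b' V' -> chamber b' C' ->
  (forall c, (c < m)%N -> jump V C c = jump V' C' c) -> (i <= N)%N -> (c <= m)%N ->
  rcap V C i c = rcap V' C' i c.
Proof.
move=> sV chC sV' chC' e iN cm.
rewrite (rcap_jump (sdflag_flag sV) chC iN cm) (rcap_jump (sdflag_flag sV') chC' iN cm).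
by apply: eq_bigr => k _; rewrite e // (leq_trans (ltn_ord k)).
Qed.

End Two.

(** The label read off a position matrix: the jump counts the steps at which passing from [C_c] to
    [C_(c+1)] does not enlarge the intersection with [V]. *)
Definition labm N N' (M : 'M['I_m.+1]_(N, N')) : seq nat :=
  mkseq (fun c => \sum_(i < N) (pos_rcap M i.+1 c.+1 == pos_rcap M i.+1 c))%N d.

Lemma labm_position (F : finFieldType) (b : 'M[F]_m) N (V : flag F m N) C :
  is_flag V -> chamber b C -> labm (position V C) = lab d V C.
Proof.
move=> fV chC; apply: (@eq_from_nth _ 0%N); rewrite ?size_mkseq // => c cd.
have cm : (c < m)%N by clear -cd md; lia.
have fC := chamber_flag chC.
rewrite !nth_mkseq //; apply: eq_bigr => i _.
rewrite !position_rcap // 1?ltnW // /rcap.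
have r : (\rank (subsp C c.+1) <= (\rank (subsp C c)).+1)%N.
  by rewrite !(chamber_rank chC) // ltnW.
rewrite (rank_cap_leq1 (subsp V i.+1) (subspS fC (leqnSn c) cm) r).
by case: (_ <= _)%MS => /=; rewrite ?addn0 ?eqxx // addn1 -[X in _ == X]addn0 -addn1 eqn_add2l.
Qed.

Lemma position_lab (F F' : finFieldType) (b : 'M[F]_m) (b' : 'M[F']_m) N
    (V : flag F m N) C (V' : flag F' m N) C' :
  admissible eps b -> admissible eps b' ->
  sdflag b V -> chamber b C -> sdflag b' V' -> chamber b' C' ->
  (position V C == position V' C') = (lab d V C == lab d V' C').
Proof.
move=> adm adm' sV chC sV' chC'; apply/eqP/eqP => e.
  rewrite -(labm_position (sdflag_flag sV) chC) -(labm_position (sdflag_flag sV') chC').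
  by rewrite e.
apply/eq_position; rewrite ?(sdflag_flag sV) ?(sdflag_flag sV') ?(chamber_flag chC) ?(chamber_flag chC') //.
move=> i c iN cm; apply: (eq_jump_rcap sV chC sV' chC') => //.
exact: (eq_lab adm adm').
Qed.

Lemma lab_valid (F : finFieldType) (b : 'M[F]_m) N (V : flag F m N) C :
  admissible eps b -> sdflag b V -> chamber b C -> lvalid eps d N (lab d V C).
Proof.
move=> adm sV chC; split; first exact: size_lab.
  move=> c cd; rewrite nth_lab //; apply: (jump_lt (sdflag_flag sV) chC).
  by clear -cd md; lia.
(* For a symmetric form [d] is the middle index, its own opposite, so its jump [x] satisfies
   [x = N.-1 - x]. *)
move=> ne; have dm : (d < m)%N by rewrite md ne; lia.
have := jump_dual adm sV chC dm; have := jump_lt (sdflag_flag sV) chC dm.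
have -> : (m.-1 - d = d)%N by rewrite md ne; clear; lia.
by move: (jump V C d) => x; clear; lia.
Qed.

Lemma same_orbitP (P P' : flag_kind) (F : finFieldType) (b : 'M[F]_m) x y x1 y1 :
  good_kind eps m P -> good_kind eps m P' -> admissible eps b ->
  x \in flags_of P b -> y \in flags_of P' b -> x1 \in flags_of P b -> y1 \in flags_of P' b ->
  same_orbit b (x1, y1) (x, y) = (position x y == position x1 y1).
Proof.
move=> gP gP' adm xP yP x1P y1P.
have [sx sy] := (flags_of_sdflag gP adm xP, flags_of_sdflag gP' adm yP).
have [sx1 sy1] := (flags_of_sdflag gP adm x1P, flags_of_sdflag gP' adm y1P).
have [fx fy] := (sdflag_flag sx, sdflag_flag sy).
have [fx1 fy1] := (sdflag_flag sx1, sdflag_flag sy1).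
apply/existsP/eqP => [[g /andP[/andP[ug _] /eqP[ex ey]]]|e].
  by apply/eq_position => // i k _ _; rewrite ex ey rcap_act.
have er : forall i k, (i <= steps P)%N -> (k <= steps P')%N -> rcap x1 y1 i k = rcap x y i k.
  by apply/eq_position.
have [C [chC ref srt]] := exists_sorted_chamber adm md sx sy.
have [C1 [chC1 ref1 srt1]] := exists_sorted_chamber adm md sx1 sy1.
have ej := sorted_determined md adm adm sx1 sy1 sx sy chC1 chC ref1 ref srt1 srt er.
have [g [ig gx gC]] := chamber_transitive adm sx1 sx chC1 chC ej.
have [rk _] := eq_dims sx1 sx (fun k => er _ k (leqnn _)).
exists g; rewrite ig /= -gx xpair_eqE eqxx /=; apply/eqP/esym.
(* [y] and [y1] are coarsenings of [C] and [C1] by the same dimensions, so the isometry from [C1] to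
   [C] carries one to the other. *)
have [l [<- <-]] : exists l, coarsen (steps P') C l = y /\ coarsen (steps P') C1 l = y1.
  exists (fun i => \rank (subsp y i)); split; first exact: (refines_coarsen fy chC ref).
  by apply: (refines_coarsen fy1 chC1 ref1) => i iN; rewrite rk.
by apply/ffunP=> i; rewrite !ffunE -gC /subsp !ffunE.
Qed.

(** The label is only given over some field. There the second flag is refined to a chamber, the
    resulting label is realised over the required field, and the chamber is coarsened again. *)
Lemma realize (P P' : flag_kind) (M : orbits eps m P P') :
  good_kind eps m P -> good_kind eps m P' ->
  forall (F : finFieldType) (b : 'M[F]_m), admissible eps b ->
  exists x y, has_position (val M) b x y.
Proof.
move=> gP gP' F b adm; have := valP M => /= /asboolP[F0 [b0 [x0 [y0 [adm0 [x0P y0P eM]]]]]].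
have [sx0 sy0] := (flags_of_sdflag gP adm0 x0P, flags_of_sdflag gP' adm0 y0P).
have [C0 chC0 ref0] := exists_chamber_refining adm0 md sy0.
have [x [C [sx chC el]]] := exists_lab adm md (lab_valid adm0 sx0 chC0).
have pr := profile_rank adm0 sy0.
have sy : sdflag b (coarsen (steps P') C (fun k => \rank (subsp y0 k))) by apply: coarsen_sdflag.
exists x, (coarsen (steps P') C (fun k => \rank (subsp y0 k))); split.
- apply: (flags_of_rank gP adm0 adm x0P sx) => i iN.
  by rewrite (rank_lab adm0 md sx0 chC0 iN) (rank_lab adm md sx chC iN) el.
- by apply: (flags_of_rank gP' adm0 adm y0P sy) => i iN; rewrite (rank_coarsen chC).
rewrite -eM; apply/eq_position; rewrite ?(sdflag_flag sx) ?(sdflag_flag sy)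
  ?(sdflag_flag sx0) ?(sdflag_flag sy0) // => i k iN kN.
rewrite rcap_coarsen // (rcap_refine _ _ (sdflag_flag sy0) chC0 ref0) //.
apply: (eq_jump_rcap sx chC sx0 chC0) => //; last exact: rank_leq_row.
exact: (eq_lab adm adm0).
Qed.

End Orbits.

(** * Structure constants *)

(* The coefficient of [e_r''] in [e_r T_jk ... T_j1], for [w = j1 ... jk]. *)
Fixpoint word_coef (d N : nat) (w r r'' : seq nat) : {poly int} :=
  if w is j :: w' then
    let x := nth 0%N r'' j in let y := lpartner d N j r'' in
    if x == y then 'X * word_coef d N w' r r''
    else if (x < y)%N then 'X * word_coef d N w' r (lrefl d N j r'')
    else word_coef d N w' r (lrefl d N j r'') + ('X - 1) * word_coef d N w' r r''
  else (r == r'')%:R.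

Fixpoint word_label (d m : nat) (w : seq nat) : seq nat :=
  if w is j :: w' then lrefl d m j (word_label d m w') else iota 0 d.

(** Reducedness is stated on labels: each letter, read from the end, exchanges an increasing pair,
    so multiplication by its generator yields a single basis element. *)
Fixpoint reduced (d m : nat) (w : seq nat) : bool :=
  if w is j :: w' then [&& reduced d m w', (j < d)%N &
    (nth 0%N (word_label d m w') j < lpartner d m j (word_label d m w'))%N] else true.

Section WordCount.
Variables (F : finFieldType) (eps : bool) (m d : nat) (b : 'M[F]_m).
Hypothesis adm : admissible eps b.
Hypothesis md : m = (d.*2 + ~~ eps)%N.
Local Notation chamber := (chamber b).
Local Notation sdflag := (sdflag b).
Local Notation panel := (panel d b).
Local Notation q := (#|F|%:R : int).

Lemma lsorted_iota dm : lsorted d m dm (iota 0 d).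
Proof.
apply/lsortedP => j jd _; rewrite /lpartner; case: ifP => jd'; rewrite !nth_iota //.
by clear -md jd; lia.
Qed.

Lemma jump_self C c : chamber C -> (c < m)%N -> jump C C c = c.
Proof.
move=> chC cm; have fC := chamber_flag chC.
have key i : (i <= m)%N -> (jump C C c < i)%N = (c < i)%N.
  move=> im; rewrite (ltn_jump C fC c im); case: (ltnP c i) => ci.
    apply/negP => /(submx_trans _) s.
    have /mxrankS : (subsp C c.+1 <= subsp C c)%MS.
      by apply: s; rewrite sub_capmx submx_refl andbT; apply: (subspS fC).
    by rewrite !(chamber_rank chC) ?ltnn // ltnW.
  by apply/negbTE; rewrite negbK (submx_trans (capmxSl _ _)) // (subspS fC) // ltnW.
have jm := jump_lt fC chC cm.
have := key _ jm; have := key _ cm; clear; lia.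
Qed.

Lemma chamber_sorted_eq C C' : chamber C -> chamber C' ->
  lsorted d m [::] (lab d C C') -> C = C'.
Proof.
move=> chC chC' srt; have sC := chamber_sdflag chC.
have /refinesP ref := sorted_refines adm md sC chC' srt.
apply: (subsp_inj (chamber_flag chC) (chamber_flag chC')) => i im.
by have := ref (chamber_flag chC') (chamber_flag chC) i im; rewrite (chamber_rank chC im).
Qed.

Lemma lab_self C : chamber C -> lab d C C = iota 0 d.
Proof.
move=> chC; apply: (@eq_from_nth _ 0%N); rewrite ?size_lab ?size_iota // => c cd.
by rewrite nth_lab // nth_iota // jump_self //; clear -cd md; lia.
Qed.

Lemma lab_iota C C' : chamber C -> chamber C' -> (lab d C C' == iota 0 d) = (C == C').
Proof.
move=> chC chC'; apply/eqP/eqP => [e|<-]; last exact: lab_self.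
by apply: chamber_sorted_eq => //; rewrite e lsorted_iota.
Qed.

(** Sorting the label down to the identity by reflections and reading these backwards gives the
    word; each exchanged a decreasing pair, so each letter is increasing. *)
Lemma exists_word C C' : chamber C -> chamber C' ->
  exists2 w, reduced d m w & word_label d m w = lab d C C'.
Proof.
move=> chC; have sC := chamber_sdflag chC.
have [k] := ubnP (lpotential d (lab d C C')); elim: k C' => // k IH C'.
rewrite ltnS => pk chC'; case: (boolP (lsorted d m [::] (lab d C C'))) => [srt|].
  by exists [::] => //=; rewrite -(chamber_sorted_eq chC chC' srt) lab_self.
case/allPn=> j; rewrite mem_iota add0n /= => jd; rewrite -ltnNge => xy.
have ne : nth 0%N (lab d C C') j != lpartner d m j (lab d C C') by rewrite eq_sym ltn_eqF.
have [C1 p1 e1] := exists_lrefl adm md sC chC' jd ne; have ch1 := panel_chamber p1.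
have jm := lab_lt adm md sC jd chC'.
have [w rw ew] : exists2 w, reduced d m w & word_label d m w = lab d C C1.
  by apply: IH => //; rewrite e1; apply: leq_trans pk; apply: lpotential_lrefl.
have [e2 e3] := lrefl_partner jd jm.
exists (j :: w) => /=; first by rewrite rw jd ew e1 e2 e3.
by rewrite ew e1 lrefl_invol // size_lab.
Qed.

Lemma word_label_valid w : reduced d m w ->
  size (word_label d m w) = d /\ forall c, (c < d)%N -> (nth 0%N (word_label d m w) c < m)%N.
Proof.
elim: w => [|j w IH] /=; first by rewrite size_iota => _; split=> // c cd;
  rewrite nth_iota //; clear -cd md; lia.
case/and3P=> /IH[sw wm] jd _; split=> [|c cd]; first exact: size_lrefl.
rewrite nth_mkseq //; case: ifP => _; last by case: ifP => _; apply: wm.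
by rewrite /lpartner; case: ifP => jd'; [apply: wm | have := wm j jd; clear; lia].
Qed.

(** This is the product of the basis element of [u] by [T_j] at [(C', C'')]. As [u] is the lower of
    its two labels, it occurs next to [C''] exactly once if [C''] carries the upper one, and not at
    all otherwise. *)
Lemma sum_adjacent_label C' C'' (u : seq nat) j : chamber C' -> chamber C'' -> (j < d)%N ->
  size u = d -> (nth 0%N u j < m)%N -> (nth 0%N u j < lpartner d m j u)%N ->
  \sum_(C1 in panel j C'' :\ C'') (lab d C' C1 == u)%:R =
    (lab d C' C'' == lrefl d m j u)%:R :> int.
Proof.
move=> ch' ch'' jd su um low; have s' := chamber_sdflag ch'.
rewrite (sum_panel adm md (fun r => (r == u)%:R : int) s' jd ch'') /=.
set r := lab d C' C''; have rm : (nth 0%N r j < m)%N by apply: (lab_lt adm md s' jd ch'').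
have sr : size r = d by exact: size_lab.
have [e1 e2] := lrefl_partner jd rm; have [f1 f2] := lrefl_partner jd um.
have ru : (lrefl d m j r == u) = (r == lrefl d m j u).
  by apply/eqP/eqP => [<-|->]; rewrite lrefl_invol.
case: eqVneq => [e|ne].
  have -> : (r == u) = false by apply/eqP => e'; move: low; rewrite -e' e ltnn.
  have -> : (r == lrefl d m j u) = false; last by rewrite mulr0.
  by apply/eqP => e'; move: low; rewrite -f1 -f2 -e' e ltnn.
case: ltnP => xy.
  rewrite ru; have -> : (r == lrefl d m j u) = false; last by rewrite mulr0.
  by apply/eqP => e'; move: low; rewrite -f1 -f2 -e' ltnNge ltnW.
have -> : (r == u) = false; last by rewrite mulr0 addr0 ru.
by apply/eqP => e'; move: low; rewrite -e' ltnNge xy.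
Qed.

(** Induction on the word: one letter is traded for a sum over the neighbours [C1] of [C''], and
    after exchanging the sums [sum_panel] for [x] reproduces the recursion of [word_coef]. *)
Lemma word_count N (x : flag F m N) R w C'' : sdflag x -> chamber C'' -> reduced d m w ->
  \sum_(C' | chamber C' && (lab d x C' == R)) (lab d C' C'' == word_label d m w)%:R =
  (word_coef d N w R (lab d x C'')).[q] :> int.
Proof.
move=> sx; elim: w C'' => [|j w IH] C'' ch'' /=.
  have -> : ((R == lab d x C'')%:R : {poly int}).[q] = (R == lab d x C'')%:R.
    by case: (_ == _); rewrite ?hornerC ?horner0.
  move=> _; rewrite (eq_bigr (fun C' => if C' == C'' then 1 else 0)) => [|C' /andP[ch' _]];
    last by rewrite lab_iota //; case: (_ == _).
  rewrite -big_mkcondr /=.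
  case: eqVneq => [e|ne].
    rewrite (eq_bigl (pred1 C'')) ?big_pred1_eq // => C' /=.
    by case: (eqVneq C' C'') => [->|]; rewrite ?andbF // ch'' e eqxx.
  rewrite big1 // => C' /andP[/andP[_ /eqP e] /eqP e'].
  by move: ne; rewrite -e e' eqxx.
case/and3P=> rw jd low; have [sw wm] := word_label_valid rw.
rewrite (eq_bigr (fun C' => \sum_(C1 in panel j C'' :\ C'')
    (lab d C' C1 == word_label d m w)%:R)) => [|C' /andP[ch' _]]; last first.
  by rewrite sum_adjacent_label // wm.
rewrite exchange_big /=.
rewrite (eq_bigr (fun C1 => (word_coef d N w R (lab d x C1)).[q])) => [|C1]; last first.
  by case/setD1P=> _ p1; apply: IH => //; apply: panel_chamber p1.
rewrite (sum_panel adm md (fun r => (word_coef d N w R r).[q]) sx jd ch'') /=.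
by case: ifP => _; [|case: ifP => _]; rewrite !(hornerE, hornerD).
Qed.

End WordCount.

Section Counting.
Variables (eps : bool) (m d : nat).
Hypothesis md : m = (d.*2 + ~~ eps)%N.
Local Notation labm := (labm d).

Lemma position_tr (F : finFieldType) (N N' : nat) (x : flag F m N) (y : flag F m N') :
  is_flag x -> is_flag y -> position y x = (position x y)^T.
Proof.
move=> fx fy; apply/matrixP=> i j; rewrite !mxE; congr inord.
have := step_dimE fx fy (ltn_ord j) (ltn_ord i).
have := step_dimE fy fx (ltn_ord i) (ltn_ord j).
by rewrite !(rcapC y x); lia.
Qed.

Lemma position_labm (F : finFieldType) (b : 'M[F]_m) N (x : flag F m N) C
    (R : 'M['I_m.+1]_(N, m)) : admissible eps b ->
  (exists (F0 : finFieldType) (b0 : 'M[F0]_m) (x0 : flag F0 m N) C0,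
     [/\ admissible eps b0, sdflag b0 x0, chamber b0 C0 & position x0 C0 = R]) ->
  sdflag b x -> chamber b C -> (position x C == R) = (lab d x C == labm R).
Proof.
move=> adm [F0 [b0 [x0 [C0 [adm0 sx0 ch0 <-]]]]] sx chC.
by rewrite (position_lab md adm adm0) // (labm_position md (sdflag_flag sx0) ch0).
Qed.

(** If one of the matrices is not a position of flags the polynomial is 0; otherwise it is
    [word_coef] for a reduced word of [W]. *)
Lemma count_pairs N (r'' : seq nat) (R : 'M['I_m.+1]_(N, m)) (W : 'M['I_m.+1]_(m, m)) :
  exists p : {poly int}, forall (F : finFieldType) (b : 'M[F]_m) (x : flag F m N) C'',
    admissible eps b -> sdflag b x -> chamber b C'' -> lab d x C'' = r'' ->
    p.[#|F|%:R] = #|[set C | [&& chamber b C, position x C == R & position C C'' == W]]|%:R.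
Proof.
case: (pselect (exists (F0 : finFieldType) (b0 : 'M[F0]_m) (x0 : flag F0 m N) C0,
     [/\ admissible eps b0, sdflag b0 x0, chamber b0 C0 & position x0 C0 = R])) => [hR|nR];
  last first.
  exists 0 => F b x C'' adm sx ch'' _; rewrite horner0 (_ : [set _ | _] = set0) ?cards0 //.
  apply/setP=> C; rewrite !inE; apply/and3P=> -[chC /eqP eR _]; case: nR.
  by exists F, b, x, C.
case: (pselect (exists (F0 : finFieldType) (b0 : 'M[F0]_m) (x0 : flag F0 m m) C0,
     [/\ admissible eps b0, chamber b0 x0, chamber b0 C0 & position x0 C0 = W])) => [|nW];
  last first.
  exists 0 => F b x C'' adm sx ch'' _; rewrite horner0 (_ : [set _ | _] = set0) ?cards0 //.
  apply/setP=> C; rewrite !inE; apply/and3P=> -[chC _ /eqP eW]; case: nW.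
  by exists F, b, C, C''.
case=> F0 [b0 [x0 [C0 [adm0 ch0 chC0 eW]]]].
have [w rw ew] := exists_word adm0 md ch0 chC0.
exists (word_coef d N w (labm R) r'') => F b x C'' adm sx ch'' <-.
rewrite -(word_count adm md _ sx ch'' rw) -sum1_card natr_sum [RHS]big_mkcond.
rewrite [LHS]big_mkcond /=; apply: eq_bigr => C _; rewrite inE.
case: (boolP (chamber b C)) => //= chC; rewrite (position_labm adm hR) //.
rewrite -eW (position_lab md adm adm0) ?(chamber_sdflag chC) ?(chamber_sdflag ch0) // ew.
by case: (_ == labm R) => //=; case: (_ == _).
Qed.

Lemma card_partition2 (T : finType) (A B : finType) (f : T -> A) (g : T -> B)
    (S : {set T}) (c : A -> B -> bool) (h : pred T) :
  (forall D, (D \in S) = h D && c (f D) (g D)) ->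
  #|S| = (\sum_a \sum_b if c a b then #|[set D | [&& h D, f D == a & g D == b]]| else 0)%N.
Proof.
move=> eS; rewrite -sum1_card (partition_big f xpredT) //=; apply: eq_bigr => a _.
rewrite (partition_big g xpredT) //=; apply: eq_bigr => e _.
case: ifP => cab.
  rewrite -sum1_card; apply: eq_bigl => D; rewrite inE eS.
  case: (eqVneq (f D) a) => [->|]; last by rewrite !andbF.
  case: (eqVneq (g D) e) => [->|]; last by rewrite !andbF.
  by rewrite cab !andbT.
rewrite big1 // => D /andP[/andP[+ /eqP fa] /eqP ge].
by rewrite eS fa ge cab andbF.
Qed.

Lemma dims_rank (F : finFieldType) N (V : flag F m N) l :
  (forall k, (k <= N)%N -> \rank (subsp V k) = l k) -> dims V = [seq l k | k <- iota 0 N.+1].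
Proof. by move=> e; apply/eq_in_map => k; rewrite mem_iota => /andP[_]; apply: e. Qed.

(** [z] is replaced by a chamber [C] refining it and sorted relative to [x], and [y] by its
    refinement [D] sorted relative to [C]. Counting [y] becomes counting [D] with prescribed
    positions to [x] and [C], summed over the finitely many suitable pairs of positions. *)
Lemma triple_count (P P' P'' : flag_kind) (M : orbits eps m P P') (M' : orbits eps m P' P'')
    (M'' : orbits eps m P P'') :
  good_kind eps m P -> good_kind eps m P' -> good_kind eps m P'' ->
  exists p : {poly int}, forall (F : finFieldType) (b : 'M[F]_m) x z, admissible eps b ->
    has_position (val M'') b x z ->
    p.[#|F|%:R] = #|[set y in flags_of P' b | (position x y == val M) &&
                        (position y z == val M')]|%:R.
Proof.
move=> gP gP' gP''.
have := valP M => /= /asboolP[Fm [bm [xm [ym [admm [xmP ymP eM]]]]]].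
have := valP M' => /= /asboolP[Fn [bn [yn [zn [admn [ynP znP eM']]]]]].
have := valP M'' => /= /asboolP[F0 [b0 [x0 [z0 [adm0 [x0P z0P eM'']]]]]].
have [sxm sym] := (flags_of_sdflag gP admm xmP, flags_of_sdflag gP' admm ymP).
have [syn szn] := (flags_of_sdflag gP' admn ynP, flags_of_sdflag gP'' admn znP).
have [sx0 sz0] := (flags_of_sdflag gP adm0 x0P, flags_of_sdflag gP'' adm0 z0P).
have [C0 [ch0 ref0 srt0]] := exists_sorted_chamber adm0 md sx0 sz0.
pose l k := \rank (subsp ym k); pose mu k := \rank (subsp z0 k).
have pl : profile m (steps P') l by exact: (profile_rank admm sym).
pose dms := [seq l k | k <- iota 0 (steps P').+1].
(* The polynomials are fixed before the field: over every field the label of [(x, C)] will be that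
   of [(x0, C0)]. *)
have /choice[pp ppE] : forall RW : 'M['I_m.+1]_(steps P, m) * 'M['I_m.+1]_(m, m),
    exists p : {poly int}, forall (F : finFieldType) (b : 'M[F]_m) (x : flag F m (steps P)) C'',
    admissible eps b -> sdflag b x -> chamber b C'' -> lab d x C'' = lab d x0 C0 ->
    p.[#|F|%:R] = #|[set C | [&& chamber b C, position x C == RW.1
                               & position C C'' == RW.2]]|%:R.
  by move=> [R W]; apply: count_pairs.
(* The conditions on [D]: sorted within the blocks of its coarsening, and in the right positions
   after coarsening. [W] is the position of [(D, C)], so its transpose carries the label of
   [(C, D)]. *)
pose good (R : 'M['I_m.+1]_(steps P, m)) (W : 'M['I_m.+1]_(m, m)) :=
  [&& lsorted d m dms (labm W^T),
      [forall i : 'I_(steps P).+1, forall k : 'I_(steps P').+1,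
         pos_rcap R i (l k) == rcap xm ym i k]
    & [forall k : 'I_(steps P').+1, forall j : 'I_(steps P'').+1,
         pos_rcap W (l k) (mu j) == rcap yn zn k j]].
exists (\sum_R \sum_W if good R W then pp (R, W) else 0) => F b x z adm [xP zP exz].
have [sx sz] := (flags_of_sdflag gP adm xP, flags_of_sdflag gP'' adm zP).
have [fx fz] := (sdflag_flag sx, sdflag_flag sz).
have erz i k : (i <= steps P)%N -> (k <= steps P'')%N -> rcap x z i k = rcap x0 z0 i k.
  move: i k; apply/eq_position; rewrite ?fx ?fz ?(sdflag_flag sx0) ?(sdflag_flag sz0) //.
  by rewrite exz eM''.
have [rz dz] := eq_dims sx sx0 (fun k => erz _ k (leqnn _)).
have [C [chC ref srt]] := exists_sorted_chamber adm md sx sz.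
have sC := chamber_sdflag chC; have fC := chamber_flag chC.
have elab : lab d x C = lab d x0 C0.
  apply: (@eq_from_nth _ 0%N); rewrite ?size_lab // => c cd; rewrite !nth_lab //.
  apply: (sorted_determined md adm adm0 sx sz sx0 sz0 chC ch0 ref ref0 srt srt0 erz).
  by clear -cd md; lia.
pose S := [set D | chamber b D && good (position x D) (position D C)].
transitivity (#|S|%:R : int).
  rewrite (@card_partition2 _ _ _ (fun D => position x D) (fun D => position D C) S good (chamber b));
    last by move=> D; rewrite inE.
  rewrite horner_sum natr_sum; apply: eq_bigr => R _.
  rewrite horner_sum natr_sum; apply: eq_bigr => W _.
  by case: ifP => _; rewrite ?horner0 // (ppE (R, W) F b x C adm sx chC elab).
congr (_%:R).
have goodP D : reflect [/\ chamber b D, lsorted d m dms (lab d C D),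
    forall i k, (i <= steps P)%N -> (k <= steps P')%N -> rcap x D i (l k) = rcap xm ym i k
    & forall k j, (k <= steps P')%N -> (j <= steps P'')%N ->
        rcap D C (l k) (mu j) = rcap yn zn k j] (D \in S).
  rewrite inE; apply: (iffP andP) => [[chD /and3P[g1 /forallP g2 /forallP g3]]|[chD g1 g2 g3]].
    have fD := chamber_flag chD; split=> //.
    - by move: g1; rewrite -(position_tr fD fC) (labm_position md fC chD).
    - move=> i k iN kN; have /forallP /(_ (inord k)) /eqP := g2 (inord i).
      by rewrite !inordK // position_rcap // (profile_le pl).
    - move=> k j kN jN; have /forallP /(_ (inord j)) /eqP := g3 (inord k).
      by rewrite !inordK // position_rcap ?(profile_le pl) ?rank_leq_row.
  have fD := chamber_flag chD; split=> //; apply/and3P; split.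
  - by rewrite -(position_tr fD fC) (labm_position md fC chD).
  - apply/forallP=> i; apply/forallP=> k; apply/eqP.
    by rewrite position_rcap ?leq_ord ?(profile_le pl) ?leq_ord // g2 ?leq_ord.
  - apply/forallP=> k; apply/forallP=> j; apply/eqP.
    by rewrite position_rcap ?(profile_le pl) ?rank_leq_row ?leq_ord // g3 ?leq_ord.
have rco D (chD : chamber b D) k := rank_coarsen (i := k) chD pl.
have dco D : chamber b D -> dims (coarsen (steps P') D l) = dms.
  by move=> chD; apply: dims_rank => k kN; apply: rco.
(* Each [y] is counted once, as it has only one refinement sorted relative to [C]. *)
have inj : {in S &, injective (fun D => coarsen (steps P') D l)}.
  move=> D D' /goodP[chD srtD _ _] /goodP[chD' srtD' _ _] e.
  have sV := coarsen_sdflag chD pl; have refD := coarsen_refines chD pl.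
  have refD' := coarsen_refines chD' pl; rewrite -e in refD'.
  rewrite -(dco D chD) in srtD srtD'.
  apply: (sorted_unique adm md sV chC chD chD' refD refD' srtD).
  exact: (sorted_determined md adm adm sC sV sC sV chD chD' refD refD' srtD srtD').
rewrite -(card_in_imset inj); apply: eq_card => y; rewrite [RHS]inE.
have zC D k j : chamber b D -> (k <= steps P')%N -> (j <= steps P'')%N ->
    rcap (coarsen (steps P') D l) z k j = rcap D C (l k) (mu j).
  move=> chD kN jN; rewrite (rcap_refine _ _ fz chC ref jN) rz //.
  by rewrite rcapC rcap_coarsen // rcapC.
apply/imsetP/and3P => [[D /goodP[chD srtD g2 g3] ->]|[yP /eqP exy /eqP eyz]].
  have sV := coarsen_sdflag chD pl; have fV := sdflag_flag sV; split.
  - by apply: (flags_of_rank gP' admm adm ymP sV) => k kN; rewrite rco.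
  - rewrite -eM; apply/eqP/eq_position; rewrite ?fx ?fV ?(sdflag_flag sxm) ?(sdflag_flag sym) //.
    by move=> i k iN kN; rewrite rcap_coarsen // g2.
  - rewrite -eM'; apply/eqP/eq_position; rewrite ?fz ?fV ?(sdflag_flag syn) ?(sdflag_flag szn) //.
    by move=> k j kN jN; rewrite zC // g3.
have sy := flags_of_sdflag gP' adm yP; have fy := sdflag_flag sy.
have e1 i k : (i <= steps P)%N -> (k <= steps P')%N -> rcap x y i k = rcap xm ym i k.
  move: i k; apply/eq_position; rewrite ?fx ?fy ?(sdflag_flag sxm) ?(sdflag_flag sym) //.
  by rewrite exy eM.
have e2 k j : (k <= steps P')%N -> (j <= steps P'')%N -> rcap y z k j = rcap yn zn k j.
  move: k j; apply/eq_position; rewrite ?fz ?fy ?(sdflag_flag syn) ?(sdflag_flag szn) //.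
  by rewrite eyz eM'.
have [ry dy] := eq_dims sx sxm (fun k => e1 _ k (leqnn _)).
have [D [chD refD srtD]] := exists_sorted_chamber adm md sC sy.
have ey : coarsen (steps P') D l = y by apply: (refines_coarsen fy chD refD).
exists D => //; apply/goodP; split=> //.
- by have -> : dms = dims y by rewrite (dims_rank ry).
- by move=> i k iN kN; rewrite -e1 // -ey rcap_coarsen.
- by move=> k j kN jN; rewrite -e2 // -ey zC.
Qed.

Lemma structure_constant_exists (P P' P'' : flag_kind) (M : orbits eps m P P')
    (M' : orbits eps m P' P'') (M'' : orbits eps m P P'') :
  good_kind eps m P -> good_kind eps m P' -> good_kind eps m P'' ->
  exists p, is_structure_constant M M' M'' p.
Proof.
move=> gP gP' gP''; have [p pE] := triple_count M M' M'' gP gP' gP''.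
exists p => F b x1 y1 y2 z2 x z adm [x1P y1P e1] [y2P z2P e2] h.
rewrite (pE F b x z adm h); case: h => xP zP e.
congr (_%:R); apply: eq_card => y; rewrite !inE -!/(_ \in _).
case: (boolP (y \in flags_of P' b)) => [yP|]; last by rewrite inE => /negbTE ->.
rewrite (same_orbitP md gP gP' adm) // (same_orbitP md gP' gP'' adm) //.
by rewrite e1 e2.
Qed.

End Counting.

(** * The convolution product *)

Lemma odd_primes k : exists s : seq nat,
  [/\ uniq s, size s = k & forall p, p \in s -> prime p && odd p].
Proof.
elim: k => [|k [s [us sk sp]]]; first by exists [::].
have [p pl pp] := prime_above (\max_(i <- s) i + 2).
exists (p :: s); split=> /=; rewrite ?sk // ?us ?andbT.
  apply: contraL pl => ps; rewrite -leqNgt; apply: leq_trans (leq_addr _ _).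
  by rewrite (big_rem p ps) /= leq_maxl.
move=> x; rewrite inE => /orP[/eqP ->|/sp //]; rewrite pp /=.
by case: (even_prime pp) => // e; move: pl; rewrite e ltnNge leq_addl.
Qed.

Lemma poly_eq_odd_primes (p q : {poly int}) :
  (forall n, prime n -> odd n -> p.[n%:R] = q.[n%:R]) -> p = q.
Proof.
move=> e; apply/eqP; rewrite -subr_eq0; apply: contraT => nz.
have [s [us ss sp]] := odd_primes (size (p - q)).
have ur : uniq [seq (n%:R : int) | n <- s].
  by rewrite map_inj_uniq // => x y /eqP; rewrite Num.Theory.eqr_nat => /eqP.
have ar : all (root (p - q)) [seq (n%:R : int) | n <- s].
  apply/allP=> _ /mapP[n ns ->]; have /andP[pn on] := sp n ns.
  by rewrite /root hornerD hornerN (e n pn on) subrr.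
by have := max_poly_roots nz ar ur; rewrite size_map ss ltnn.
Qed.

(** * Identities in q tested over prime fields *)

Section Forms.
Variables (eps : bool) (m d : nat).
Hypothesis md : m = (d.*2 + ~~ eps)%N.

(** The antidiagonal matrix, with signs for the skew case, squares to plus or minus the identity. A
    skew form has [m] even, so no antidiagonal entry is also diagonal. *)
Lemma exists_form (F : finFieldType) : odd #|F| -> exists b : 'M[F]_m, admissible eps b.
Proof.
move=> oF; pose e (i j : 'I_m) : F := if eps && (j < i)%N then -1 else 1.
pose b : 'M[F]_m := \matrix_(i, j) ((j == rev_ord i)%:R * e i j).
have bt : b^T = (-1) ^+ eps *: b.
  apply/matrixP=> i j; rewrite !mxE.
  have -> : (i == rev_ord j) = (j == rev_ord i) by apply/eqP/eqP => ->; rewrite rev_ordK.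
  case: eqVneq => [ej|_]; last by rewrite !mul0r mulr0.
  rewrite !mul1r /e; case: (boolP eps) => ee /=; last by rewrite expr0 mul1r.
  have nij : (i : nat) != j.
    apply/eqP => eij; have := congr1 val ej; rewrite /= -eij; have := ltn_ord i.
    by clear -md ee; case: eps md ee => //=; lia.
  rewrite expr1; case: ltngtP nij => //= _ _; by rewrite ?mulN1r ?opprK ?mulr1.
have bb : b *m b = (-1) ^+ eps *: 1%:M.
  apply/matrixP=> i k; rewrite !mxE (bigD1 (rev_ord i)) //= big1 ?addr0; last first.
    by move=> j nj; rewrite !mxE (negPf nj) !mul0r.
  rewrite !mxE eqxx rev_ordK mul1r eq_sym; case: (eqVneq i k) => [<-|_]; last first.
    by rewrite mul0r !mulr0.
  rewrite mul1r mulr1 /e; case: (boolP eps) => ee /=; last by rewrite expr0 mulr1.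
  have nij : (i : nat) != (m - i.+1)%N.
    by apply/eqP; have := ltn_ord i; clear -md ee; case: eps md ee => //=; lia.
  by rewrite expr1; case: ltngtP nij => //= _ _; rewrite ?mulr1 ?mul1r.
exists b; split=> //.
  by apply/sesquiP; rewrite map_mx_id // bt scalerA -expr2 sqrr_sign scale1r.
suff /mulmx1_unit[] : b *m ((-1) ^+ eps *: b) = 1%:M by [].
by rewrite -scalemxAr bb scalerA -expr2 sqrr_sign scale1r.
Qed.

(** Identities between structure constants thereby reduce to identities between numbers of flags
    over finite fields. *)
Lemma poly_eq_forms (p q : {poly int}) :
  (forall (F : finFieldType) (b : 'M[F]_m), admissible eps b ->
     p.[#|F|%:R] = q.[#|F|%:R]) -> p = q.
Proof.
move=> e; apply: poly_eq_odd_primes => n pn on.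
have cF : #|'F_n| = n by exact: card_Fp.
have [|b adm] := @exists_form 'F_n; first by rewrite cF.
by have := e _ b adm; rewrite cF.
Qed.

End Forms.

Section EvalV2.

Lemma eval_v2_is_zmod_morphism : zmod_morphism eval_v2.
Proof. by move=> p q; rewrite /eval_v2 rmorphB hornerD hornerN. Qed.
Lemma eval_v2_is_monoid_morphism : monoid_morphism eval_v2.
Proof. by split=> [|p q]; rewrite /eval_v2 ?rmorph1 ?hornerC // rmorphM hornerM. Qed.
HB.instance Definition _ := GRing.isZmodMorphism.Build {poly int} laurent eval_v2
  eval_v2_is_zmod_morphism.
HB.instance Definition _ := GRing.isMonoidMorphism.Build {poly int} laurent eval_v2
  eval_v2_is_monoid_morphism.

Lemma eval_v2X : eval_v2 'X = v ^+ 2.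
Proof. by rewrite /eval_v2 map_polyX hornerX. Qed.

Lemma mulIv2 (x : laurent) : v ^+ 2 * x = 0 -> x = 0.
Proof.
move=> /(congr1 val); rewrite rmorphM rmorphXn /= => /eqP.
rewrite mulf_eq0 expf_eq0 /= tofrac_eq0 polyX_eq0 /= => /eqP e.
by apply: val_inj; rewrite /= e.
Qed.

End EvalV2.

Section Algebra.
Variables (eps : bool) (m d : nat).
Hypothesis md : m = (d.*2 + ~~ eps)%N.
Local Notation orbits := (orbits eps m).
Local Notation orbit_module := (orbit_module eps m).
Local Notation good := (good_kind eps m).

(** The existence of the polynomial gives access to the one chosen by [epsilon]; its orbit
    representatives come from [realize], and orbits are then recognised by positions. *)
Lemma structure_constantE (P P' P'' : flag_kind) (M : orbits P P') (M' : orbits P' P'')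
    (M'' : orbits P P'') : good P -> good P' -> good P'' ->
  forall (F : finFieldType) (b : 'M[F]_m) x z, admissible eps b ->
    has_position (val M'') b x z ->
    (structure_constant M M' M'').[#|F|%:R] =
      #|[set y in flags_of P' b | (position x y == val M) &&
                        (position y z == val M')]|%:R.
Proof.
move=> gP gP' gP'' F b x z adm h.
have sc := epsilon_spec (inhabits 0) _ (structure_constant_exists md M M' M'' gP gP' gP'').
have [x1 [y1 h1]] := realize md M gP gP' adm.
have [y2 [z2 h2]] := realize md M' gP' gP'' adm.
rewrite /structure_constant (sc F b x1 y1 y2 z2 x z adm h1 h2 h).
case: h h1 h2 => xP zP e [x1P y1P e1] [y2P z2P e2].
congr (_%:R); apply: eq_card => y; rewrite !inE -!/(_ \in _).
case: (boolP (y \in flags_of P' b)) => [yP|]; last by rewrite inE => /negbTE ->.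
rewrite (same_orbitP md gP gP' adm) // (same_orbitP md gP' gP'' adm) //.
by rewrite e1 e2.
Qed.

Lemma orbit_of (P P' : flag_kind) (F : finFieldType) (b : 'M[F]_m) x y :
  admissible eps b -> x \in flags_of P b -> y \in flags_of P' b ->
  exists M : orbits P P', position x y = val M.
Proof.
move=> adm xP yP.
have h : `[< exists (F : finFieldType) (b : 'M[F]_m)
         (x0 : flag F m (steps P)) (y0 : flag F m (steps P')),
         admissible eps b /\ has_position (position x y) b x0 y0 >].
  by apply/asboolP; exists F, b, x, y.
by exists (@exist _ (fun M => is_true `[< exists (F0 : finFieldType) (b0 : 'M[F0]_m)
         (x0 : flag F0 m (steps P)) (y0 : flag F0 m (steps P')),
         admissible eps b0 /\ has_position M b0 x0 y0 >]) _ h).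
Qed.

Lemma sum_orbits (P P' : flag_kind) (F : finFieldType) (b : 'M[F]_m) x y (c : orbits P P' -> int) z :
  admissible eps b -> x \in flags_of P b -> y \in flags_of P' b ->
  (forall M, position x y = val M -> c M = z) ->
  \sum_M (position x y == val M)%:R * c M = z.
Proof.
move=> adm xP yP cz; have [M eM] := orbit_of adm xP yP.
rewrite (bigD1 M) //= eM eqxx mul1r big1 ?addr0; first exact: cz.
move=> M' nM; rewrite (inj_eq val_inj) eq_sym (negPf nM) mul0r //.
Qed.

Lemma card_setE (T : finType) (A : {set T}) (f : pred T) :
  #|[set y in A | f y]|%:R = \sum_(y in A) (f y)%:R :> int.
Proof.
rewrite -sum1_card natr_sum big_mkcond [RHS]big_mkcond /=; apply: eq_bigr => y _.
by rewrite inE; case: (y \in A) => //=; case: (f y).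
Qed.

(** Evaluated at q, both sides count the pairs [(y, z)] with prescribed positions of [(x, y)],
    [(y, z)] and [(z, w)]. *)
Lemma structure_constant_assoc (P1 P2 P3 P4 : flag_kind) (M : orbits P1 P2) (M' : orbits P2 P3)
    (N : orbits P3 P4) (L : orbits P1 P4) : good P1 -> good P2 -> good P3 -> good P4 ->
  \sum_K structure_constant M M' K * structure_constant K N L =
  \sum_K structure_constant M' N K * structure_constant M K L.
Proof.
move=> g1 g2 g3 g4; apply: (poly_eq_forms md) => F b adm.
have [x [w hL]] := realize md L g1 g4 adm; have [xP wP eL] := hL.
rewrite !horner_sum.
transitivity (\sum_(z in flags_of P3 b) \sum_(y in flags_of P2 b)
   [&& position x y == val M, position y z == val M' & position z w == val N]%:R : int).
  rewrite (eq_bigr (fun K => \sum_(z in flags_of P3 b)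
     (position x z == val K)%:R * ((structure_constant M M' K).[#|F|%:R] *
        (position z w == val N)%:R))).
    rewrite exchange_big /=; apply: eq_bigr => z zP; apply: (sum_orbits adm) => // K eK.
    rewrite (structure_constantE _ _ g1 g2 g3 adm (And3 xP zP eK)).
    rewrite card_setE mulr_suml; apply: eq_bigr => y _.
    by rewrite -natrM mulnb andbA.
  move=> K _; rewrite hornerM (structure_constantE K N g1 g3 g4 adm hL) card_setE mulr_sumr.
  by apply: eq_bigr => z _; rewrite mulrCA -natrM mulnb.
rewrite exchange_big /=; apply/esym.
rewrite (eq_bigr (fun K => \sum_(y in flags_of P2 b)
     (position y w == val K)%:R * ((structure_constant M' N K).[#|F|%:R] *
        (position x y == val M)%:R))).
  rewrite exchange_big /=; apply: eq_bigr => y yP; apply: (sum_orbits adm) => // K eK.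
  rewrite (structure_constantE _ _ g2 g3 g4 adm (And3 yP wP eK)).
  rewrite card_setE mulr_suml; apply: eq_bigr => z _.
  by rewrite -natrM mulnb andbC.
move=> K _; rewrite hornerM (structure_constantE M K g1 g2 g4 adm hL) card_setE mulr_sumr.
by apply: eq_bigr => y _; rewrite mulrCA -natrM mulnb andbC.
Qed.

Lemma coef_conv (P P' P'' : flag_kind) (f : orbit_module P P') (g : orbit_module P' P'') L :
  coef (conv f g) L = \sum_M \sum_M' coef f M * coef g M' * eval_v2 (structure_constant M M' L).
Proof. by rewrite /coef ffunE. Qed.

Lemma coef_inj (P P' : flag_kind) (f g : orbit_module P P') :
  (forall M, coef f M = coef g M) -> f = g.
Proof. by move=> e; apply/ffunP=> M; apply: e. Qed.

Lemma conv_assoc (P1 P2 P3 P4 : flag_kind) (f : orbit_module P1 P2) (g : orbit_module P2 P3)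
    (h : orbit_module P3 P4) : good P1 -> good P2 -> good P3 -> good P4 ->
  conv (conv f g) h = conv f (conv g h).
Proof.
move=> g1 g2 g3 g4; apply: coef_inj => L; rewrite !coef_conv.
transitivity (\sum_M \sum_M' \sum_N coef f M * coef g M' * coef h N *
   eval_v2 (\sum_K structure_constant M M' K * structure_constant K N L)).
  rewrite (eq_bigr (fun K => \sum_N \sum_M \sum_M' coef f M * coef g M' * coef h N *
     eval_v2 (structure_constant M M' K * structure_constant K N L))); last first.
    move=> K _; apply: eq_bigr => N _; rewrite coef_conv !mulr_suml; apply: eq_bigr => M _.
    rewrite !mulr_suml; apply: eq_bigr => M' _; rewrite rmorphM; ring.
  rewrite exchange_big /=.
  under eq_bigr do (rewrite exchange_big /=; under eq_bigr do rewrite exchange_big /=).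
  rewrite exchange_big /=; apply: eq_bigr => M _; rewrite exchange_big /=.
  apply: eq_bigr => M' _; apply: eq_bigr => N _; rewrite rmorph_sum mulr_sumr //.
apply: eq_bigr => M _.
rewrite (eq_bigr (fun M' => \sum_N \sum_K coef f M * coef g M' * coef h N *
   eval_v2 (structure_constant M' N K * structure_constant M K L))); last first.
  move=> M' _; apply: eq_bigr => N _.
  by rewrite (structure_constant_assoc M M' N L g1 g2 g3 g4) rmorph_sum mulr_sumr.
under eq_bigr do rewrite exchange_big /=.
rewrite exchange_big /=; apply: eq_bigr => K _; rewrite coef_conv mulr_sumr mulr_suml.
apply: eq_bigr => M' _; rewrite mulr_sumr mulr_suml; apply: eq_bigr => N _.
by rewrite rmorphM; ring.
Qed.

(** [char_fun] quantifies over all fields and all pairs with the given label; a realisation over the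
    field with 3 elements excludes a vacuously true value. *)
Lemma coef_char_fun (P P' : flag_kind)
    (Q : forall F : finFieldType, flag F m (steps P) -> flag F m (steps P') -> bool) (M : orbits P P') (c : bool) : good P -> good P' ->
  (forall (F : finFieldType) (b : 'M[F]_m) x y, admissible eps b ->
     has_position (val M) b x y -> Q F x y = c) ->
  coef (@char_fun eps m P P' Q) M = c%:R.
Proof.
move=> gP gP' eQ; rewrite /coef ffunE; congr (nat_of_bool _)%:R.
apply/asboolP/idP => [h|cT F b x y adm hM]; last by rewrite (eQ F b x y adm hM).
have o3 : odd #|'F_3| by rewrite card_Fp.
have [b adm] := exists_form md o3.
have [x [y hM]] := realize md M gP gP' adm.
by rewrite -(eQ _ b x y adm hM) (h _ b x y adm hM).
Qed.

(** Equality of the two flags in terms of ranks: as step [N] is the whole space, the three ranks are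
    those of the intersection and of the two members. *)
Definition diagonal N (M : 'M['I_m.+1]_(N, N)) : bool :=
  [forall i : 'I_N.+1, (pos_rcap M i i == pos_rcap M i N) && (pos_rcap M i i == pos_rcap M N i)].

Lemma diagonal_position (F : finFieldType) N (x y : flag F m N) : is_flag x -> is_flag y ->
  diagonal (position x y) = (x == y).
Proof.
move=> fx fy; apply/forallP/eqP => [h|-> i]; last first.
  rewrite !position_rcap ?leq_ord //; apply/andP; split.
    by rewrite /rcap (subsp_last fy) (capmx_idPl (submx1 _)) (capmx_idPl (submx_refl _)).
  by rewrite /rcap (subsp_last fy) cap1mx (capmx_idPl (submx_refl _)).
apply: (subsp_inj fx fy) => i iN; have := h (inord i); rewrite inordK //.
rewrite !position_rcap // => /andP[/eqP e1 /eqP e2].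
rewrite /rcap (subsp_last fx) cap1mx in e2; rewrite /rcap (subsp_last fy) (capmx_idPl (submx1 _)) in e1.
apply: (@eqmx_trans _ _ _ _ _ _ (subsp x i :&: subsp y i)%MS).
  by apply/eqmx_sym/eqmx_rank_sub; rewrite ?capmxSl // e1.
by apply/eqmx_rank_sub; rewrite ?capmxSr // e2.
Qed.

Lemma coef_conv1 (P : flag_kind) (M : orbits P P) : good P ->
  coef (conv1 eps m P) M = (diagonal (val M))%:R.
Proof.
move=> gP; apply: coef_char_fun => // F b x y adm [xP yP <-].
by rewrite diagonal_position ?(sdflag_flag (flags_of_sdflag gP adm xP))
  ?(sdflag_flag (flags_of_sdflag gP adm yP)).
Qed.

Lemma sum_delta_coef (P P' : flag_kind) (t : orbit_module P P') L :
  \sum_M coef t M * eval_v2 (M == L)%:R = coef t L.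
Proof.
rewrite (bigD1 L) //= eqxx rmorph1 mulr1 big1 ?addr0 // => M nM.
by rewrite (negPf nM) rmorph0 mulr0.
Qed.

Lemma eval_v2_bool (c : bool) : eval_v2 c%:R = c%:R.
Proof. by case: c; rewrite ?rmorph1 ?rmorph0. Qed.

Lemma conv1_conv (P P' : flag_kind) (t : orbit_module P P') : good P -> good P' ->
  conv (conv1 eps m P) t = t.
Proof.
move=> gP gP'; apply: coef_inj => L; rewrite coef_conv exchange_big /= -[RHS]sum_delta_coef.
apply: eq_bigr => M' _.
transitivity (coef t M' * eval_v2 (\sum_M (diagonal (val M))%:R * structure_constant M M' L)).
  rewrite rmorph_sum mulr_sumr; apply: eq_bigr => M _.
  by rewrite coef_conv1 // rmorphM /= eval_v2_bool; ring.
congr (_ * eval_v2 _); apply: (poly_eq_forms md) => F b adm.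
have [x [w hL]] := realize md L gP gP' adm; have [xP wP eL] := hL.
have fx := sdflag_flag (flags_of_sdflag gP adm xP).
rewrite horner_sum.
rewrite (eq_bigr (fun M => \sum_(y in flags_of P b) (position x y == val M)%:R *
   ((diagonal (val M))%:R * (position y w == val M')%:R))); last first.
  move=> M _; rewrite hornerM (structure_constantE M M' gP gP gP' adm hL) card_setE mulr_sumr.
  apply: eq_bigr => y _; rewrite -mulnb natrM mulrCA; congr (_ * (_ * _)).
  by case: diagonal; rewrite ?hornerC ?horner0.
rewrite exchange_big /= (bigD1 x) //= [X in _ + X]big1 ?addr0; last first.
  move=> y /andP[yP nyx]; apply: (sum_orbits adm) => // M eM.
  have fy := sdflag_flag (flags_of_sdflag gP adm yP).
  by rewrite -eM (diagonal_position fx fy) eq_sym (negPf nyx) mul0r.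
rewrite (sum_orbits (z := (M' == L)%:R) adm) //; first by case: (M' == L); rewrite ?hornerC ?horner0.
by move=> M eM; rewrite -eM (diagonal_position fx fx) eqxx mul1r eL (inj_eq val_inj) eq_sym.
Qed.

Lemma conv_conv1 (P P' : flag_kind) (t : orbit_module P P') : good P -> good P' ->
  conv t (conv1 eps m P') = t.
Proof.
move=> gP gP'; apply: coef_inj => L; rewrite coef_conv -[RHS]sum_delta_coef.
apply: eq_bigr => M _.
transitivity (coef t M * eval_v2 (\sum_M' (diagonal (val M'))%:R * structure_constant M M' L)).
  rewrite rmorph_sum mulr_sumr; apply: eq_bigr => M' _.
  by rewrite coef_conv1 // rmorphM /= eval_v2_bool; ring.
congr (_ * eval_v2 _); apply: (poly_eq_forms md) => F b adm.
have [x [w hL]] := realize md L gP gP' adm; have [xP wP eL] := hL.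
have fw := sdflag_flag (flags_of_sdflag gP' adm wP).
rewrite horner_sum.
rewrite (eq_bigr (fun M' => \sum_(y in flags_of P' b) (position y w == val M')%:R *
   ((diagonal (val M'))%:R * (position x y == val M)%:R))); last first.
  move=> M' _; rewrite hornerM (structure_constantE M M' gP gP' gP' adm hL) card_setE mulr_sumr.
  apply: eq_bigr => y _; rewrite andbC -mulnb natrM mulrCA; congr (_ * (_ * _)).
  by case: diagonal; rewrite ?hornerC ?horner0.
rewrite exchange_big /= (bigD1 w) //= [X in _ + X]big1 ?addr0; last first.
  move=> y /andP[yP nyw]; apply: (sum_orbits adm) => // M' eM.
  have fy := sdflag_flag (flags_of_sdflag gP' adm yP).
  by rewrite -eM (diagonal_position fy fw) (negPf nyw) mul0r.
rewrite (sum_orbits (z := (M == L)%:R) adm) //; first by case: (M == L); rewrite ?hornerC ?horner0.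
by move=> M' eM; rewrite -eM (diagonal_position fw fw) eqxx mul1r eL (inj_eq val_inj) eq_sym.
Qed.

End Algebra.

(** * The action of the generators *)

Section RefinedLabels.
Variables (F : finFieldType) (eps : bool) (m d : nat) (b : 'M[F]_m).
Hypothesis adm : admissible eps b.
Hypothesis md : m = (d.*2 + ~~ eps)%N.

Lemma refines_jump N (V : flag F m N) C c i : sdflag b V -> chamber b C -> refines C V ->
  (c < m)%N -> (i <= N)%N -> (jump V C c < i)%N = (c < \rank (subsp V i))%N.
Proof.
move=> sV chC /refinesP ref cm iN; have fV := sdflag_flag sV; have fC := chamber_flag chC.
rewrite (ltn_jump C fV c iN); have e := ref fC fV i iN.
rewrite (cap_eqmx e (eqmx_refl _)); case: (ltnP c (\rank (subsp V i))) => ci.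
  apply/negP => s; have /mxrankS : (subsp C c.+1 <= subsp C c)%MS.
    apply: submx_trans s; rewrite sub_capmx submx_refl andbT.
    by apply: (subspS fC) => //; apply: rank_leq_row.
  by rewrite !(chamber_rank chC) ?ltnn // ltnW.
by apply/negbTE; rewrite negbK (submx_trans (capmxSl _ _)) // (subspS fC) // ltnW.
Qed.

Lemma refines_sorted N (V : flag F m N) C : sdflag b V -> chamber b C -> refines C V ->
  lsorted d N [::] (lab d V C).
Proof.
move=> sV chC ref; have fV := sdflag_flag sV.
have mono c c' : (c <= c')%N -> (c' < m)%N -> (jump V C c <= jump V C c')%N.
  move=> cc' cm'; have jN := jump_lt fV chC cm'.
  have cm := leq_ltn_trans cc' cm'.
  rewrite -ltnS (refines_jump sV chC ref cm jN); apply: (leq_ltn_trans cc').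
  by rewrite -(refines_jump sV chC ref cm' jN).
apply/lsortedP => j jd _; rewrite /lpartner; case: ifP => jd'; rewrite !nth_lab //.
  by apply: mono => //; clear -md jd'; lia.
have jm : (j < m)%N by clear -md jd; lia.
by rewrite -(jump_dual adm sV chC jm); apply: mono; clear -md jd; lia.
Qed.

(** If [V] has no member of dimension [j.+1], the lines [j] and [j.+1] of [C] lie in one step of
    [V], or for [j.+1 = d] line [j] lies in a step equal to its opposite. *)
Lemma refines_fixed N (V : flag F m N) C j : sdflag b V -> chamber b C -> refines C V ->
  (j < d)%N -> j.+1 \notin dims V -> nth 0%N (lab d V C) j = lpartner d N j (lab d V C).
Proof.
move=> sV chC ref jd jn; have fV := sdflag_flag sV.
have jm : (j < m)%N by clear -md jd; lia.
have jN := jump_lt fV chC jm.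
have /lsortedP/(_ j jd isT) le := refines_sorted sV chC ref.
apply/eqP; rewrite eqn_leq le /= leqNgt; apply: contra jn => lt.
suff -> : j.+1 = \rank (subsp V (jump V C j).+1) by apply: mem_dims.
have j1 : (j < \rank (subsp V (jump V C j).+1))%N by rewrite -(refines_jump sV chC ref).
apply/eqP; rewrite eqn_leq j1 /=; move: lt; rewrite /lpartner; case: ifP => jd'; rewrite !nth_lab // => lt.
  rewrite leqNgt -(refines_jump sV chC ref) // -?leqNgt //; clear -md jd'; lia.
have := rank_isotropic adm (subsp_isotropic (i := (jump V C j).+1) sV _).
by move=> H; have := H _; clear -md jd' lt jN; lia.
Qed.

End RefinedLabels.

Section Action.
Variables (eps : bool) (m d : nat).
Hypothesis md : m = (d.*2 + ~~ eps)%N.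
Local Notation orbits := (orbits eps m).
Local Notation orbit_module := (orbit_module eps m).
Local Notation good := (good_kind eps m).
Local Notation Y := (complete_flags m).
Local Notation labm := (labm d).
Local Notation iota_d := (iota 0 d).
Local Notation gY := (good_complete_flags eps m).

Lemma label_of (P : flag_kind) (R : orbits P Y) (F : finFieldType) (b : 'M[F]_m) x C : good P ->
  admissible eps b -> has_position (val R) b x C -> labm (val R) = lab d x C.
Proof.
move=> gP adm [xP chC <-].
exact: (labm_position md (sdflag_flag (flags_of_sdflag gP adm xP)) chC).
Qed.

Lemma witness (P P' : flag_kind) (M : orbits P P') : good P -> good P' ->
  exists (F : finFieldType) (b : 'M[F]_m) x y, admissible eps b /\ has_position (val M) b x y.
Proof. by have := valP M => /= /asboolP[F [b [x [y [? ?]]]]]; exists F, b, x, y. Qed.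

Lemma labm_inj (P : flag_kind) (R R' : orbits P Y) : good P ->
  labm (val R) = labm (val R') -> R = R'.
Proof.
move=> gP e; have [F [b [x [C [adm h]]]]] := witness R gP gY.
have [F' [b' [x' [C' [adm' h']]]]] := witness R' gP gY.
apply/val_inj; have [xP chC ep] := h; have [xP' chC' ep'] := h'.
have sx := flags_of_sdflag gP adm xP; have sx' := flags_of_sdflag gP adm' xP'.
rewrite -ep -ep'; apply/eqP; rewrite (position_lab md adm adm' sx chC sx' chC').
by rewrite -(label_of gP adm h) -(label_of gP adm' h') e.
Qed.

Lemma orbit_with (P : flag_kind) (F : finFieldType) (b : 'M[F]_m) x C : good P ->
  admissible eps b -> x \in flags_of P b -> chamber b C ->
  exists R : orbits P Y, has_position (val R) b x C /\ labm (val R) = lab d x C.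
Proof.
move=> gP adm xP chC; have [R eR] := orbit_of adm xP (chC : C \in flags_of Y b).
by exists R; have h : has_position (val R) b x C by []; rewrite (label_of gP adm h).
Qed.

(** The action of H on T is thus expressed through labels and words alone, in a form that can be
    compared between the types. *)
Lemma structure_constant_word (P : flag_kind) (R R'' : orbits P Y) (W : orbits Y Y) w :
  good P -> reduced d m w -> labm (val W) = word_label d m w ->
  structure_constant R W R'' = word_coef d (steps P) w (labm (val R)) (labm (val R'')).
Proof.
move=> gP rw ew; apply: (poly_eq_forms md) => F b adm.
have [x [C'' h]] := realize md R'' gP gY adm; have [xP ch'' e] := h.
have sx := flags_of_sdflag gP adm xP.
rewrite (structure_constantE md R W gP gY gY adm h) (label_of gP adm h).
rewrite -(word_count adm md _ sx ch'' rw) card_setE big_mkcond [RHS]big_mkcond /=.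
apply: eq_bigr => C _; rewrite -/(chamber b C); case: (boolP (chamber b C)) => //= chC.
have [x1 [C1 [x1P ch1 e1]]] := realize md R gP gY adm.
have [C2 [C3 [ch2 ch3 e2]]] := realize md W gY gY adm.
have sx1 := flags_of_sdflag gP adm x1P.
rewrite -e1 -{1}e2 (position_lab md adm adm sx chC sx1 ch1).
rewrite (position_lab md adm adm (chamber_sdflag chC) ch'' (chamber_sdflag ch2) ch3).
rewrite (labm_position md (sdflag_flag sx1) ch1) -ew -e2.
rewrite (labm_position md (chamber_flag ch2) ch3).
by case: (lab d x C == _).
Qed.

Lemma orbit_word (W : orbits Y Y) : exists2 w, reduced d m w & word_label d m w = labm (val W).
Proof.
have [F [b [x [C [adm h]]]]] := witness W gY gY; have [xP chC _] := h.
by rewrite (label_of gY adm h); apply: (exists_word adm md).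
Qed.

Lemma lrefl_idr N j r : (j < d)%N -> size r = d -> nth 0%N r j = lpartner d N j r ->
  lrefl d N j r = r.
Proof.
move=> jd sr e; apply: (@eq_from_nth _ 0%N); rewrite ?size_lrefl ?sr // => c cd.
rewrite [LHS]nth_mkseq //; case: (eqVneq c j) => [->//|cj]; case: (eqVneq c j.+1) => // cj1.
by rewrite e /lpartner -cj1 cd.
Qed.

Lemma label_valid (P : flag_kind) (R : orbits P Y) : good P ->
  lvalid eps d (steps P) (labm (val R)).
Proof.
move=> gP; have [F [b [x [C [adm h]]]]] := witness R gP gY; have [xP chC _] := h.
rewrite (label_of gP adm h); apply: (lab_valid md adm) => //.
exact: flags_of_sdflag adm xP.
Qed.

Lemma exists_orbit_refl (P : flag_kind) (R : orbits P Y) j : good P -> (j < d)%N ->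
  exists R' : orbits P Y, labm (val R') = lrefl d (steps P) j (labm (val R)).
Proof.
move=> gP jd; have [sz _ _] := label_valid R gP.
case: (eqVneq (nth 0%N (labm (val R)) j) (lpartner d (steps P) j (labm (val R)))) => [e|ne].
  by exists R; rewrite lrefl_idr.
have [F [b [x [C [adm h]]]]] := witness R gP gY; have [xP chC _] := h.
rewrite (label_of gP adm h) in ne *.
have [C' p' <-] := exists_lrefl adm md (flags_of_sdflag gP adm xP) chC jd ne.
by have [R' [_ eR']] := orbit_with gP adm xP (panel_chamber p'); exists R'.
Qed.

(** Within a panel only two labels occur, and the identity label means equality; so [T_j] is
    supported on one orbit, the reflection of the identity label. *)
Lemma coef_hecke_gen (j : 'I_d) (W : orbits Y Y) :
  coef (hecke_gen eps m d j) W = (labm (val W) == lrefl d m j iota_d)%:R.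
Proof.
apply: (coef_char_fun md gY gY) => F b x y adm h; have [chx chy _] := h.
have sx := chamber_sdflag chx; rewrite (label_of gY adm h).
have jd := ltn_ord j; have jm : (j < m)%N by clear -md jd; lia.
have i1 : (nth 0%N iota_d j < m)%N by rewrite nth_iota.
have i2 : (nth 0%N iota_d j < lpartner d m j iota_d)%N.
  by rewrite /lpartner; case: ifP => jd'; rewrite !nth_iota //; clear -md jd; lia.
have [f1 f2] := lrefl_partner jd i1.
have inv : lrefl d m j (lrefl d m j iota_d) = iota_d by rewrite lrefl_invol ?size_iota.
apply/forallP/eqP => [h1|e i].
  have nxy : x != y.
    have := h1 j; rewrite eqxx /= eqbF_neg; apply: contra => /eqP ->; exact: eqxx.
  have p : x \in panel d b j y.
    rewrite inE; apply/andP; split; first exact: chx.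
    apply/forallP=> i; apply/implyP=> ij.
    have /eqP := h1 i; rewrite -(inj_eq val_inj) ij [LHS]eq_sym => e1; exact: e1.
  have [e|e] := lab_panel adm md sx jd chy p.
    by move: nxy; rewrite -(lab_iota adm md chx chy) -e (lab_self md chx) ?eqxx.
  have := lab_self md chx; rewrite e => <-.
  by rewrite lrefl_invol ?size_lab // (lab_lt adm md sx).
have ne : nth 0%N (lab d x y) j != lpartner d m j (lab d x y).
  by rewrite e f1 f2 eq_sym ltn_eqF.
have [C1 p1 e1] := exists_lrefl adm md sx chy jd ne; have ch1 := panel_chamber p1.
have ex : x = C1 by apply/eqP; rewrite -(lab_iota adm md chx ch1) e1 e inv.
rewrite -ex in p1; case: (eqVneq i j) => [->|nij] /=.
  rewrite eqbF_neg; apply: contraTneq i2 => exy.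
  have exy' : x = y.
    apply: (panel_eq adm md jd chy p1 (mem_panel d j chy)).
    by rewrite /subsp exy; apply: eqmx_refl.
  have := lab_self md chx; rewrite {2}exy' e => e2.
  by move: f1; rewrite e2 => ->; rewrite ltnn.
move: p1; rewrite inE => /andP[_ /forallP /(_ i)]; rewrite -(inj_eq val_inj) in nij.
by rewrite nij /= eq_sym => ->.
Qed.

Lemma reduced1 (j : 'I_d) : reduced d m [:: nat_of_ord j].
Proof.
have jd := ltn_ord j; rewrite /= jd /= /lpartner.
by case: ifP => jd'; rewrite !nth_iota //; clear -md jd; lia.
Qed.

Lemma exists_simple_orbit (j : 'I_d) : exists W : orbits Y Y, labm (val W) = lrefl d m j iota_d.
Proof.
have o3 : odd #|'F_3| by rewrite card_Fp.
have [b adm] := exists_form md o3; have [C chC] := exists_chamber adm md.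
have [W0 [_ e0]] := orbit_with gY adm chC chC.
by have [W eW] := exists_orbit_refl W0 gY (ltn_ord j); exists W; rewrite eW e0 (lab_self md chC).
Qed.

(** This gives the coefficients of a product by [T_j], so the cases are the transpose of the
    multiplication rule for the basis elements. *)
Lemma coef_conv_hecke (P : flag_kind) (t : orbit_module P Y) (j : 'I_d) (R R' : orbits P Y) :
  good P -> labm (val R') = lrefl d (steps P) j (labm (val R)) ->
  coef (conv t (hecke_gen eps m d j)) R =
    if nth 0%N (labm (val R)) j == lpartner d (steps P) j (labm (val R)) then v ^+ 2 * coef t R
    else if (nth 0%N (labm (val R)) j < lpartner d (steps P) j (labm (val R)))%N
    then v ^+ 2 * coef t R'
    else coef t R' + (v ^+ 2 - 1) * coef t R.
Proof.
move=> gP eR'; have [W eW] := exists_simple_orbit j.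
rewrite coef_conv.
transitivity (\sum_M coef t M * eval_v2 (word_coef d (steps P) [:: nat_of_ord j]
    (labm (val M)) (labm (val R)))).
  apply: eq_bigr => M _; rewrite (bigD1 W) //= big1 ?addr0.
    rewrite coef_hecke_gen eW eqxx mulr1.
    by rewrite (structure_constant_word M R gP (reduced1 j)) //.
  move=> W' nW; rewrite coef_hecke_gen -eW; case: eqP => [/(labm_inj gY) e|_].
    by rewrite e eqxx in nW.
  by rewrite mulr0 mul0r.
have eqR (M M' : orbits P Y) : (labm (val M) == labm (val M')) = (M == M').
  by apply/eqP/eqP => [/(labm_inj gP)//|->].
rewrite /= -eR'; case: ifP => _; [|case: ifP => _].
- under eq_bigr do rewrite eqR rmorphM /= eval_v2X mulrCA.
  by rewrite -mulr_sumr (sum_delta_coef t R).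
- under eq_bigr do rewrite eqR rmorphM /= eval_v2X mulrCA.
  by rewrite -mulr_sumr (sum_delta_coef t R').
under eq_bigr do rewrite !eqR rmorphD rmorphM rmorphB rmorph1 /= eval_v2X mulrDr mulrCA.
rewrite big_split /= -mulr_sumr; congr (_ + _ * _).
  exact: (sum_delta_coef t R').
exact: (sum_delta_coef t R).
Qed.

End Action.

(** * Endomorphisms of the Hecke module *)

HB.lock Definition delta (eps : bool) (m : nat) (P P' : flag_kind) (R : orbits eps m P P') :
  orbit_module eps m P P' := [ffun M => (M == R)%:R].

Section Endomorphisms.
Variables (eps : bool) (m d : nat).
Hypothesis md : m = (d.*2 + ~~ eps)%N.
Local Notation orbits := (orbits eps m).
Local Notation orbit_module := (orbit_module eps m).
Local Notation good := (good_kind eps m).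
Local Notation Y := (complete_flags m).
Local Notation labm := (labm d).
Local Notation gY := (good_complete_flags eps m).

Lemma refines_lab (F F' : finFieldType) (b : 'M[F]_m) (b' : 'M[F']_m) N
    (V : flag F m N) C (V' : flag F' m N) C' :
  admissible eps b -> admissible eps b' -> sdflag b V -> chamber b C -> refines C V ->
  sdflag b' V' -> chamber b' C' -> refines C' V' ->
  (forall k, (k <= N)%N -> \rank (subsp V k) = \rank (subsp V' k)) -> lab d V C = lab d V' C'.
Proof.
move=> adm adm' sV chC ref sV' chC' ref' e; apply: (@eq_from_nth _ 0%N); rewrite ?size_lab // => c cd.
have cm : (c < m)%N by clear -cd md; lia.
rewrite !nth_lab //.
have jN := jump_lt (sdflag_flag sV) chC cm; have jN' := jump_lt (sdflag_flag sV') chC' cm.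
have key i : (i <= N)%N -> (jump V C c < i)%N = (jump V' C' c < i)%N.
  by move=> iN; rewrite (refines_jump sV chC ref cm iN) (refines_jump sV' chC' ref' cm iN) e.
apply/eqP; rewrite eqn_leq; apply/andP; split.
  by rewrite -ltnS key.
by rewrite -ltnS -key.
Qed.

Lemma coef_delta (P P' : flag_kind) (R M : orbits P P') : coef (delta R) M = (M == R)%:R.
Proof. by rewrite /coef unlock ffunE. Qed.

Lemma coefD (P P' : flag_kind) (f g : orbit_module P P') M : coef (f + g) M = coef f M + coef g M.
Proof. by rewrite /coef ffunE. Qed.

Lemma coefZ (P P' : flag_kind) a (f : orbit_module P P') M : coef (a *: f) M = a * coef f M.
Proof. by rewrite /coef ffunE. Qed.

Lemma coef_sum (P P' : flag_kind) (I : finType) (f : I -> orbit_module P P') M :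
  coef (\sum_i f i) M = \sum_i coef (f i) M.
Proof. by apply: (big_morph (fun f => coef f M)) => [f1 f2|]; rewrite /coef ffunE. Qed.

Lemma delta_decomp (P P' : flag_kind) (t : orbit_module P P') :
  t = \sum_R coef t R *: delta R.
Proof.
apply: coef_inj => M; rewrite coef_sum (bigD1 M) //= big1 ?addr0.
  by rewrite coefZ coef_delta eqxx mulr1.
by move=> R nR; rewrite coefZ coef_delta eq_sym (negPf nR) mulr0.
Qed.

Lemma conv_linear (P P' P'' : flag_kind) (f : orbit_module P P') :
  linear (fun g : orbit_module P' P'' => conv f g).
Proof.
move=> a g h; apply: coef_inj => L; rewrite coefD coefZ !coef_conv mulr_sumr -big_split /=.
apply: eq_bigr => M _; rewrite mulr_sumr -big_split /=; apply: eq_bigr => M' _.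
by rewrite coefD coefZ; ring.
Qed.

Lemma conv_linearl (P P' P'' : flag_kind) (g : orbit_module P' P'') :
  linear (fun f : orbit_module P P' => conv f g).
Proof.
move=> a f h; apply: coef_inj => L; rewrite coefD coefZ !coef_conv mulr_sumr -big_split /=.
apply: eq_bigr => M _; rewrite mulr_sumr -big_split /=; apply: eq_bigr => M' _.
by rewrite coefD coefZ; ring.
Qed.

Lemma coef_conv_delta (P P' P'' : flag_kind) (f : orbit_module P P') (R : orbits P' P'') L :
  coef (conv f (delta R)) L = \sum_M coef f M * eval_v2 (structure_constant M R L).
Proof.
rewrite coef_conv; apply: eq_bigr => M _; rewrite (bigD1 R) //= big1 ?addr0.
  by rewrite coef_delta eqxx mulr1.
by move=> M' nM; rewrite coef_delta (negPf nM) mulr0 mul0r.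
Qed.

Section Fixed.
Variable P : flag_kind.
Hypothesis gP : good P.
Local Notation N := (steps P).
Local Notation T := (orbit_module P Y).

(** A sorted label forces [C] to refine [y], and the label also fixes the dimensions of [y]; hence
    [y] can only be the coarsening of [C] by these. *)
Lemma sorted_flag (R0 : orbits P Y) (F : finFieldType) (b : 'M[F]_m) C :
  lsorted d N [::] (labm (val R0)) -> admissible eps b -> chamber b C ->
  exists y, [/\ has_position (val R0) b y C, refines C y
              & forall y', has_position (val R0) b y' C -> y' = y].
Proof.
move=> srt adm chC; have [W [C1 h1]] := realize md R0 gP gY adm.
have [WP ch1 e1] := h1; have sW := flags_of_sdflag gP adm WP.
have l1 := label_of md gP adm h1.
have ref1 : refines C1 W by apply: (sorted_refines adm md sW ch1); rewrite -l1.
have pl := profile_rank adm sW; set l := fun _ => _ in pl.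
have sy := coarsen_sdflag chC pl; have ref := coarsen_refines chC pl.
have ry := rank_coarsen chC pl.
exists (coarsen N C l); split=> //.
  split; [exact: (flags_of_rank gP adm adm WP sy (fun i iN => esym (ry i iN))) | exact: chC | ].
  rewrite -e1; apply/eqP; rewrite (position_lab md adm adm sy chC sW ch1); apply/eqP.
  exact: (refines_lab adm adm sy chC ref sW ch1 ref1).
move=> y' h'; have [yP' _ e'] := h'; have sy' := flags_of_sdflag gP adm yP'.
have l' := label_of md gP adm h'.
have ref' : refines C y' by apply: (sorted_refines adm md sy' chC); rewrite -l'.
rewrite -[LHS](refines_coarsen (l := l) (sdflag_flag sy') chC ref') // => i iN.
by rewrite (rank_lab adm md sy' chC iN) -l' l1 -(rank_lab adm md sW ch1 iN).
Qed.

(* [V'] is determined by [R0] and [C], so that [M] is the only orbit contributing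
   to the coefficient of [e_R] in the products [e_M e_R0], and it contributes 1. *)
Definition sorted_triple (M : orbits P P) (R0 R : orbits P Y) : Prop :=
  exists (F : finFieldType) (b : 'M[F]_m) V V' C,
  [/\ admissible eps b, refines C V', has_position (val M) b V V',
      has_position (val R0) b V' C & has_position (val R) b V C].

Lemma sorted_triple_exists M : exists R0R : orbits P Y * orbits P Y, sorted_triple M R0R.1 R0R.2.
Proof.
have [F [b [V [V' [adm h]]]]] := witness M gP gP; have [VP VP' e] := h.
have [C chC ref] := exists_chamber_refining adm md (flags_of_sdflag gP adm VP').
have [R0 [h0 _]] := orbit_with md gP adm VP' chC.
have [R [h1 _]] := orbit_with md gP adm VP chC.
by exists (R0, R), F, b, V, V', C.
Qed.

Lemma sorted_triple_sorted M R0 R : sorted_triple M R0 R -> lsorted d N [::] (labm (val R0)).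
Proof.
move=> [F [b [V [V' [C [adm ref _ h0 _]]]]]]; have [VP' chC _] := h0.
rewrite (label_of md gP adm h0).
exact: (refines_sorted adm md (flags_of_sdflag gP adm VP') chC ref).
Qed.

Lemma sorted_triple_of_sorted R0 R : lsorted d N [::] (labm (val R0)) -> exists M, sorted_triple M R0 R.
Proof.
move=> srt; have [F [b [V [C [adm h]]]]] := witness R gP gY; have [VP chC _] := h.
have [V' [h0 ref _]] := sorted_flag srt adm chC; have [VP' _ _] := h0.
by have [M eM] := orbit_of adm VP VP'; exists M, F, b, V, V', C.
Qed.

Lemma sorted_triple_position M R0 R (F : finFieldType) (b : 'M[F]_m) x y z : sorted_triple M R0 R ->
  admissible eps b -> has_position (val R) b x z -> has_position (val R0) b y z ->
  position x y = val M.
Proof.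
move=> tr adm hR h0; have srt := sorted_triple_sorted tr.
case: tr => F1 [b1 [V [V' [C [adm1 ref1 [VP VP' <-] h01 hR1]]]]].
have [xP chz eR] := hR; have [yP _ e0] := h0; have [_ chC eR1] := hR1.
have sx := flags_of_sdflag gP adm xP; have sy := flags_of_sdflag gP adm yP.
have sV := flags_of_sdflag gP adm1 VP; have sV' := flags_of_sdflag gP adm1 VP'.
have refy : refines z y.
  by apply: (sorted_refines adm md sy chz); rewrite -(label_of md gP adm h0).
apply/eq_position; rewrite ?(sdflag_flag sx) ?(sdflag_flag sy) ?(sdflag_flag sV)
  ?(sdflag_flag sV') // => i k iN kN.
rewrite (rcap_refine x _ (sdflag_flag sy) chz refy) //.
rewrite (rcap_refine V _ (sdflag_flag sV') chC ref1) //.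
have -> : \rank (subsp y k) = \rank (subsp V' k).
  rewrite (rank_lab adm md sy chz kN) (rank_lab adm1 md sV' chC kN).
  by rewrite -(label_of md gP adm h0) -(label_of md gP adm1 h01).
apply: (eq_jump_rcap sx chz sV chC) => //; last exact: rank_leq_row.
apply: (eq_lab md adm adm1 sx chz sV chC).
by rewrite -(label_of md gP adm hR) -(label_of md gP adm1 hR1).
Qed.

Lemma sorted_triple_structure_constant M R0 R M' : sorted_triple M R0 R ->
  structure_constant M' R0 R = (M' == M)%:R.
Proof.
move=> tr; apply: (poly_eq_forms md) => F b adm.
have [x [z hR]] := realize md R gP gY adm; have [xP chz _] := hR.
rewrite (structure_constantE md M' R0 gP gP gY adm hR) card_setE.
have [y [h0 _ uni]] := sorted_flag (sorted_triple_sorted tr) adm chz; have [yP _ e0] := h0.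
rewrite (bigD1 y) //= big1 ?addr0 => [|y' /andP[yP' ny]]; last first.
  by rewrite (_ : (position y' z == val R0) = false) ?andbF //; apply: contraNF ny => /eqP e;
    apply/eqP; apply: uni.
rewrite e0 eqxx andbT (sorted_triple_position tr adm hR h0) (inj_eq val_inj) eq_sym.
by case: (M' == M); rewrite ?hornerC ?horner0.
Qed.

Lemma sorted_triple_unique M R0 R0' R R' : sorted_triple M R0 R -> sorted_triple M R0' R' -> R0 = R0'.
Proof.
move=> [F [b [V [V' [C [adm ref [VP VP' e] h0 hR]]]]]].
move=> [F1 [b1 [V1 [V1' [C1 [adm1 ref1 [VP1 VP1' e1] h01 hR1]]]]]].
have [_ chC _] := h0; have [_ ch1 _] := h01.
have sV := flags_of_sdflag gP adm VP; have sV' := flags_of_sdflag gP adm VP'.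
have sV1 := flags_of_sdflag gP adm1 VP1; have sV1' := flags_of_sdflag gP adm1 VP1'.
apply: (labm_inj md gP); rewrite (label_of md gP adm h0) (label_of md gP adm1 h01).
apply: (refines_lab adm adm1 sV' chC ref sV1' ch1 ref1).
have er : forall i k, (i <= N)%N -> (k <= N)%N -> rcap V V' i k = rcap V1 V1' i k.
  by apply/eq_position; rewrite ?(sdflag_flag sV) ?(sdflag_flag sV') ?(sdflag_flag sV1)
    ?(sdflag_flag sV1') // e e1.
by have [rk _] := eq_dims sV sV1 (fun k => er _ k (leqnn _)).
Qed.

(** Sorting within the blocks of [V'] only uses reflections fixing [R0], hence preserves the
    coefficient. The sorted label depends on [M] alone, so [R] and [R'] are led to the same
    orbit. *)
Lemma sorted_triple_invariant M R0 R R' (t : T) : sorted_triple M R0 R -> sorted_triple M R0 R' ->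
  (forall j R1 R2, (j < d)%N ->
     nth 0%N (labm (val R0)) j = lpartner d N j (labm (val R0)) ->
     labm (val R2) = lrefl d N j (labm (val R1)) -> coef t R1 = coef t R2) ->
  coef t R = coef t R'.
Proof.
move=> tr tr' inv.
have sort (S : orbits P Y) : sorted_triple M R0 S -> exists (F : finFieldType) (b : 'M[F]_m) V V' C,
  exists S1 : orbits P Y,
  [/\ admissible eps b, refines C V', has_position (val M) b V V',
      has_position (val S1) b V C & lsorted d N (dims V') (lab d V C) /\ coef t S1 = coef t S].
  move=> [F [b [V [V' [C [adm ref [VP VP' e] h0 hS]]]]]]; have [_ chC _] := h0.
  have sV := flags_of_sdflag gP adm VP; have sV' := flags_of_sdflag gP adm VP'.
  (* The property carried through the sorting is that [t] has the same coefficient at the current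
     label as at [S]. *)
  have [|C1 j ch1 jd jn [S1 [e1 t1]]|C' [ch' ref' srt' [S1 [e1 t1]]]] :=
    @sort_chamber F eps m d b adm md N V N V'
      (fun r => exists S1 : orbits P Y, labm (val S1) = r /\ coef t S1 = coef t S) C
      sV sV' chC ref.
  - by exists S; rewrite (label_of md gP adm hS).
  - have [S2 e2] := exists_orbit_refl md S1 gP jd; exists S2; rewrite e2 e1; split=> //.
    rewrite -t1; apply/esym; apply: (inv j) => //.
    rewrite (label_of md gP adm h0); exact: (refines_fixed adm md sV' chC ref).
  exists F, b, V, V', C', S1; split=> //.
  have [S2 [h2 e2]] := orbit_with md gP adm VP ch'.
  by have -> : S1 = S2 by apply: (labm_inj md gP); rewrite e1 e2.
have [F [b [V [V' [C [S1 [adm ref hM hS [srt <-]]]]]]]] := sort R tr.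
have [F' [b' [W [W' [C' [S1' [adm' ref' hM' hS' [srt' <-]]]]]]]] := sort R' tr'.
congr coef; apply: (labm_inj md gP).
have [VP VP' e] := hM; have [WP WP' e'] := hM'.
have sV := flags_of_sdflag gP adm VP; have sV' := flags_of_sdflag gP adm VP'.
have sW := flags_of_sdflag gP adm' WP; have sW' := flags_of_sdflag gP adm' WP'.
have [_ chC _] := hS; have [_ chC' _] := hS'.
rewrite (label_of md gP adm hS) (label_of md gP adm' hS').
apply: (@eq_from_nth _ 0%N); rewrite ?size_lab // => c cd; rewrite !nth_lab //.
apply: (sorted_determined md adm adm' sV sV' sW sW' chC chC' ref ref' srt srt').
  by apply/eq_position; rewrite ?(sdflag_flag sV) ?(sdflag_flag sV') ?(sdflag_flag sW)
    ?(sdflag_flag sW') // e e'.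
by clear -cd md; lia.
Qed.

Lemma label_lt (R : orbits P Y) j : (j < d)%N ->
  (nth 0%N (labm (val R)) j < N)%N /\ size (labm (val R)) = d.
Proof. by move=> jd; have [sr rN _] := label_valid md R gP; rewrite rN. Qed.

Lemma delta_fixed (R0 : orbits P Y) (j : 'I_d) :
  nth 0%N (labm (val R0)) j = lpartner d N j (labm (val R0)) ->
  conv (delta R0) (hecke_gen eps m d j) = v ^+ 2 *: delta R0.
Proof.
move=> fx; apply: coef_inj => R; have jd := ltn_ord j.
have [R' eR'] := exists_orbit_refl md R gP jd.
have [rN sr] := label_lt R jd; have [r0N sr0] := label_lt R0 jd.
apply: etrans (coef_conv_hecke md (delta R0) gP eR') _; rewrite coefZ !coef_delta; case: eqP => [//|ne].
have -> : (R == R0) = false by apply/eqP => e; case: ne; rewrite e.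
have -> : (R' == R0) = false.
  apply/eqP => e; case: ne; move: eR'; rewrite e => e0.
  have [f1 f2] := lrefl_partner jd rN.
  by rewrite -f1 -f2 -e0 fx.
by rewrite !mulr0 addr0; case: ifP.
Qed.

(** A descent is produced from a label of smaller potential by one generator; this is the induction
    step by which sorted labels generate T. *)
Lemma delta_up (R R' : orbits P Y) (j : 'I_d) :
  (lpartner d N j (labm (val R)) < nth 0%N (labm (val R)) j)%N ->
  labm (val R') = lrefl d N j (labm (val R)) ->
  delta R = conv (delta R') (hecke_gen eps m d j).
Proof.
move=> up e'; apply: coef_inj => S; have jd := ltn_ord j.
have [S' eS'] := exists_orbit_refl md S gP jd.
have [rN sr] := label_lt R jd; have [sN ss] := label_lt S jd.
have [f1 f2] := lrefl_partner jd rN; have [g1 g2] := lrefl_partner jd sN.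
apply/esym.
apply: (etrans (coef_conv_hecke md (delta R') gP eS')).
rewrite (coef_delta R S) (coef_delta R' S) (coef_delta R' S').
have eSR : (S' == R') = (S == R).
  apply/eqP/eqP => [e|e]; last by apply: (labm_inj md gP); rewrite e' eS' e.
  apply: (labm_inj md gP); rewrite -(lrefl_invol jd sN ss) -(lrefl_invol jd rN sr).
  by rewrite -eS' -e' e.
rewrite eSR; case: eqP => [e|ne].
  have -> : (S == R) = false by apply: contraTF up => /eqP <-; rewrite e ltnn.
  have -> : (S == R') = false; last by rewrite mulr0.
  by apply/eqP => eS; move: e; rewrite eS e' f1 f2 => h; move: up; rewrite h ltnn.
case: ltnP => xy.
  have -> : (S == R) = false; last by rewrite mulr0.
  by apply: contraTF up => /eqP <-; rewrite -leqNgt ltnW.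
have -> : (S == R') = false; last by rewrite mulr0 addr0.
by apply: contraTF xy => /eqP ->; rewrite e' f1 f2 -ltnNge.
Qed.

Lemma hecke_linear_ext (f g : T -> T) : linear f -> linear g ->
  (forall t h, f (conv t h) = conv (f t) h) -> (forall t h, g (conv t h) = conv (g t) h) ->
  (forall R0 : orbits P Y, lsorted d N [::] (labm (val R0)) -> f (delta R0) = g (delta R0)) ->
  f =1 g.
Proof.
move=> lf lg hf hg e.
have key (R : orbits P Y) : f (delta R) = g (delta R).
  have [k] := ubnP (lpotential d (labm (val R))); elim: k R => // k IH R; rewrite ltnS => pk.
  case: (boolP (lsorted d N [::] (labm (val R)))) => [|/allPn[j]]; first exact: e.
  rewrite mem_iota add0n /= => jd; rewrite -ltnNge => up.
  have [R' eR'] := exists_orbit_refl md R gP jd.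
  rewrite (@delta_up R R' (Ordinal jd)) // hf hg IH // eR'.
  by apply: leq_trans pk; apply: lpotential_lrefl.
pose F : {linear T -> T} := HB.pack f (GRing.isLinear.Build _ _ _ _ f lf).
pose G : {linear T -> T} := HB.pack g (GRing.isLinear.Build _ _ _ _ g lg).
move=> t; rewrite (delta_decomp t) -[LHS]/(F _) -[RHS]/(G _) !linear_sum.
by apply: eq_bigr => R _; rewrite !linearZ; congr (_ *: _); apply: key.
Qed.

(** Coefficients at [R1] are compared in [f (delta R0) T_j = v ^+ 2 *: f (delta R0)]. When the two
    labels differ, this reads [v ^+ 2 * x2 = v ^+ 2 * x1] or [x2 + (v ^+ 2 - 1) * x1 = v ^+ 2 * x1],
    and [v ^+ 2] is cancellable. *)
Lemma hecke_invariant (f : {linear T -> T}) (R0 : orbits P Y) j R1 R2 :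
  (forall t h, f (conv t h) = conv (f t) h) -> (j < d)%N ->
  nth 0%N (labm (val R0)) j = lpartner d N j (labm (val R0)) ->
  labm (val R2) = lrefl d N j (labm (val R1)) ->
  coef (f (delta R0)) R1 = coef (f (delta R0)) R2.
Proof.
move=> hf jd fx e2; have := hf (delta R0) (hecke_gen eps m d (Ordinal jd)).
rewrite (delta_fixed (j := Ordinal jd) fx) linearZ => /(congr1 (fun t => coef t R1))/esym.
move/(etrans (esym (@coef_conv_hecke _ _ _ md P (f (delta R0)) (Ordinal jd) R1 R2 gP e2))).
rewrite coefZ.
set x1 := coef _ R1; set x2 := coef _ R2; have [rN sr] := label_lt R1 jd.
case: eqP => [e _|_].
  by rewrite /x1 /x2; congr coef; apply: (labm_inj md gP); rewrite e2 lrefl_idr.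
case: ifP => _ e.
  by apply/eqP; rewrite -subr_eq0; apply/eqP/mulIv2; rewrite mulrBr e subrr.
have : (v ^+ 2 * x1) - (x2 + (v ^+ 2 - 1) * x1) = 0 by rewrite -e subrr.
by move=> e3; apply/eqP; rewrite -subr_eq0 -e3; apply/eqP; ring.
Qed.

Lemma end_iso : endomorphism_iso eps m P Y.
Proof.
split=> [s t h|s s' t|t|f hf].
- by apply/esym/(conv_assoc md) => //; apply: gY.
- by apply: (conv_assoc md) => //; apply: gY.
- exact: (conv1_conv md t gP gY).
(* The value of [s] at [M] is read at an arbitrary triple over [M]; the invariance of the
   coefficients of [f (delta R0)] makes the choice immaterial. *)
have /choice[rr rrP] := sorted_triple_exists.
pose s : orbit_module P P := [ffun M => coef (f (delta (rr M).1)) (rr M).2].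
have es M : coef s M = coef (f (delta (rr M).1)) (rr M).2 by rewrite /coef ffunE.
have conv_triple (s' : orbit_module P P) M R0 R : sorted_triple M R0 R ->
    coef (conv s' (delta R0)) R = coef s' M.
  move=> tr; rewrite coef_conv_delta -[RHS]sum_delta_coef; apply: eq_bigr => M' _.
  by rewrite (sorted_triple_structure_constant M' tr).
exists s; split=> [|s' e]; last first.
  by apply: coef_inj => M; rewrite es e (conv_triple s' M _ _ (rrP M)).
apply: hecke_linear_ext => //; [exact: linearP | exact: conv_linear | |].
  by move=> t h; apply/esym/(conv_assoc md) => //; apply: gY.
move=> R0 srt; apply: coef_inj => R; have [M tr] := sorted_triple_of_sorted R srt.
rewrite (conv_triple _ _ _ _ tr) es; have tr' := rrP M.
have e0 := sorted_triple_unique tr' tr; rewrite e0 in tr' *.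
by apply: (sorted_triple_invariant tr tr') => j R1 R2 jd fx e2; apply: (hecke_invariant hf jd fx e2).
Qed.

Lemma right_mod : right_module eps m P Y.
Proof.
split=> [t h h'|t]; last exact: (conv_conv1 md t gP gY).
by apply: (conv_assoc md) => //; apply: gY.
Qed.

End Fixed.
End Endomorphisms.

(** * Comparison of the two types *)

(* All that the formulas for the action of the generators see of the values of
   the labels: their order and the duality [x |-> N - 1 - x]. *)
Definition relabels (N' N : nat) (io : nat -> nat) : Prop :=
  [/\ forall x, (x < N')%N -> (io x < N)%N, forall x y, (io x < io y)%N = (x < y)%N
    & forall x, (x < N')%N -> io (N'.-1 - x)%N = (N.-1 - io x)%N].

Lemma relabels_id N : relabels N N id.
Proof. by []. Qed.

Lemma relabels_bump n : relabels n.*2 n.*2.+1 (bump n).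
Proof. by split=> [x|x y|x]; rewrite /bump; lia. Qed.

Definition label_ok (d N : nat) (r : seq nat) : Prop :=
  size r = d /\ forall c, (c < d)%N -> (nth 0%N r c < N)%N.

Lemma label_ok_lrefl d N j r : (j < d)%N -> label_ok d N r -> label_ok d N (lrefl d N j r).
Proof.
move=> jd [sr rN]; split=> [|c cd]; first exact: size_lrefl.
rewrite nth_mkseq // /lpartner; have := rN j jd; have := rN c cd; have := rN j.+1.
by case: (eqVneq c j) => // _; case: (ltnP j.+1 d) => // _; case: (eqVneq c j.+1) => // _; lia.
Qed.

Lemma word_label_ok eps m d w : m = (d.*2 + ~~ eps)%N -> reduced d m w ->
  label_ok d m (word_label d m w).
Proof. by move=> md /(word_label_valid md). Qed.

Section Relabel.
Variables (d N' N : nat) (io : nat -> nat).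
Hypothesis rel : relabels N' N io.

Lemma relabels_inj : injective io.
Proof.
case: rel => _ mono _ x y e; have := mono x y; have := mono y x.
by rewrite e ltnn; case: ltngtP.
Qed.

Lemma lpartner_map j r : (j < d)%N -> label_ok d N' r ->
  lpartner d N j (map io r) = io (lpartner d N' j r).
Proof.
case: rel => _ _ dual jd [sr rN]; rewrite /lpartner; case: ifP => jd'.
  by rewrite (nth_map 0%N) ?sr.
by rewrite (nth_map 0%N) ?sr // dual ?rN.
Qed.

Lemma lrefl_map j r : (j < d)%N -> label_ok d N' r ->
  lrefl d N j (map io r) = map io (lrefl d N' j r).
Proof.
move=> jd ok; have [sr _] := ok; apply: (@eq_from_nth _ 0%N); rewrite size_lrefl ?size_map ?size_iota // => c cd.
rewrite (nth_map 0%N) ?size_lrefl // !nth_mkseq // lpartner_map //.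
by case: eqP => // _; case: eqP => // _; rewrite (nth_map 0%N) ?sr.
Qed.

Lemma word_coef_map w r r'' : all (fun j => j < d)%N w -> label_ok d N' r -> label_ok d N' r'' ->
  word_coef d N w (map io r) (map io r'') = word_coef d N' w r r''.
Proof.
move=> + ok; elim: w r'' => [|j w IH] r'' /=; first by rewrite (inj_eq (inj_map relabels_inj)).
case/andP=> jd aw ok''; have [sr'' _] := ok''; have ok1 := label_ok_lrefl jd ok''.
have [_ mono _] := rel.
rewrite (nth_map 0%N) ?sr'' // lpartner_map // (inj_eq relabels_inj) mono lrefl_map //.
by rewrite !IH.
Qed.

End Relabel.

Lemma reduced_lt d m w : reduced d m w -> all (fun j => j < d)%N w.
Proof. by elim: w => //= j w IH /and3P[/IH -> ->]. Qed.

(** The identity label has only entries fixed by [io], and reflections commute with relabelling, so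
    both types have the same reduced words. *)
Lemma word_label_map eps' m' m d io w : m' = (d.*2 + ~~ eps')%N -> relabels m' m io ->
  map io (iota 0 d) = iota 0 d ->
  reduced d m w = reduced d m' w /\
  (reduced d m' w -> word_label d m w = map io (word_label d m' w)).
Proof.
move=> md' rel fix_io; elim: w => [|j w [e1 e2]] /=; first by rewrite fix_io.
rewrite e1; case: (boolP (reduced d m' w)) => //= rw; rewrite (e2 rw).
case: (ltnP j d) => //= jd; have ok := word_label_ok md' rw; have [sr _] := ok.
have [_ mono _] := rel; split.
  by rewrite (nth_map 0%N) ?sr // (lpartner_map rel) // mono.
by move=> _; apply: (lrefl_map rel).
Qed.

Section Match.
Variables (eps eps' : bool) (m m' d : nat).
Hypotheses (md : m = (d.*2 + ~~ eps)%N) (md' : m' = (d.*2 + ~~ eps')%N).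
Local Notation Y := (complete_flags m).
Local Notation Y' := (complete_flags m').
Local Notation gY := (good_complete_flags eps m).
Local Notation gY' := (good_complete_flags eps' m').

Section Pullback.
Variables (P P' : flag_kind) (be : orbits eps' m' P' Y' -> orbits eps m P Y).

(** Orbits are matched from type C to type B, because relabelling inserts a value; functions then
    travel from type B to type C. *)
Definition pullback (f : orbit_module eps m P Y) : orbit_module eps' m' P' Y' :=
  [ffun R => coef f (be R)].

Lemma coef_pullback f R : coef (pullback f) R = coef f (be R).
Proof. by rewrite /coef ffunE. Qed.

Lemma pullback_is_linear : linear pullback.
Proof. by move=> a f g; apply: coef_inj => R; rewrite coefD coefZ !coef_pullback coefD coefZ. Qed.
HB.instance Definition _ := GRing.isLinear.Build laurent (orbit_module eps m P Y)
  (orbit_module eps' m' P' Y') _ pullback pullback_is_linear.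

Lemma pullback_bij : bijective be -> bijective pullback.
Proof.
case=> al K1 K2; exists (fun g => [ffun R => coef g (al R)] : orbit_module eps m P Y) => f.
  by apply: coef_inj => R; rewrite {1}/coef ffunE coef_pullback K2.
by apply: coef_inj => R; rewrite coef_pullback {1}/coef ffunE K1.
Qed.

End Pullback.

Definition matches (P P' : flag_kind) (io : nat -> nat)
    (be : orbits eps' m' P' Y' -> orbits eps m P Y) : Prop :=
  bijective be /\ forall R, labm d (val (be R)) = map io (labm d (val R)).

Lemma exists_matches (P P' : flag_kind) io : good_kind eps m P -> good_kind eps' m' P' ->
  injective io ->
  (forall R' : orbits eps' m' P' Y', exists R : orbits eps m P Y,
     labm d (val R) = map io (labm d (val R'))) ->
  (forall R : orbits eps m P Y, exists R' : orbits eps' m' P' Y',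
     labm d (val R) = map io (labm d (val R'))) ->
  exists be, @matches P P' io be.
Proof.
move=> gP gP' ii /choice[be beE] /choice[al alE]; exists be; split=> //; exists al => R.
  apply: (labm_inj md' gP'); apply: (inj_map ii).
  by rewrite -alE beE.
by apply: (labm_inj md gP); rewrite beE -alE.
Qed.

Variables (ioY : nat -> nat) (beY : orbits eps' m' Y' Y' -> orbits eps m Y Y).
Hypotheses (relY : relabels m' m ioY) (fixY : map ioY (iota 0 d) = iota 0 d).
Hypothesis maY : matches ioY beY.

(** A reduced word of [W] is reduced on both sides, and [word_coef] only sees what [relabels]
    preserves. *)
Lemma structure_constant_match (P P' : flag_kind) io be R W R'' : good_kind eps m P ->
  good_kind eps' m' P' -> relabels (steps P') (steps P) io -> @matches P P' io be ->
  structure_constant (be R) (beY W) (be R'') = structure_constant R W R''.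
Proof.
move=> gP gP' rel [_ eb]; have [w rw ew] := orbit_word md' W.
have [er el] := word_label_map w md' relY fixY; have [_ ebY] := maY.
rewrite (structure_constant_word md' R R'' gP' rw (esym ew)).
have rw1 : reduced d m w by rewrite er.
rewrite (@structure_constant_word _ _ _ md P (be R) (be R'') (beY W) w gP rw1); last first.
  by rewrite ebY -ew el.
rewrite !eb (word_coef_map rel) //; first exact: reduced_lt rw.
  by have [? ? _] := label_valid md' R gP'.
by have [? ? _] := label_valid md' R'' gP'.
Qed.

Lemma pullback_conv (P P' : flag_kind) io be t h : good_kind eps m P ->
  good_kind eps' m' P' -> relabels (steps P') (steps P) io -> @matches P P' io be ->
  pullback be (conv t h) = conv (pullback be t) (pullback beY h).
Proof.
move=> gP gP' rel ma; have [bb _] := ma; have [bbY _] := maY.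
apply: coef_inj => L; rewrite coef_pullback !coef_conv.
rewrite (reindex be) /=; last exact: onW_bij.
apply: eq_bigr => R _; rewrite (reindex beY) /=; last exact: onW_bij.
apply: eq_bigr => W _; rewrite !coef_pullback.
by rewrite (structure_constant_match R W L gP gP' rel ma).
Qed.

(** A multiplicative bijection carries the unit to a unit, so the diagonal orbits need not be
    matched by hand. *)
Lemma pullback_conv1 : pullback beY (conv1 eps m Y) = conv1 eps' m' Y'.
Proof.
have [al K1 K2] := pullback_bij maY.1.
rewrite -[LHS](conv1_conv md' _ gY' gY') -[in LHS](K2 (conv1 eps' m' Y')).
by rewrite -(pullback_conv _ _ gY gY' relY maY) (conv_conv1 md _ gY gY) K2.
Qed.

Lemma pullback_hecke_gen (j : 'I_d) :
  pullback beY (hecke_gen eps m d j) = hecke_gen eps' m' d j.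
Proof.
apply: coef_inj => W; rewrite coef_pullback (coef_hecke_gen md) (coef_hecke_gen md').
have [_ ebY] := maY; rewrite ebY -{1}fixY (lrefl_map relY) //.
  by rewrite (inj_eq (inj_map (relabels_inj relY))).
split=> [|c cd]; first exact: size_iota.
by rewrite nth_iota //; clear -cd md'; lia.
Qed.

Lemma coef_seq_elt (P : flag_kind) (r : {ffun 'I_d -> 'I_(steps P)}) R : good_kind eps m P ->
  coef (seq_elt eps m P d r) R = (labm d (val R) == [seq nat_of_ord (r c) | c <- enum 'I_d])%:R.
Proof.
move=> gP; apply: (coef_char_fun md gP gY) => F b x y adm h; have [xP chy _] := h.
have fx := sdflag_flag (flags_of_sdflag gP adm xP).
rewrite (label_of md gP adm h).
have en (c : 'I_d) : nth 0%N [seq nat_of_ord (r c) | c <- enum 'I_d] c = r c.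
  by rewrite (nth_map c) ?size_enum_ord // nth_ord_enum.
have sd (c : 'I_d) : (step_dim x y (r c) c == 1%N) = (nth 0%N (lab d x y) c == r c).
  have cm : (c < m)%N by have := ltn_ord c; clear -md; lia.
  by rewrite (step_dim_jump fx chy) // nth_lab // eqb1.
apply/forallP/eqP => [e|e c]; last by rewrite sd e en.
apply: (@eq_from_nth _ 0%N) => [|c]; rewrite size_lab; first by rewrite size_map size_enum_ord.
move=> cd.
by rewrite (en (Ordinal cd)); have := e (Ordinal cd); rewrite sd => /eqP.
Qed.

End Match.

(** * From module isomorphisms to endomorphism algebras *)

Section Transport.
Variables (eps eps' : bool) (m m' : nat) (P Y P' Y' : flag_kind).
Local Notation S := (orbit_module eps m P P).
Local Notation S' := (orbit_module eps' m' P' P').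
Local Notation T := (orbit_module eps m P Y).
Local Notation T' := (orbit_module eps' m' P' Y').
Local Notation H := (orbit_module eps m Y Y).
Local Notation H' := (orbit_module eps' m' Y' Y').
Hypotheses (eB : endomorphism_iso eps m P Y) (eC : endomorphism_iso eps' m' P' Y').
Hypotheses (rB : right_module eps m P Y) (rC : right_module eps' m' P' Y').
Variables (phi : {linear T -> T'}) (psi : H -> H').
Hypotheses (phi_bij : bijective phi) (psi_bij : bijective psi).
Hypothesis phi_conv : forall t h, phi (conv t h) = conv (phi t) (psi h).

(** This is the uniqueness half of [endomorphism_iso], applied to left convolution by [a]. *)
Lemma conv_faithful (e : bool) (k : nat) (Q Z : flag_kind) (a c : orbit_module e k Q Q) :
  endomorphism_iso e k Q Z -> (forall t : orbit_module e k Q Z, conv a t = conv c t) -> a = c.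
Proof.
move=> [as1 _ _ ex] ac.
pose f : {linear orbit_module e k Q Z -> orbit_module e k Q Z} :=
  HB.pack (fun t => conv a t) (GRing.isLinear.Build _ _ _ _ _ (@conv_linear e k Q Q Z a)).
have [|s [_ uni]] := ex f; first by move=> t h; apply: as1.
by rewrite -(uni a) // -(uni c).
Qed.

(** [theta s] is the element representing the conjugate of [s] by [phi]. Linearity, multiplicativity
    and the unit follow from uniqueness, and the inverse arises from the opposite conjugation. *)
Lemma exists_transport : exists theta : {linear S -> S'}, algebra_iso theta /\
  forall s t, phi (conv s t) = conv (theta s) (phi t).
Proof.
have [psi' pK pK'] := psi_bij; have [phi' K K'] := phi_bij.
have phi'_lin : linear phi'.
  by move=> a t u; apply: (can_inj K); rewrite linearP !K'.
have [asB mulB oneB exB] := eB; have [asC mulC oneC exC] := eC.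
have phi'_conv t h : phi' (conv t h) = conv (phi' t) (psi' h).
  by apply: (can_inj K); rewrite phi_conv !K' pK'.
have /choice[theta thE] : forall s : S, exists s' : S', forall t, phi (conv s t) = conv s' (phi t).
  move=> s; pose g t := phi (conv s (phi' t)).
  have g_lin : linear g by move=> a t u; rewrite /g phi'_lin (conv_linear s) linearP.
  pose f : {linear T' -> T'} := HB.pack g (GRing.isLinear.Build _ _ _ _ _ g_lin).
  have [|s' [e _]] := exC f; first by move=> t h; rewrite /= /g phi'_conv asB phi_conv pK'.
  by exists s' => t; have := e (phi t); rewrite /= /g K.
have th_uni s s' : (forall t, phi (conv s t) = conv s' (phi t)) -> theta s = s'.
  by move=> e; apply: (conv_faithful eC) => t; rewrite -(K' t) -thE e.
have th_lin : linear theta.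
  move=> a s u; apply: th_uni => t.
  by rewrite (conv_linearl t) linearP !thE (conv_linearl (phi t)).
pose th : {linear S -> S'} := HB.pack theta (GRing.isLinear.Build _ _ _ _ _ th_lin).
exists th; split=> //; split=> [||s u] /=.
- have /choice[al alE] : forall s' : S', exists s, theta s = s'.
    move=> s'; pose g t := phi' (conv s' (phi t)).
    have g_lin : linear g by move=> a t u; rewrite /g linearP (conv_linear s') phi'_lin.
    pose f : {linear T -> T} := HB.pack g (GRing.isLinear.Build _ _ _ _ _ g_lin).
    have [|s [e _]] := exB f.
      by move=> t h; rewrite /= /g phi_conv asC phi'_conv pK.
    exists s; apply: th_uni => t; have := e t; rewrite /= /g => <-; exact: K'.
  exists al => // s; apply: (conv_faithful eB) => t; apply: (can_inj K).
  by rewrite !thE alE.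
- by apply: th_uni => t; rewrite oneB oneC.
by apply: th_uni => t; rewrite mulB !thE mulC.
Qed.

End Transport.

(** * The labels that occur for each kind of flags *)

Section LabelSets.
Variables (eps : bool) (m d : nat).
Hypothesis md : m = (d.*2 + ~~ eps)%N.
Local Notation Y := (complete_flags m).
Local Notation gY := (good_complete_flags eps m).

Lemma exists_admissible : exists (F : finFieldType) (b : 'M[F]_m), admissible eps b.
Proof.
have o3 : odd #|'F_3| by rewrite card_Fp.
by have [b adm] := exists_form md o3; exists 'F_3, b.
Qed.

Lemma word_orbit w : reduced d m w ->
  exists W : orbits eps m Y Y, labm d (val W) = word_label d m w.
Proof.
elim: w => [_|j w IH] /=.
  have [F [b adm]] := exists_admissible; have [C chC] := exists_chamber adm md.
  by have [W [_ eW]] := orbit_with md gY adm chC chC; exists W; rewrite eW (lab_self md chC).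
case/and3P=> /IH[W eW] jd _; have [W' eW'] := exists_orbit_refl md W gY jd.
by exists W'; rewrite eW' eW.
Qed.

Lemma label_orbit (P : flag_kind) r : good_kind eps m P -> lvalid eps d (steps P) r ->
  (forall (F : finFieldType) (b : 'M[F]_m) V C, admissible eps b -> sdflag b V ->
     chamber b C -> lab d V C = r -> V \in flags_of P b) ->
  exists R : orbits eps m P Y, labm d (val R) = r.
Proof.
move=> gP val inP; have [F [b adm]] := exists_admissible.
have [V [C [sV chC eV]]] := exists_lab adm md val.
have [R [_ eR]] := orbit_with md gP adm (inP F b V C adm sV chC eV) chC.
by exists R; rewrite eR.
Qed.

Lemma selfdual_label_orbit N r : lvalid eps d N r ->
  exists R : orbits eps m (selfdual_flags N) Y, labm d (val R) = r.
Proof.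
move=> rv; apply: label_orbit => //; first exact: good_selfdual_flags.
by move=> F b V C _ /andP[fV sV] _ _; rewrite inE fV.
Qed.

End LabelSets.

Section MaximalIsotropic.
Variables n d : nat.
Local Notation m := d.*2.+1.
Local Notation N := n.*2.+1.
Local Notation Y := (complete_flags m).

Lemma mdB : m = (d.*2 + ~~ false)%N.
Proof. by rewrite addn1. Qed.

(** Below rank [d] an isotropic vector can still be adjoined, and no isotropic space has rank beyond
    [d]. *)
Lemma maximal_isotropic_rank (F : finFieldType) (b : 'M[F]_m) (U : 'M[F]_m) :
  admissible false b -> isotropic b U -> maximal_isotropic b U = (\rank U == d).
Proof.
move=> adm iU; have rd (W : 'M[F]_m) : isotropic b W -> (\rank W <= d)%N.
  by move=> /(rank_isotropic adm); move: (\rank W) => k; clear; lia.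
rewrite /maximal_isotropic iU /=; apply/forallP/eqP => [mx|rU W]; last first.
  apply/implyP=> /andP[iW UW]; have [_ <-] := mxrank_leqif_sup UW.
  by rewrite eqn_leq mxrankS //= rU rd.
apply/eqP; rewrite eqn_leq rd //= leqNgt; apply/negP => lt.
have [u [uo nu uu]] := exists_isotropic_row adm mdB iU lt.
have /implyP := mx (U + u)%MS; rewrite (isotropic_adds adm iU uo uu) addsmxSl.
by move/(_ isT); rewrite addsmx_sub (negPf nu) andbF.
Qed.

Lemma maxiso_rank (F : finFieldType) (b : 'M[F]_m) (V : flag F m N) : admissible false b ->
  sdflag b V -> maximal_isotropic b (V (inord n)) = (\rank (subsp V n) == d).
Proof.
by move=> adm sV; apply: maximal_isotropic_rank => //; apply: (subsp_isotropic sV).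
Qed.

Lemma good_maxiso : good_kind false m (selfdual_flags_maxiso n).
Proof.
exists (fun f : {ffun 'I_N.+1 -> nat} => f (inord n) == d) => F b V adm fV /=; rewrite ffunE.
case: (boolP (selfdual b V)) => //= sV; apply: maxiso_rank => //; exact/andP.
Qed.

(** Steps [n] and [n.+1] have ranks adding up to [m], and their difference counts the lines in the
    middle step. It is 1 exactly when only the middle line falls there. *)
Lemma lrank_middle r : lvalid false d N r -> (lrank m d N r n == d) = (n \notin r).
Proof.
move=> rv; have [F [b adm]] := exists_admissible mdB.
have := lrankN adm mdB rv (i := n); have [sr rN _] := rv.
have -> : (N - n = n.+1)%N by clear; lia.
have -> : lrank m d N r n.+1 = (lrank m d N r n + \sum_(c < m) (lext m d N r c == n))%N.
  rewrite /lrank -big_split /=; apply: eq_bigr => c _.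
  by rewrite ltnS leq_eqVlt; case: ltngtP.
have dm : (d < m)%N by clear; lia.
rewrite (bigD1 (Ordinal dm)) //=.
(* In dimension 2d + 1 the middle line always falls in the middle step. *)
have -> : lext m d N r d = n by rewrite /lext ltnn; case: ifP; clear; lia.
rewrite eqxx; set s := (\sum_(c < m | _) _)%N.
have -> : (n \notin r) = (s == 0)%N.
  rewrite sum_nat_eq0; apply/idP/forallP => [nr c|h].
    apply/implyP=> cd; rewrite eqb0; apply: contra nr => /eqP; rewrite /lext.
    have cm := ltn_ord c; case: ifP => c1; first by move=> <-; rewrite mem_nth ?sr.
    case: ifP => c2; first by move: cd; rewrite -(inj_eq val_inj) /=; clear -c1 c2; lia.
    have cd' : (m.-1 - c < d)%N by clear -c2 cm; lia.
    have := mem_nth 0%N (s := r) (n := (m.-1 - c)%N); rewrite sr => /(_ cd').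
    have := rN _ cd'; move: (nth 0%N r _) => x xN xr e.
    by have -> : n = x by clear -e xN; move: e; rewrite /=; lia.
  apply/negP => nr; have cd : (index n r < d)%N by rewrite -sr index_mem.
  have cm : (index n r < m)%N by clear -cd; lia.
  have /implyP := h (Ordinal cm); rewrite -(inj_eq val_inj) /= /lext cd nth_index // eqxx.
  by move: cd; clear; case: ltngtP => // _ _ /(_ isT).
have nN : (n <= N)%N by clear; lia.
by move=> /(_ nN); move: s (lrank _ _ _ _ _) => s a; clear; lia.
Qed.

Lemma maxiso_notin (F : finFieldType) (b : 'M[F]_m) (V : flag F m N) C : admissible false b ->
  sdflag b V -> chamber b C ->
  (V \in flags_of (selfdual_flags_maxiso n) b) = (n \notin lab d V C).
Proof.
move=> adm sV chC; have /andP[fV sdV] := sV.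
rewrite inE fV /= sdV /= (maxiso_rank adm sV) (rank_lab adm mdB sV chC); last by clear; lia.
by apply: lrank_middle; apply: (lab_valid mdB adm sV chC).
Qed.

End MaximalIsotropic.

Section Matching.
Variables n d : nat.
Local Notation mB := d.*2.+1.
Local Notation mC := d.*2.
Local Notation YB := (complete_flags mB).
Local Notation YC := (complete_flags mC).

Lemma mdC : mC = (d.*2 + ~~ true)%N.
Proof. by rewrite addn0. Qed.

Lemma bump_iota : map (bump d) (iota 0 d) = iota 0 d.
Proof. by apply: map_id_in => c; rewrite mem_iota /bump => /andP[_ cd]; rewrite leqNgt cd. Qed.

(** Not every sequence is the label of a pair of complete flags, so existence on either side goes
    through reduced words rather than through a description of the labels. *)
Lemma matches_complete : exists be, @matches false true mB mC d YB YC (bump d) be.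
Proof.
have gB := good_complete_flags false mB; have gC := good_complete_flags true mC.
apply: (exists_matches (mdB d) mdC gB gC); first exact: relabels_inj (relabels_bump d).
  move=> W; have [w rw <-] := orbit_word mdC W.
  have [er el] := word_label_map w mdC (relabels_bump d) bump_iota.
  by have [|R eR] := @word_orbit false mB d (mdB d) w; rewrite ?er //; exists R; rewrite eR el.
move=> W; have [w rw <-] := orbit_word (mdB d) W.
have [er el] := word_label_map w mdC (relabels_bump d) bump_iota.
rewrite er in rw; have [R eR] := word_orbit mdC rw.
by exists R; rewrite eR el.
Qed.

Lemma matches_selfdual : exists be,
  @matches false true mB mC d (selfdual_flags n.*2.+1) (selfdual_flags n.*2.+1) id be.
Proof.
have gB := good_selfdual_flags false mB n.*2.+1; have gC := good_selfdual_flags true mC n.*2.+1.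
apply: (exists_matches (mdB d) mdC gB gC) => // R.
  have [sr rN _] := label_valid mdC R gC; rewrite [map id _]map_id.
  by apply: (selfdual_label_orbit (mdB d)); split=> // _; rewrite /= odd_double.
have [sr rN _] := label_valid (mdB d) R gB.
have [|R' e] := @selfdual_label_orbit true mC d mdC n.*2.+1 (labm d (val R)); first by split.
by exists R'; rewrite map_id e.
Qed.

(** Maximal isotropy of [V_n] means that the label avoids the middle step [n]; such labels are the
    images of arbitrary type C labels under [bump n], and [unbump n] recovers them. *)
Lemma matches_maxiso : exists be,
  @matches false true mB mC d (selfdual_flags_maxiso n) (selfdual_flags n.*2) (bump n) be.
Proof.
have gB := good_maxiso n d; have gC := good_selfdual_flags true mC n.*2.
apply: (exists_matches (mdB d) mdC gB gC); first exact: relabels_inj (relabels_bump n).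
  move=> R; have [sr rN _] := label_valid mdC R gC.
  apply: (label_orbit (mdB d) gB).
    split=> [|c cd|_]; first by rewrite size_map.
      by rewrite (nth_map 0%N) ?sr //; have [h _ _] := relabels_bump n; apply/h/rN.
    by rewrite /= odd_double.
  move=> F b V C adm sV chC e; rewrite (maxiso_notin adm sV chC) e.
  by apply/negP => /mapP[x _]; rewrite /bump; clear; lia.
move=> R; have [sr rN _] := label_valid (mdB d) R gB.
have nr : n \notin labm d (val R).
  have [F [b [V [C [adm h]]]]] := witness R gB (good_complete_flags false mB).
  have [VP chC _] := h; have sV := flags_of_sdflag gB adm VP.
  by rewrite (label_of (mdB d) gB adm h) -(maxiso_notin adm sV chC).
have [|R' e] := @selfdual_label_orbit true mC d mdC n.*2 (map (unbump n) (labm d (val R))).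
  split=> [|c cd|//]; first by rewrite size_map.
  rewrite (nth_map 0%N) ?sr //; have := rN c cd.
  have : nth 0%N (labm d (val R)) c != n by apply: contraNneq nr => e0; rewrite -[X in X \in _]e0 mem_nth ?sr.
  by move: (nth _ _ _) => x; rewrite /= /unbump; clear; lia.
exists R'; rewrite e -map_comp; apply/esym/map_id_in => x xr /=.
by apply: unbumpK; rewrite inE; apply: contraNneq nr => e0; rewrite -[X in X \in _]e0.
Qed.

End Matching.

Section NaturalIso.
Variables (d : nat) (P P' : flag_kind) (io : nat -> nat).
Local Notation mB := d.*2.+1.
Local Notation mC := d.*2.
Local Notation YB := (complete_flags mB).
Local Notation YC := (complete_flags mC).
Variables (beY : orbits true mC YC YC -> orbits false mB YB YB)
          (be : orbits true mC P' YC -> orbits false mB P YB).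
Hypotheses (maY : matches d (bump d) beY) (ma : matches d io be).
Hypotheses (gP : good_kind false mB P) (gP' : good_kind true mC P').
Hypothesis rel : relabels (steps P') (steps P) io.

Lemma pullback_seq_elt (r : {ffun 'I_d -> 'I_(steps P)}) (r' : {ffun 'I_d -> 'I_(steps P')}) :
  (forall c, r c = io (r' c) :> nat) ->
  pullback be (seq_elt false mB P d r) = seq_elt true mC P' d r'.
Proof.
move=> e; apply: coef_inj => R.
rewrite coef_pullback (coef_seq_elt (mdB d) _ _ gP) (coef_seq_elt (mdC d) _ _ gP').
have [_ ->] := ma; have -> : [seq nat_of_ord (r c) | c <- enum 'I_d] =
    map io [seq nat_of_ord (r' c) | c <- enum 'I_d].
  by rewrite -map_comp; apply: eq_map => c; apply: e.
by rewrite (inj_eq (inj_map (relabels_inj rel))).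
Qed.

Lemma natural_iso_match (I : Type) (e : I -> orbit_module false mB P YB)
    (e' : I -> orbit_module true mC P' YC) :
  (forall i, pullback be (e i) = e' i) ->
  natural_iso (pullback beY : {linear _ -> _}) e e'.
Proof.
move=> ee; have eB := end_iso (mdB d) gP; have eC := end_iso (mdC d) gP'.
have rB := right_mod (mdB d) gP; have rC := right_mod (mdC d) gP'.
have pc t h := pullback_conv (mdB d) (mdC d) (relabels_bump d) (bump_iota d) maY t h gP gP' rel ma.
have [theta [ath th]] := @exists_transport _ _ _ _ _ _ _ _ eB eC
  (pullback be : {linear _ -> _}) (pullback beY) (pullback_bij ma.1) (pullback_bij maY.1) pc.
exists (pullback be : {linear _ -> _}), theta; split=> //; split=> //.
exact: pullback_bij ma.1.
Qed.

End NaturalIso.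

Theorem proposition6p6 (n d : nat) (hn : (0 < n)%N) (hd : (0 < d)%N) :
  let mB := d.*2.+1 in
  let mC := d.*2 in
  let YB := complete_flags mB in
  let YC := complete_flags mC in
  exists psi : {linear orbit_module false mB YB YB -> orbit_module true mC YC YC},
  [/\ algebra_iso psi,
      forall j : 'I_d, psi (hecke_gen false mB d j) = hecke_gen true mC d j,
      natural_iso psi
        (seq_elt false mB (selfdual_flags n.*2.+1) d)
        (seq_elt true mC (selfdual_flags n.*2.+1) d)
    & natural_iso psi
        (fun r : {ffun 'I_d -> 'I_(n.*2)} =>
           seq_elt false mB (selfdual_flags_maxiso n) d (skip_middle r))
        (seq_elt true mC (selfdual_flags n.*2) d)].
Proof.
move=> mB mC YB YC.
(* Complete flags lose the middle step [d] on passing to type C. The partial flags use the identity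
   of labels in the first case, and the removal of step [n] in the second. *)
have [beY maY] := matches_complete d.
have relY := relabels_bump d; have fixY := bump_iota d.
have gB := good_complete_flags false mB; have gC := good_complete_flags true mC.
exists (pullback beY : {linear _ -> _}); split.
- split; first exact: pullback_bij maY.1.
    exact: (pullback_conv1 (mdB d) (mdC d) relY fixY maY).
  by move=> s t; apply: (pullback_conv (mdB d) (mdC d) relY fixY maY s t gB gC relY maY).
- by move=> j; apply: (pullback_hecke_gen (mdB d) (mdC d) relY fixY maY).
- have [be ma] := matches_selfdual n d.
  have gP := good_selfdual_flags false mB n.*2.+1.
  have gP' := good_selfdual_flags true mC n.*2.+1.
  apply: (natural_iso_match maY ma gP gP' (relabels_id _)) => r.
  by apply: (@pullback_seq_elt d _ _ _ _ ma gP gP' (relabels_id _) r r).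
have [be ma] := matches_maxiso n d.
have gP := good_maxiso n d; have gP' := good_selfdual_flags true mC n.*2.
apply: (natural_iso_match maY ma gP gP' (relabels_bump n)) => r.
apply: (pullback_seq_elt ma gP gP' (relabels_bump n)) => c.
rewrite ffunE /= inordK //; lia.
Qed.
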